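(* Let $h=(h_1,h_2)$ with $h_1,h_2>0$, let $a\in C^\infty(\mathbb T^1)$ be real-valued, $a_0=\int_0^1a(s)\,ds$, and consider the operators on $H^{-\infty}_{L_h}(\Omega)$ $$P=\frac{\partial}{\partial x_1}+a(x_1)\frac{\partial}{\partial x_2},\qquad P_0=\frac{\partial}{\partial x_1}+a_0\frac{\partial}{\partial x_2}.$$ Then $P$ is globally $L_h$-solvable if and only if $P_0$ is globally $L_h$-solvable.
   Context: $\Omega=(0,1)^2$ and $L_h=\partial_{x_1}^2+\partial_{x_2}^2$ on $\Omega$ with boundary conditions (BC), for $j=1,2$: $h_jf|_{x_j=0}=f|_{x_j=1}$ and $h_j\,\partial_{x_j}f|_{x_j=0}=\partial_{x_j}f|_{x_j=1}$, and domain $\mathrm{Dom}(L_h)=\{f\in L^2(\Omega):L_hf\in L^2(\Omega),\ f\text{ satisfies (BC)}\}$. Write $h^x=h_1^{x_1}h_2^{x_2}$. For $\xi\in\mathbb Z^2$, $u_\xi(x)=h^xe^{2\pi ix\cdot\xi}$ and $v_\xi(x)=h^{-x}e^{2\pi ix\cdot\xi}$ are biorthogonal systems of eigenfunctions of $L_h$ and its adjoint $L_h^*$, with eigenvalues $\lambda_\xi=(\log h_1+2\pi i\xi_1)^2+(\log h_2+2\pi i\xi_2)^2$ and $\overline{\lambda_\xi}$. Weight: $\langle\xi\rangle=(1+|\lambda_\xi|^2)^{1/4}$. $H^\infty_{L_h}(\overline\Omega)=\bigcap_{k\ge1}\mathrm{Dom}(L_h^k)$ with seminorms $\max_{j\le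 k}\|L_h^j\varphi\|_{L^2(\Omega)}$ (also written $H^\infty_{L_h}(\Omega)$); $H^\infty_{L_h^*}(\overline\Omega)$ likewise; $H^{-\infty}_{L_h}(\Omega)$ is the space of continuous linear functionals on $H^\infty_{L_h^*}(\overline\Omega)$, containing $H^\infty_{L_h}(\overline\Omega)$ via $\langle\psi,\varphi\rangle=\int_\Omega\psi\varphi\,dx$. The $L_h$-Fourier transform is $\widehat f(\xi)=\int_\Omega f\overline{v_\xi}\,dx$, $\widehat w(\xi)=\langle w,\overline{v_\xi}\rangle$ for distributions. Standing fact: it is a bijective homeomorphism from $H^\infty_{L_h}(\overline\Omega)$ onto the rapidly decaying sequences $\mathcal S(\mathbb Z^2)$ and from $H^{-\infty}_{L_h}(\Omega)$ onto the sequences of moderate (polynomial) growth $\mathcal S'(\mathbb Z^2)$, both measured by $\langle\xi\rangle$ (so $H^\infty_{L_h}(\overline\Omega)=\{h^xg:g\in C^\infty(\mathbb T^2)\}$). Derivatives and multiplication by $b\in C^\infty(\mathbb T^2)$ (in particular $b(x)=a(x_1)$) act on $H^{-\infty}_{L_h}(\Omega)$ by duality: $\langle\partial_{x_j}w,\varphi\rangle=-\langle w,\partial_{x_j}\varphi\rangle$, $\langle bw,\varphi\rangle=\langle w,b\varphi\rangle$. In particular $\widehat{P_0w}(\xi)=\sigma_{P_0}(\xi)\widehat w(\xi)$ with $\sigma_{P_0}(\xi)=\log h_1+2\pi i\xi_1+a_0(\log h_2+2\pi i\xi_2)$. One-variable objects: for $j=1,2$, $u_{\xi_j}(x_j)=h_j^{x_j}e^{2\pi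 ix_j\xi_j}$, $v_{\xi_j}(x_j)=h_j^{-x_j}e^{2\pi ix_j\xi_j}$, $\xi_j\in\mathbb Z$; $L_j=-i\,d/dx_j$ on $(0,1)$ with boundary condition $h_jf(0)=f(1)$ and domain $\{f\in L^2((0,1)):L_jf\in L^2((0,1)),\ h_jf(0)=f(1)\}$; $L_j^*$ its adjoint; $H^\infty_{L_j}((0,1))=\bigcap_k\mathrm{Dom}(L_j^k)$, $H^\infty_{L_j^*}((0,1))$ likewise, and $H^{-\infty}_{L_j}((0,1))$ the continuous dual of $H^\infty_{L_j^*}((0,1))$. For $w\in H^{-\infty}_{L_h}(\Omega)$ and $\xi_2\in\mathbb Z$, $\mathcal F_2w(\cdot,\xi_2)\in H^{-\infty}_{L_1}((0,1))$ is $\langle\mathcal F_2w(\cdot,\xi_2),\varphi\rangle=\langle w,\varphi\times v_{-\xi_2}\rangle$, $(\varphi\times v_{-\xi_2})(x)=\varphi(x_1)v_{-\xi_2}(x_2)$. With $A(x_1)=\int_0^{x_1}a(s)\,ds-x_1a_0$, set $$\Psi_aw(x_1,x_2)=\sum_{\xi_2\in\mathbb Z}e^{(\log h_2+2\pi i\xi_2)A(x_1)}\mathcal F_2w(x_1,\xi_2)u_{\xi_2}(x_2),$$ i.e. $\mathcal F_2(\Psi_aw)(x_1,\xi_2)=e^{(\log h_2+2\pi i\xi_2)A(x_1)}\mathcal F_2w(x_1,\xi_2)$ for all $\xi_2$. Solvability: $\mathbb E_0=\{f\in H^{-\infty}_{L_h}(\Omega):\sigma_{P_0}(\xi)=0\Rightarrow\widehat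 f(\xi)=0\}$, and $P_0$ is globally $L_h$-solvable if $P_0H^{-\infty}_{L_h}(\Omega)=\mathbb E_0$. Let $\mathbb F=\{f\in H^{-\infty}_{L_h}(\Omega):\Psi_af\in\mathbb E_0\}$; $P$ is globally $L_h$-solvable if $PH^{-\infty}_{L_h}(\Omega)=\mathbb F$. *)

(* Defs.v *)
From mathcomp Require Import all_boot all_order all_algebra.
From mathcomp Require Import all_classical all_reals all_analysis.
From mathcomp.real_closed Require Import complex.

Set Implicit Arguments.
Unset Strict Implicit.
Unset Printing Implicit Defensive.

Import Order.TTheory GRing.Theory Num.Theory ComplexField.Normc.
Import numFieldNormedType.Exports.

Local Open Scope classical_set_scope.
Local Open Scope ring_scope.
Local Open Scope complex_scope.

Definition cexp (R : realType) (z : R[i]) : R[i] :=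
  (expR (complex.Re z))%:C * (cos (complex.Im z) +i* sin (complex.Im z)).

(* Unbounded operators on the complex Hilbert space L^2(D, mu), represented by
   their graphs: [T f g] reads "f is in Dom(T) and T f = g".  Elements of L^2
   are functions X -> C of which only the a.e. class on D matters. *)
Section Operators.
Context {d : measure_display} {X : measurableType d} {R : realType}.
Variables (mu : {measure set X -> \bar R}) (D : set X).

Local Notation fct := (X -> R[i]).
Local Notation operator := (fct -> fct -> Prop).

Definition cintegral (f : fct) : R[i] :=
  (\int[mu]_(x in D) complex.Re (f x)) +i*
  (\int[mu]_(x in D) complex.Im (f x)).

Definition L2 (f : fct) : Prop :=
  [/\ measurable_fun D (fun x => complex.Re (f x)),
      measurable_fun D (fun x => complex.Im (f x)) &
      (\int[mu]_(x in D) (normc (f x) ^+ 2)%:E < +oo)%E].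

Definition L2norm (f : fct) : R :=
  Num.sqrt (\int[mu]_(x in D) (normc (f x) ^+ 2)).

Definition inner (f g : fct) : R[i] := cintegral (fun x => f x * (g x)^*).

Definition adjoint (T : operator) : operator := fun f g =>
  [/\ L2 f, L2 g & forall u v, T u v -> inner v f = inner u g].

Fixpoint iterop (T : operator) (k : nat) : operator :=
  if k is k'.+1 then fun f g => exists2 f', T f f' & iterop T k' f' g
  else fun f g => f = g.

Definition opow (T : operator) (k : nat) (f : fct) : fct :=
  xget (fun=> 0) [set g | iterop T k f g].

(* H^oo_T = \bigcap_{k >= 1} Dom(T^k), and its k-th seminorm
   max_{j <= k} ||T^j f|| *)
Definition Hinf (T : operator) (f : fct) : Prop :=
  forall k, (1 <= k)%N -> exists g, iterop T k f g.

Definition Hnorm (T : operator) (k : nat) (f : fct) : R :=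
  \big[Num.max/0]_(j < k.+1) L2norm (opow T j f).

(* Functionals are total on X -> C, but only their values on the test space
   matter: they are compared with [eqd] below. *)
Definition functional := fct -> R[i].

Definition linear_on (T : operator) (w : functional) : Prop :=
  forall (c : R[i]) (phi psi : fct), Hinf T phi -> Hinf T psi ->
    w (fun x => c * phi x + psi x) = c * w phi + w psi.

Definition continuous_on (T : operator) (w : functional) : Prop :=
  forall phi, Hinf T phi -> forall e : R, 0 < e ->
    exists (k : nat) (dl : R), 0 < dl /\
      forall psi, Hinf T psi ->
        Hnorm T k (fun x => psi x - phi x) < dl -> normc (w psi - w phi) < e.

(* H^{-oo}_T is the continuous dual of H^oo_{T^*} *)
Definition Hminf (T : operator) (w : functional) : Prop :=
  linear_on (adjoint T) w /\ continuous_on (adjoint T) w.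

(* equality in H^{-oo}_T *)
Definition eqd (T : operator) (w w' : functional) : Prop :=
  forall phi, Hinf (adjoint T) phi -> w phi = w' phi.

Definition addd (w w' : functional) : functional :=
  fun phi => w phi + w' phi.

Definition muld (b : fct) (w : functional) : functional :=
  fun phi => w (fun x => b x * phi x).

End Operators.

Section Square.
Variable R : realType.

Local Notation C := R[i].
Local Notation R2 := (measurableTypeR R * measurableTypeR R)%type.
Local Notation leb := (@lebesgue_measure R).
Local Notation leb2 := (leb \x leb)%E.

Definition unitI : set (measurableTypeR R) := [set x | 0 < x < 1].
Definition Omega : set R2 := [set x | 0 < x.1 < 1 /\ 0 < x.2 < 1].

(* The direction x_1 is encoded by false and x_2 by true. *)
Definition coord (j : bool) (x : R * R) : R := if j then x.2 else x.1.
Definition evec (j : bool) : R * R := if j then (0, 1) else (1, 0).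
(* the point with x_j = s and t as its other coordinate *)
Definition face (j : bool) (s t : R) : R * R := if j then (t, s) else (s, t).

Fixpoint Ck (n : nat) (f : R * R -> R) : Prop :=
  continuous f /\
  (if n is n'.+1 then
     forall j, (forall x, derivable f x (evec j)) /\ Ck n' ('D_(evec j) f)
   else True).

Definition smooth2 (f : R * R -> C) : Prop :=
  forall n, Ck n (fun x => complex.Re (f x)) /\ Ck n (fun x => complex.Im (f x)).

Definition pd (j : bool) (f : R * R -> C) : R * R -> C := fun x =>
  'D_(evec j) (fun y => complex.Re (f y)) x +i*
  'D_(evec j) (fun y => complex.Im (f y)) x.

Definition laplacian (f : R * R -> C) : R * R -> C := fun x =>
  pd false (pd false f) x + pd true (pd true f) x.

Definition weak_laplacian (f g : R2 -> C) : Prop :=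
  forall psi : R2 -> C, smooth2 psi -> closure [set x | psi x != 0] `<=` Omega ->
    cintegral leb2 Omega (fun x => f x * laplacian psi x) =
    cintegral leb2 Omega (fun x => g x * psi x).

(* psi|_{x_j=0} = h_j psi|_{x_j=1}, and the same for d_{x_j} psi *)
Definition transposed_BC (h : R * R) (psi : R * R -> C) : Prop :=
  forall (j : bool) (t : R), 0 <= t <= 1 ->
    psi (face j 0 t) = (coord j h)%:C * psi (face j 1 t) /\
    pd j psi (face j 0 t) = (coord j h)%:C * pd j psi (face j 1 t).

(* The boundary conditions h_j f|_{x_j=0} = f|_{x_j=1} and
   h_j d_{x_j}f|_{x_j=0} = d_{x_j}f|_{x_j=1} for f in L^2 with weak Laplacian g
   in L^2, in the usual weak sense: the boundary terms of Green's formula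
   vanish against every smooth psi satisfying the transposed conditions.  For f
   in C^2 up to the boundary this is the pointwise condition.  (Traces on the
   open edges alone would not exclude singularities at the corners.) *)
Definition BC (h : R * R) (f g : R2 -> C) : Prop :=
  forall psi : R2 -> C, smooth2 psi -> transposed_BC h psi ->
    cintegral leb2 Omega (fun x => g x * psi x) =
    cintegral leb2 Omega (fun x => f x * laplacian psi x).

Definition Lh (h : R * R) (f g : R2 -> C) : Prop :=
  [/\ L2 leb2 Omega f, L2 leb2 Omega g, weak_laplacian f g & BC h f g].

(* L = -i d/dx on (0,1): f has an absolutely continuous representative F with
   F' = i g and hj F(0) = F(1). *)
Definition L1 (hj : R) (f g : measurableTypeR R -> C) : Prop :=
  [/\ L2 leb unitI f, L2 leb unitI g &
      exists F : measurableTypeR R -> C,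
        [/\ {ae leb, forall x, unitI x -> f x = F x},
            (forall x, 0 <= x <= 1 ->
               F x = F 0 + cintegral leb [set t | 0 < t < x]
                             (fun t => 'i * g t)) &
            hj%:C * F 0 = F 1]].

Local Notation dist1 := (@functional _ (measurableTypeR R) R).
Local Notation dist2 := (@functional _ R2 R).

Definition eqd1 (hj : R) : dist1 -> dist1 -> Prop := eqd leb unitI (L1 hj).
Definition Hminf2 (h : R * R) : dist2 -> Prop := Hminf leb2 Omega (Lh h).
Definition eqd2 (h : R * R) : dist2 -> dist2 -> Prop := eqd leb2 Omega (Lh h).

(* The smooth function in the a.e. class of phi on Omega; its values on Omega
   are unique. *)
Definition smooth_rep (phi : R2 -> C) : R2 -> C :=
  xget (fun=> 0) [set psi : R2 -> C | smooth2 psi /\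
                   {ae leb2, forall x, Omega x -> phi x = psi x}].

Definition derived (j : bool) (w : dist2) : dist2 :=
  fun phi => - w (pd j (smooth_rep phi)).

Definition Pop (a : R -> R) (w : dist2) : dist2 :=
  addd (derived false w) (muld (fun x => (a x.1)%:C) (derived true w)).

(* v_{xi_j}(x) = hj^{-x} e^{2 pi i x xi_j} *)
Definition v1 (hj : R) (xi : int) (x : R) : C :=
  (hj `^ (- x))%:C * cexp (0 +i* (2 * pi * x * xi%:~R)).

Definition v2 (h : R * R) (xi : int * int) (x : R * R) : C :=
  v1 h.1 xi.1 x.1 * v1 h.2 xi.2 x.2.

Definition fourier (h : R * R) (w : dist2) (xi : int * int) : C :=
  w (fun x => (v2 h xi x)^*).

Definition F2 (h : R * R) (w : dist2) (xi2 : int) : dist1 :=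
  fun phi => w (fun x => phi x.1 * v1 h.2 (- xi2) x.2).

(* log hj + 2 pi i xi *)
Definition freq (hj : R) (xi : int) : C := ln hj +i* (2 * pi * xi%:~R).

Definition mean (a : R -> R) : R := \int[leb]_(s in [set s | 0 < s < 1]) a s.

(* A(x) = int_0^x a - x a_0; only x in (0,1) is relevant *)
Definition Aprim (a : R -> R) (x : R) : R :=
  \int[leb]_(s in [set s | 0 < s < x]) a s - x * mean a.

(* w' = Psi_a w *)
Definition is_Psi (h : R * R) (a : R -> R) (w w' : dist2) : Prop :=
  forall xi2 : int,
    eqd1 h.1 (F2 h w' xi2)
      (muld (fun x => cexp (freq h.2 xi2 * (Aprim a x)%:C)) (F2 h w xi2)).

Definition sigmaP0 (h : R * R) (a0 : R) (xi : int * int) : C :=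
  freq h.1 xi.1 + a0%:C * freq h.2 xi.2.

Definition E0 (h : R * R) (a0 : R) (f : dist2) : Prop :=
  Hminf2 h f /\ forall xi, sigmaP0 h a0 xi = 0 -> fourier h f xi = 0.

Definition FF (h : R * R) (a : R -> R) (f : dist2) : Prop :=
  Hminf2 h f /\ exists2 g, E0 h (mean a) g & is_Psi h a f g.

(* the equality of subsets Q H^{-oo}_{L_h} = E of H^{-oo}_{L_h} *)
Definition has_range (h : R * R) (Q : dist2 -> dist2) (E : dist2 -> Prop) :=
  (forall w, Hminf2 h w -> Hminf2 h (Q w) /\ E (Q w)) /\
  (forall f, E f -> exists2 w, Hminf2 h w & eqd2 h (Q w) f).

Definition P_solvable (h : R * R) (a : R -> R) : Prop :=
  has_range h (Pop a) (FF h a).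

Definition P0_solvable (h : R * R) (a : R -> R) : Prop :=
  has_range h (Pop (fun=> mean a)) (E0 h (mean a)).

(* a : T^1 -> R smooth, as a 1-periodic function *)
Definition smooth_periodic (a : R -> R) : Prop :=
  (forall x, a (x + 1) = a x) /\ (forall n x, derivable (derive1n n a) x 1).

End Square.

(* Main.v *)
From mathcomp Require Import all_boot all_order all_algebra.
From mathcomp Require Import all_classical all_reals all_analysis measurable_realfun.
From mathcomp.real_closed Require Import complex.
From mathcomp Require Import ring lra zify.
Require Import Defs.

(** In the partial frequency xi_2, the operator Psi_a multiplies by
    exp ((log h_2 + 2 pi i xi_2) A(x_1)), that is, it translates x_2 by A(x_1).
    By duality Psi_a is therefore the pull-back of test functions along the
    shear (x_1, x_2) |-> (x_1, x_2 - A(x_1)), once the test functions are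
    extended to quasi-periodic functions on the plane and A to a smooth
    1-periodic function; the latter is possible because a - a_0 has mean zero
    ([perprim]).  By the chain rule the shear conjugates P to P_0 ([Psi_P]), and
    the shear along - A inverts it.  So Psi_a is an automorphism of the space of
    distributions that carries the range of P onto the range of P_0 and the
    space F onto E_0 ([FFP]); moreover the range of P_0 always lies in E_0, P_0
    being the multiplication of Fourier coefficients by its symbol ([E0_P0]).
    The two solvability properties are thus the same ([solvable_equiv]).

    Most of the work is to recognize the test functions.  They are given as the
    elements of all the domains of the powers of the adjoint of L_h, which is
    itself defined weakly.  Smooth quasi-periodic functions are test functions
    by the boundary conditions ([adjoint_Q]).  Conversely Green's formula puts
    u_xi in the domain of L_h ([Lh_uu]), so the adjoint multiplies the Fourier
    coefficients of a test function by lambda_xi ([coef_adj]); the coefficients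
    decay rapidly, their series is smooth and quasi-periodic, and the test
    function agrees with it almost everywhere by uniqueness of Fourier
    coefficients ([regular]).  The same estimates compare the seminorms of the
    test space with bounds for the derivatives on boxes ([Hnorm_le],
    [Hnorm_Bd]).  Hence a functional may be composed with any operator on smooth
    quasi-periodic functions that is bounded for these, such as a derivative or
    a shear ([adm_Hminf]), and is determined by its values on exponentials
    ([w_dense]).

    The definition of Psi_a tests with products of a one-variable test function
    and an exponential.  Integration by parts shows that the one-variable
    coefficients decay rapidly too, so that such products are test functions on
    the square ([tensor]), on which the shear acts by the expected factor
    ([is_Psi_shear]); they include all exponentials, so Psi_a w is uniquely
    determined ([is_Psi_unique]). *)

Set Implicit Arguments.
Unset Strict Implicit.
Unset Printing Implicit Defensive.

Import Order.TTheory GRing.Theory Num.Theory ComplexField.Normc.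
Import numFieldNormedType.Exports.
Local Open Scope classical_set_scope.
Local Open Scope ring_scope.
Local Open Scope complex_scope.

(** * Uniqueness of Fourier series on the interval *)

Section Uniqueness1D.
Variable R : realType.
Local Notation leb := (@lebesgue_measure R).
Local Notation I := (@unitI R).

Lemma measurable_unitI : measurable I.
Proof.
have -> : I = [set` `]0%R, 1%R[] by apply/seteqP; split => x /=; rewrite in_itv.
exact: measurable_itv.
Qed.

Lemma lebesgue_unitI : leb I = 1%E.
Proof.
have -> : I = [set` `]0%R, 1%R[] by apply/seteqP; split => x /=; rewrite in_itv.
by rewrite lebesgue_measure_itv /= lte_fin ltr01 oppr0 adde0.
Qed.

Lemma finite_unitI : (leb I < +oo)%E.
Proof. by apply: (@le_lt_trans _ _ 1%E); [rewrite -lebesgue_unitI|exact: ltry]. Qed.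

(** Polynomials that converge, boundedly on [0, 1], to 0 on [0, 1/2[ and to 1 on
    ]1/2, 1]: both limits are squeezed by Bernoulli's inequality, using
    2 ^ n t ^ n -> 0 in the first case and (2 t) ^ - n -> 0 in the second. *)
Definition step_poly (n : nat) (t : R) : R := 1 - (1 - t ^+ n) ^+ (2 ^ n).

Lemma bernoulli (u : R) N : 0 <= u -> 1 + N%:R * u <= (1 + u) ^+ N.
Proof.
move=> u0; elim: N => [|N IH]; first by rewrite mul0r addr0 expr0.
rewrite exprS; apply: (@le_trans _ _ ((1 + u) * (1 + N%:R * u))).
  rewrite -natr1; have : 0 <= N%:R * u * u by rewrite !mulr_ge0.
  by nra.
by rewrite ler_wpM2l// addr_ge0.
Qed.

Lemma bernoulliB (u : R) N : 0 <= u <= 1 -> 1 - N%:R * u <= (1 - u) ^+ N.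
Proof.
move=> /andP[u0 u1]; elim: N => [|N IH]; first by rewrite mul0r subr0 expr0.
rewrite exprS; apply: (@le_trans _ _ ((1 - u) * (1 - N%:R * u))).
  rewrite -natr1; have : 0 <= N%:R * u * u by rewrite !mulr_ge0.
  by nra.
by rewrite ler_wpM2l// subr_ge0.
Qed.

Lemma step_poly_bound n t : 0 <= t <= 1 -> 0 <= step_poly n t <= 1.
Proof.
move=> /andP[t0 t1]; have t0' : 0 <= t ^+ n by rewrite exprn_ge0.
have t1' : t ^+ n <= 1 by rewrite exprn_ile1.
rewrite /step_poly; have : (1 - t ^+ n) ^+ (2 ^ n) <= 1.
  by apply: exprn_ile1; lra.
have : 0 <= (1 - t ^+ n) ^+ (2 ^ n) by rewrite exprn_ge0// subr_ge0.
by move=> ? ?; apply/andP; split; lra.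
Qed.

Lemma cvg_step_poly0 t : 0 <= t < 2^-1 -> step_poly n t @[n --> \oo] --> (0 : R).
Proof.
move=> /andP[t0 t1].
have t1' : t <= 1 by lra.
apply: (@squeeze_cvgr _ _ _ _ (fun=> 0) (fun n => (2 * t) ^+ n)).
- near=> n; have /andP[-> _] : 0 <= step_poly n t <= 1 by apply: step_poly_bound; rewrite t0.
  rewrite /= /step_poly exprMn -natrX.
  have := @bernoulliB (t ^+ n) (2 ^ n).
  by rewrite exprn_ge0// exprn_ile1// => /(_ isT); lra.
- exact: cvg_cst.
- by apply: cvg_expr; rewrite ger0_norm; lra.
Unshelve. all: by end_near. Qed.

Lemma cvg_step_poly1 t : 2^-1 < t <= 1 -> step_poly n t @[n --> \oo] --> (1 : R).
Proof.
move=> /andP[t0 t1]; have tp : 0 < t by lra.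
have -> : (1:R) = 1 - 0 by rewrite subr0.
rewrite /step_poly; apply: cvgB; first exact: cvg_cst.
apply: (@squeeze_cvgr _ _ _ _ (fun=> 0) (fun n => (2 * t)^-1 ^+ n)).
- near=> n; have u0 : 0 <= t ^+ n by rewrite exprn_ge0// ltW.
  have u1 : t ^+ n <= 1 by rewrite exprn_ile1// ltW.
  apply/andP; split; first by rewrite exprn_ge0// subr_ge0.
  rewrite exprVn -[X in X <= _]mulr1 -[X in _ <= X]mul1r ler_pdivlMr ?exprn_gt0//; last lra.
  rewrite mulr1.
  apply: (@le_trans _ _ ((1 - t ^+ n) ^+ (2 ^ n) * (1 + t ^+ n) ^+ (2 ^ n))).
    rewrite ler_wpM2l ?exprn_ge0 ?subr_ge0//.
    by have := @bernoulli (t ^+ n) (2 ^ n) u0; rewrite exprMn -natrX; lra.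
  rewrite -exprMn -subr_sqr expr1n exprn_ile1//; nra.
- exact: cvg_cst.
- apply: cvg_expr; rewrite ger0_norm ?invr_ge0; last lra.
  by rewrite invf_lt1; lra.
Unshelve. all: by end_near. Qed.

Definition trc (k : int) (y : R) : R := cos (2 * pi * y * k%:~R).
Definition trs (k : int) (y : R) : R := sin (2 * pi * y * k%:~R).

Lemma trc1M k y : trc 1 y * trc k y = 2^-1 * (trc (k + 1) y + trc (k - 1) y).
Proof.
rewrite /trc intrB intrD (mulrBr (2 * pi * y)) (mulrDr (2 * pi * y)) cosB cosD; lra.
Qed.
Lemma trc1Ms k y : trc 1 y * trs k y = 2^-1 * (trs (k + 1) y + trs (k - 1) y).
Proof. rewrite /trc /trs intrB intrD (mulrBr (2 * pi * y)) (mulrDr (2 * pi * y)) sinB sinD; lra. Qed.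
Lemma trs1M k y : trs 1 y * trc k y = 2^-1 * (trs (k + 1) y - trs (k - 1) y).
Proof. rewrite /trc /trs intrB intrD (mulrBr (2 * pi * y)) (mulrDr (2 * pi * y)) sinB sinD; lra. Qed.
Lemma trs1Ms k y : trs 1 y * trs k y = 2^-1 * (trc (k - 1) y - trc (k + 1) y).
Proof. rewrite /trc /trs intrB intrD (mulrBr (2 * pi * y)) (mulrDr (2 * pi * y)) cosB cosD; lra. Qed.

(** A trigonometric polynomial of degree one that is positive on ]0, x[ and
    negative on ]x, 1[. *)
Definition arcfun (x y : R) : R := sin (pi * y) * sin (pi * (x - y)).

Lemma arcfunE x y :
  arcfun x y = 2^-1 * (cos (pi * x) * trc 1 y + sin (pi * x) * trs 1 y - cos (pi * x)).
Proof.
rewrite /trc /trs /arcfun mulr1z mulr1.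
have -> : 2 * pi * y = pi * y + pi * y by ring.
rewrite (mulrBr pi x y) sinB cosD sinD.
have := sin2cos2 (pi * y); rewrite !expr2 => e.
have : cos (pi * y) * cos (pi * y) = 1 - sin (pi * y) * sin (pi * y) by lra.
by move=> ->; field.
Qed.

Lemma cont_meas (D : set R) (f : R -> R) : measurable D -> continuous f ->
  measurable_fun D (f : measurableTypeR R -> R).
Proof.
move=> mD cf; apply: (measurable_funS measurableT) => //.
exact: continuous_measurable_fun.
Qed.

(** The test functions against which an integrable function may be integrated. *)
Definition cbd (g : R -> R) := continuous g /\ exists M, forall y, `|g y| <= M.

Lemma cbdM g1 g2 : cbd g1 -> cbd g2 -> cbd (fun y => g1 y * g2 y).
Proof.
move=> [c1 [M1 h1]] [c2 [M2 h2]]; split.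
  by move=> y; apply: continuousM; [exact: c1|exact: c2].
by exists (M1 * M2) => y; rewrite normrM ler_pM.
Qed.

Lemma cbdD g1 g2 : cbd g1 -> cbd g2 -> cbd (fun y => g1 y + g2 y).
Proof.
move=> [c1 [M1 h1]] [c2 [M2 h2]]; split.
  by move=> y; apply: continuousD; [exact: c1|exact: c2].
by exists (M1 + M2) => y; rewrite (le_trans (ler_normD _ _))// lerD.
Qed.

Lemma cbd_cst c : cbd (fun=> c).
Proof. by split; [move=> ?; exact: cst_continuous|exists `|c|]. Qed.

Lemma cbd_trc k : cbd (trc k).
Proof.
split; last by exists 1 => y; rewrite ler_norml cos_geN1 cos_le1.
move=> y; apply: continuous_comp; last exact: continuous_cos.
by apply: continuousM; [apply: continuousM => //; exact: cst_continuous|exact: cst_continuous].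
Qed.

Lemma cbd_trs k : cbd (trs k).
Proof.
split; last by exists 1 => y; rewrite ler_norml sin_geN1 sin_le1.
move=> y; apply: continuous_comp; last exact: continuous_sin.
by apply: continuousM; [apply: continuousM => //; exact: cst_continuous|exact: cst_continuous].
Qed.

Lemma cbd_arcfun x : cbd (arcfun x).
Proof.
rewrite (_ : arcfun x = fun y => 2^-1 * (cos (pi * x) * trc 1 y + sin (pi * x) * trs 1 y + - cos (pi * x))); last first.
  by apply/funext => y; rewrite arcfunE.
apply: cbdM; first exact: cbd_cst.
apply: cbdD; last exact: cbd_cst.
by apply: cbdD; apply: cbdM; try exact: cbd_cst; [exact: cbd_trc|exact: cbd_trs].
Qed.

Lemma cbd_horner g (p : {poly R}) : cbd g -> cbd (fun y => p.[g y]).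
Proof.
move=> cg; elim/poly_ind: p => [|p c IH].
  by under eq_fun do rewrite horner0; exact: cbd_cst.
under eq_fun do rewrite hornerMXaddC.
by apply: cbdD; [exact: cbdM|exact: cbd_cst].
Qed.

Lemma integrable_cbd (f g : R -> R) : leb.-integrable I (EFin \o f) -> cbd g ->
  leb.-integrable I (EFin \o (fun y => f y * g y)).
Proof.
move=> fi [cg [M hM]]; apply: (integrableMl measurable_unitI fi).
  by apply: cont_meas => //; exact: measurable_unitI.
exists M; split; first exact: num_real.
by move=> N MN y _ /=; rewrite (le_trans (hM y))// ltW.
Qed.

Definition annih (f g : R -> R) := cbd g /\ \int[leb]_(y in I) (f y * g y) = 0.

Section Annihilated.
Variable f : R -> R.
Hypothesis fi : leb.-integrable I (EFin \o f).

Lemma annihD g1 g2 : annih f g1 -> annih f g2 -> annih f (fun y => g1 y + g2 y).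
Proof.
move=> [b1 e1] [b2 e2]; split; first exact: cbdD.
transitivity (\int[leb]_(y in I) (f y * g1 y + f y * g2 y)).
  by apply: eq_Rintegral => y _; rewrite mulrDr.
by rewrite (RintegralD measurable_unitI (integrable_cbd fi b1) (integrable_cbd fi b2)) e1 e2 addr0.
Qed.

Lemma annihZ c g : annih f g -> annih f (fun y => c * g y).
Proof.
move=> [b e]; split; first by apply: cbdM => //; exact: cbd_cst.
transitivity (\int[leb]_(y in I) (c * (f y * g y))).
  by apply: eq_Rintegral => y _; rewrite mulrCA.
by rewrite (RintegralZl _ measurable_unitI (integrable_cbd fi b)) e mulr0.
Qed.

(** Multiplying [trc k] or [trs k] by [arcfun x] yields a combination of the
    same functions at frequencies k - 1, k, k + 1, so that the span of all of
    them is stable under polynomials in [arcfun x]. *)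
Lemma poly_arcfun x (p : {poly R}) :
  (forall k, \int[leb]_(y in I) (f y * trc k y) = 0) ->
  (forall k, \int[leb]_(y in I) (f y * trs k y) = 0) ->
  \int[leb]_(y in I) (f y * p.[arcfun x y]) = 0.
Proof.
move=> hc hs.
have ac k : annih f (trc k) by split; [exact: cbd_trc|exact: hc].
have as_ k : annih f (trs k) by split; [exact: cbd_trs|exact: hs].
suff : forall k, annih f (fun y => p.[arcfun x y] * trc k y) /\
    annih f (fun y => p.[arcfun x y] * trs k y).
  move=> /(_ 0)[[_ +] _]; congr (_ = _); apply: eq_Rintegral => y _.
  by rewrite /trc mulr0 cos0 mulr1.
elim/poly_ind: p => [|p c IH] k.
  split; rewrite (_ : (fun y => _) = (fun y => 0 * trc k y)); try exact: annihZ.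
    by apply/funext => y; rewrite horner0 !mul0r.
  by apply/funext => y; rewrite horner0 !mul0r.
pose A := cos (pi * x) * 2^-1; pose B := sin (pi * x) * 2^-1.
pose q y := p.[arcfun x y].
have E (g : R -> R) y : (p * 'X + c%:P).[arcfun x y] * g y =
    q y * (A * (trc 1 y * g y) + B * (trs 1 y * g y) - A * g y) + c * g y.
  by rewrite hornerMXaddC -/(q y) arcfunE /A /B; ring.
split.
  rewrite (_ : (fun y => _) = (fun y => A * 2^-1 * (q y * trc (k + 1) y) + A * 2^-1 * (q y * trc (k - 1) y) +
    (B * 2^-1 * (q y * trs (k + 1) y) + - (B * 2^-1) * (q y * trs (k - 1) y) + (- A * (q y * trc k y) + c * trc k y)))).
    by do !apply: annihD; apply: annihZ => //; [apply: (IH _).1|apply: (IH _).1|apply: (IH _).2|apply: (IH _).2|apply: (IH _).1].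
  by apply/funext => y; rewrite E trc1M trs1M; ring.
rewrite (_ : (fun y => _) = (fun y => A * 2^-1 * (q y * trs (k + 1) y) + A * 2^-1 * (q y * trs (k - 1) y) +
  (B * 2^-1 * (q y * trc (k - 1) y) + - (B * 2^-1) * (q y * trc (k + 1) y) + (- A * (q y * trs k y) + c * trs k y)))).
  by do !apply: annihD; apply: annihZ => //; [apply: (IH _).2|apply: (IH _).2|apply: (IH _).1|apply: (IH _).1|apply: (IH _).2].
by apply/funext => y; rewrite E trc1Ms trs1Ms; ring.
Qed.

End Annihilated.

(** Composing [step_poly n] with (1 + arcfun x) / 2 gives trigonometric polynomials
    that converge boundedly to the indicator function of ]0, x[. *)
Lemma orth_half (f : R -> R) (x : R) : 0 < x < 1 ->
  leb.-integrable I (EFin \o f) ->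
  (forall k, \int[leb]_(y in I) (f y * trc k y) = 0) ->
  (forall k, \int[leb]_(y in I) (f y * trs k y) = 0) ->
  \int[leb]_(y in I) (f y * (y < x)%R%:R) = 0.
Proof.
move=> /andP[x0 x1] fi hc hs.
have mI := measurable_unitI.
pose P (n : nat) : {poly R} := 1 - (1 - (2^-1 *: (1 + 'X)) ^+ n) ^+ (2 ^ n).
have PE n (y : R) : (P n).[arcfun x y] = step_poly n (2^-1 * (1 + arcfun x y)).
  by rewrite /P /step_poly !hornerE.
have tb (y : R) : 0 <= 2^-1 * (1 + arcfun x y) <= 1.
  have : `|arcfun x y| <= 1.
    by rewrite normrM mulr_ile1// ler_norml sin_geN1 sin_le1.
  by rewrite ler_norml => /andP[? ?]; lra.
have mf : measurable_fun I f by have /measurable_int/measurable_EFinP := fi.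
have mlt : measurable_fun I (fun y : R => (y < x)%R%:R : R).
  apply: (@measurable_funS _ _ _ _ setT) => //.
  rewrite (_ : (fun y : R => _) = \1_[set y | y < x]); last first.
    by apply/funext => y; rewrite indicE mem_setE.
  apply: measurable_indic.
  rewrite (_ : mkset _ = [set` `]-oo, x[]) ?measurable_itv//.
have := @dominated_convergence _ _ _ leb I mI
  (fun n y => (f y * (P n).[arcfun x y])%:E) (fun y => (f y * (y < x)%R%:R)%:E)
  (fun y => `|f y|%:E).
case.
- move=> n; apply: (@measurable_int _ _ _ leb).
  by apply: integrable_cbd => //; exact/cbd_horner/cbd_arcfun.
- by apply/measurable_EFinP; exact: measurable_funM.
- exists [set x]; split; first exact: measurable_set1.
    exact: lebesgue_measure_set1.
  move=> y /=; apply: contra_notP => /eqP yx Iy.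
  apply: cvg_EFin; first by apply: nearW.
  rewrite /comp/=; apply: cvgM; first exact: cvg_cst.
  under eq_fun do rewrite PE.
  move: Iy => [y01]; have /andP[y0 y1] : 0 < y < 1 by [].
  have s1 : 0 < sin (pi * y).
    apply: sin_gt0_pi; rewrite mulr_gt0 ?pi_gt0//=.
    by rewrite -[X in _ < X]mulr1 ltr_pM2l// pi_gt0.
  have [yx'|xy] := ltP y x.
    apply: cvg_step_poly1.
    have : 0 < arcfun x y.
      rewrite /arcfun mulr_gt0//; apply: sin_gt0_pi.
      rewrite mulr_gt0 ?pi_gt0 ?subr_gt0//= -[X in _ < X]mulr1 ltr_pM2l ?pi_gt0//; lra.
    by have := tb y; lra.
  apply: cvg_step_poly0.
  have : arcfun x y < 0.
    rewrite /arcfun pmulr_rlt0// -(opprB y x) mulrN sinN oppr_lt0; apply: sin_gt0_pi.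
    rewrite mulr_gt0 ?pi_gt0 ?subr_gt0//=.
      by rewrite -[X in _ < X]mulr1 ltr_pM2l ?pi_gt0//; lra.
    by rewrite lt_neqAle xy eq_sym yx.
  by have := tb y; lra.
- have := integrable_norm fi; congr (_.-integrable _ _).
- apply: aeW => y n Iy /=; rewrite lee_fin normrM PE.
  have /andP[h0 h1] := step_poly_bound n (tb y).
  by rewrite -[X in _ <= X]mulr1 ler_wpM2l// ger0_norm.
move=> _ _ h.
have E : (fun n => (\int[leb]_(y in I) (f y * (P n).[arcfun x y])%:E)%E) = fun=> 0%E.
  apply/funext => n; have := poly_arcfun fi x (P n) hc hs.
  rewrite /Rintegral => e; rewrite -[LHS]fineK ?e//.
  apply: integrable_fin_num => //.
  exact/integrable_cbd/cbd_horner/cbd_arcfun.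
rewrite E in h.
have := cvg_unique (@ereal_hausdorff R) h (cvg_cst 0%E).
by rewrite /Rintegral => ->.
Qed.

(** The primitive of [f] vanishes on the interval, and [f] is its derivative at
    almost every point. *)
Lemma ae0_halves (f : R -> R) : leb.-integrable I (EFin \o f) ->
  (forall x, 0 < x < 1 -> \int[leb]_(y in I) (f y * (y < x)%R%:R) = 0) ->
  {ae leb, forall x, I x -> f x = 0}.
Proof.
move=> fi h.
have mI := measurable_unitI.
have fT : leb.-integrable setT (EFin \o (f \_ I)).
  by rewrite -restrict_EFin; apply/(integrable_mkcond _ mI).1.
have locf : locally_integrable setT (f \_ I : R -> R) := integrable_locally_restrict mI fi.
have intf y : leb.-integrable `]-oo, y] (EFin \o (f \_ I : R -> R)).
  by apply: integrableS fT => //; exact: measurable_itv.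
have := FTC1Ny intf locf; apply: filterS; first exact: (ae_filter_ringOfSetsType leb).
move=> x /= [dF F'] Ix.
have := F'; rewrite patchE mem_set// => <-.
rewrite derive1E; apply: derive_val.
apply: (@near_eq_is_derive _ _ _ (cst 0)).
case: (Ix) => /andP[x0 x1].
near=> y => /=.
have y0 : 0 < y by near: y; exact: lt_nbhsr.
have y1 : y < 1 by near: y; exact: lt_nbhsl.
rewrite -[LHS](h y) ?y0// -Rintegral_itv_bndo_bndc; last first.
  by apply: integrableS fT => //; exact: measurable_itv.
rewrite Rintegral_mkcond [RHS]Rintegral_mkcond; apply: eq_Rintegral => t _.
rewrite !patchE; case: ifPn => tI; case: ifPn => ty //.
- by move: ty; rewrite inE /= in_itv /= => ->; rewrite mulr1.
- by move: ty; rewrite notin_setE /= in_itv /= => /negP/negbTE ->; rewrite mulr0.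
Unshelve. all: by end_near. Qed.

Lemma fourier_unique1 (f : R -> R) :
  leb.-integrable I (EFin \o f) ->
  (forall k, \int[leb]_(y in I) (f y * trc k y) = 0) ->
  (forall k, \int[leb]_(y in I) (f y * trs k y) = 0) ->
  {ae leb, forall x, I x -> f x = 0}.
Proof. by move=> fi hc hs; apply: ae0_halves => // x x01; exact: orth_half. Qed.

End Uniqueness1D.



(** * Complex numbers and complex-valued integrals *)

Section ComplexParts.
Variable R : rcfType.
Implicit Types x y : R[i].
Lemma ReD x y : complex.Re (x + y) = complex.Re x + complex.Re y.
Proof. by case: x y => [? ?] [? ?]. Qed.
Lemma ImD x y : complex.Im (x + y) = complex.Im x + complex.Im y.
Proof. by case: x y => [? ?] [? ?]. Qed.
Lemma ReN x : complex.Re (- x) = - complex.Re x.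
Proof. by case: x. Qed.
Lemma ImN x : complex.Im (- x) = - complex.Im x.
Proof. by case: x. Qed.
Lemma ReM x y : complex.Re (x * y) = complex.Re x * complex.Re y - complex.Im x * complex.Im y.
Proof. by case: x y => [? ?] [? ?]. Qed.
Lemma ImM x y : complex.Im (x * y) = complex.Re x * complex.Im y + complex.Im x * complex.Re y.
Proof. by case: x y => [? ?] [? ?]. Qed.
Lemma ReJ x : complex.Re (Num.conj x) = complex.Re x.
Proof. by case: x. Qed.
Lemma ImJ x : complex.Im (Num.conj x) = - complex.Im x.
Proof. by case: x. Qed.
Lemma Re0 : complex.Re (0 : R[i]) = 0. Proof. by []. Qed.
Lemma Im0 : complex.Im (0 : R[i]) = 0. Proof. by []. Qed.
Lemma Re1 : complex.Re (1 : R[i]) = 1. Proof. by []. Qed.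
Lemma Im1 : complex.Im (1 : R[i]) = 0. Proof. by []. Qed.
Lemma Rei : complex.Re ('i : R[i]) = 0. Proof. by []. Qed.
Lemma Imi : complex.Im ('i : R[i]) = 1. Proof. by []. Qed.
Lemma ReC (c : R) : complex.Re (c%:C) = c. Proof. by []. Qed.
Lemma ImC (c : R) : complex.Im (c%:C) = 0. Proof. by []. Qed.
Lemma Remk (a b : R) : complex.Re (a +i* b) = a. Proof. by []. Qed.
Lemma Immk (a b : R) : complex.Im (a +i* b) = b. Proof. by []. Qed.
Definition cE := (Remk, Immk, ReC, ImC, Re0, Im0, Re1, Im1, Rei, Imi, ReD, ImD, ReN, ImN, ReM, ImM, ReJ, ImJ).

Lemma eqcP x y : complex.Re x = complex.Re y -> complex.Im x = complex.Im y -> x = y.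
Proof. by case: x y => [? ?] [? ?] /= -> ->. Qed.

Lemma conjM x y : Num.conj (x * y) = Num.conj x * Num.conj y.
Proof. by apply: eqcP; rewrite !cE; ring. Qed.
Lemma conj_inj x y : Num.conj x = Num.conj y -> x = y.
Proof. by move=> xy; apply: eqcP; [rewrite -ReJ xy ReJ|apply: oppr_inj; rewrite -!ImJ xy]. Qed.

Lemma normcE x : normc x = Num.sqrt (complex.Re x ^+ 2 + complex.Im x ^+ 2).
Proof. by case: x. Qed.
Lemma normc_nneg x : 0 <= normc x.
Proof. by rewrite normcE sqrtr_ge0. Qed.
Lemma normc_sqr x : normc x ^+ 2 = complex.Re x ^+ 2 + complex.Im x ^+ 2.
Proof. by rewrite normcE sqr_sqrtr// addr_ge0// sqr_ge0. Qed.
Lemma Re_le_normc x : `|complex.Re x| <= normc x.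
Proof. by rewrite normcE -sqrtr_sqr ler_wsqrtr// lerDl sqr_ge0. Qed.
Lemma Im_le_normc x : `|complex.Im x| <= normc x.
Proof. by rewrite normcE -sqrtr_sqr ler_wsqrtr// lerDr sqr_ge0. Qed.
Lemma normc_le_ReIm x : normc x <= `|complex.Re x| + `|complex.Im x|.
Proof.
rewrite -(ger0_norm (normc_nneg x)) -ler_sqr ?nnegrE ?addr_ge0 ?normr_ge0//.
rewrite ger0_norm ?normc_nneg// normc_sqr sqrrD !real_normK ?num_real//.
have := mulr_ge0 (normr_ge0 (complex.Re x)) (normr_ge0 (complex.Im x)); lra.
Qed.
Lemma normcX x n : normc (x ^+ n) = normc x ^+ n.
Proof. by elim: n => [|n IH]; rewrite ?expr0 ?normc1// !exprS normcM IH. Qed.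

Lemma exprD1_le (s : R) m : 0 <= s -> (1 + s) ^+ m <= 2 ^+ m * (1 + s ^+ m).
Proof.
move=> s0; have sm0 : 0 <= s ^+ m by exact: exprn_ge0.
have [s1|s1] := leP s 1.
  apply: (@le_trans _ _ (2 ^+ m)); first by apply: lerXn2r; rewrite ?nnegrE; lra.
  by rewrite ler_peMr ?exprn_ge0// lerDl.
apply: (@le_trans _ _ ((2 * s) ^+ m)); first by apply: lerXn2r; rewrite ?nnegrE; lra.
by rewrite exprMn ler_wpM2l ?exprn_ge0// lerDr.
Qed.
End ComplexParts.

Section ComplexIntegral.
Context {d : measure_display} {X : measurableType d} {R : realType}.
Variables (mu : {measure set X -> \bar R}) (D : set X).
Hypothesis mD : measurable D.
Implicit Types f g : X -> R[i].
Local Notation Re := complex.Re.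
Local Notation Im := complex.Im.

Lemma integrable_RD (f g : X -> R) : mu.-integrable D (EFin \o f) -> mu.-integrable D (EFin \o g) ->
  mu.-integrable D (EFin \o (fun x => f x + g x)).
Proof. by move=> fi gi; have := integrableD mD fi gi; congr (_.-integrable _ _); apply/funext. Qed.

Lemma integrable_RB (f g : X -> R) : mu.-integrable D (EFin \o f) -> mu.-integrable D (EFin \o g) ->
  mu.-integrable D (EFin \o (fun x => f x - g x)).
Proof. by move=> fi gi; have := integrableB mD fi gi; congr (_.-integrable _ _); apply/funext. Qed.

Lemma integrable_RZ (f : X -> R) a : mu.-integrable D (EFin \o f) ->
  mu.-integrable D (EFin \o (fun x => a * f x)).
Proof. by move=> /(integrableZl mD a); congr (_.-integrable _ _); apply/funext. Qed.

Definition cintegrable f :=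
  mu.-integrable D (EFin \o (fun x => Re (f x))) /\
  mu.-integrable D (EFin \o (fun x => Im (f x))).

Definition cmeas f :=
  measurable_fun D (fun x => Re (f x)) /\ measurable_fun D (fun x => Im (f x)).

Lemma cintegrable_meas f : cintegrable f -> cmeas f.
Proof. by move=> [/measurable_int/measurable_EFinP ? /measurable_int/measurable_EFinP]. Qed.

Lemma eqfun_meas (f g : X -> R) : measurable_fun D f -> (forall x, g x = f x) ->
  measurable_fun D g.
Proof. by move=> mf fg; rewrite (_ : g = f)//; apply/funext. Qed.

Lemma cmeasM f g : cmeas f -> cmeas g -> cmeas (fun x => f x * g x).
Proof.
move=> [f1 f2] [g1 g2]; split.
  apply: (eqfun_meas (measurable_funB (measurable_funM f1 g1) (measurable_funM f2 g2))) => x.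
  by rewrite cE.
apply: (eqfun_meas (measurable_funD (measurable_funM f1 g2) (measurable_funM f2 g1))) => x.
by rewrite cE.
Qed.
Lemma cmeasD f g : cmeas f -> cmeas g -> cmeas (fun x => f x + g x).
Proof.
move=> [f1 f2] [g1 g2]; split.
  by apply: (eqfun_meas (measurable_funD f1 g1)) => x; rewrite cE.
by apply: (eqfun_meas (measurable_funD f2 g2)) => x; rewrite cE.
Qed.
Lemma cmeasN f : cmeas f -> cmeas (fun x => - f x).
Proof.
move=> [f1 f2]; split.
  by apply: (eqfun_meas (measurable_funN f1)) => x; rewrite cE.
by apply: (eqfun_meas (measurable_funN f2)) => x; rewrite cE.
Qed.
Lemma cmeasJ f : cmeas f -> cmeas (fun x => Num.conj (f x)).
Proof.
move=> [f1 f2]; split.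
  by apply: (eqfun_meas f1) => x; rewrite cE.
by apply: (eqfun_meas (measurable_funN f2)) => x; rewrite cE.
Qed.
Lemma cmeas_cst c : cmeas (fun=> c).
Proof. by split; exact: measurable_cst. Qed.

Lemma measurable_normc f : cmeas f -> measurable_fun D (fun x => normc (f x)).
Proof.
move=> [m1 m2].
have h := measurable_funD (measurable_funX 2 m1) (measurable_funX 2 m2).
have ms : measurable_fun setT (@Num.sqrt R).
  by apply: continuous_measurable_fun; exact: sqrt_continuous.
by apply: (eqfun_meas (measurableT_comp ms h)) => x; rewrite normcE.
Qed.

Lemma cintegrable_dom f (h : X -> R) : cmeas f -> mu.-integrable D (EFin \o h) ->
  (forall x, D x -> normc (f x) <= h x) -> cintegrable f.
Proof.
move=> [m1 m2] hi fh; split; apply: (le_integrable mD _ _ hi) => //;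
  try exact/measurable_EFinP.
  move=> x Dx /=; rewrite lee_fin (le_trans (Re_le_normc _))//.
  by rewrite (le_trans (fh _ Dx))// ler_norm.
move=> x Dx /=; rewrite lee_fin (le_trans (Im_le_normc _))//.
by rewrite (le_trans (fh _ Dx))// ler_norm.
Qed.

Lemma integrable_normc f : cintegrable f -> mu.-integrable D (EFin \o (fun x => normc (f x))).
Proof.
move=> fi; have [i1 i2] := fi; have := integrableD mD (integrable_norm i1) (integrable_norm i2).
move=> h; apply: (le_integrable mD _ _ h).
  by apply/measurable_EFinP; apply: measurable_normc; exact: cintegrable_meas.
move=> x Dx /=; rewrite lee_fin ger0_norm ?normc_nneg// ger0_norm ?addr_ge0//.
exact: normc_le_ReIm.
Qed.

Lemma cintegrableM f g M : cintegrable f -> cmeas g ->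
  (forall x, D x -> normc (g x) <= M) -> cintegrable (fun x => f x * g x).
Proof.
move=> fi mg gM.
apply: (@cintegrable_dom _ (fun x => M * normc (f x))).
- by apply: cmeasM => //; exact: cintegrable_meas.
- by apply: integrable_RZ; exact: integrable_normc.
- by move=> x Dx; rewrite normcM mulrC ler_wpM2r ?normc_nneg// gM.
Qed.

Lemma cintegrableD f g : cintegrable f -> cintegrable g ->
  cintegrable (fun x => f x + g x).
Proof.
move=> [f1 f2] [g1 g2]; split.
  have := integrableD mD f1 g1; congr (_.-integrable _ _); apply/funext => x /=.
  by rewrite ReD.
have := integrableD mD f2 g2; congr (_.-integrable _ _); apply/funext => x /=.
by rewrite ImD.
Qed.

Lemma cintegrableZ c f : cintegrable f -> cintegrable (fun x => c * f x).
Proof.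
move=> fi; under eq_fun do rewrite mulrC.
apply: (@cintegrableM _ _ (normc c)) => //; exact: cmeas_cst.
Qed.

Lemma cintegralD f g : cintegrable f -> cintegrable g ->
  cintegral mu D (fun x => f x + g x) = cintegral mu D f + cintegral mu D g.
Proof.
move=> [f1 f2] [g1 g2]; rewrite /cintegral; apply: eqcP; rewrite !cE.
  by rewrite -RintegralD//; apply: eq_Rintegral => x _; rewrite cE.
by rewrite -RintegralD//; apply: eq_Rintegral => x _; rewrite cE.
Qed.

Lemma cintegralZ c f : cintegrable f ->
  cintegral mu D (fun x => c * f x) = c * cintegral mu D f.
Proof.
move=> [f1 f2]; rewrite /cintegral.
have i (r : R) (h : X -> R) := @integrable_RZ h r.
apply: eqcP; rewrite !cE -!RintegralZl//.
  rewrite -RintegralB//; [|exact: i|exact: i].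
  by apply: eq_Rintegral => x _; rewrite cE.
rewrite -RintegralD//; [|exact: i|exact: i].
by apply: eq_Rintegral => x _; rewrite cE.
Qed.

Lemma cintegralN f : cintegrable f ->
  cintegral mu D (fun x => - f x) = - cintegral mu D f.
Proof.
move=> fi; rewrite -mulN1r -cintegralZ//; congr cintegral.
by apply/funext => x; rewrite mulN1r.
Qed.

Lemma cintegralJ f : cintegrable f ->
  cintegral mu D (fun x => Num.conj (f x)) = Num.conj (cintegral mu D f).
Proof.
move=> [f1 f2]; rewrite /cintegral; apply: eqcP; rewrite !cE.
  by apply: eq_Rintegral => x _; rewrite cE.
rewrite -mulN1r -RintegralZl//; apply: eq_Rintegral => x _.
by rewrite cE mulN1r.
Qed.

Lemma eq_cintegral f g : (forall x, D x -> f x = g x) ->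
  cintegral mu D f = cintegral mu D g.
Proof.
by move=> fg; rewrite /cintegral; congr (_ +i* _); apply: eq_Rintegral => x;
  rewrite inE => /fg ->.
Qed.

Lemma ae_eq_cintegral f g : cmeas f -> cmeas g ->
  {ae mu, forall x, D x -> f x = g x} -> cintegral mu D f = cintegral mu D g.
Proof.
move=> [f1 f2] [g1 g2] fg; rewrite /cintegral /Rintegral.
by congr (fine _ +i* fine _); apply: ae_eq_integral => //;
  try exact/measurable_EFinP;
  apply: filterS fg => x fg Dx; rewrite (fg Dx).
Qed.

(** The constant 2 comes from estimating the real and the imaginary part
    separately. *)
Lemma normc_cintegral f : cintegrable f ->
  normc (cintegral mu D f) <= 2 * \int[mu]_(x in D) normc (f x).
Proof.
move=> fi; have [i1 i2] := fi; have ni := integrable_normc fi.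
apply: (le_trans (normc_le_ReIm _)); rewrite /cintegral !cE.
rewrite mulr2n mulrDl !mul1r lerD//; apply: (le_trans (le_normr_Rintegral _ _)) => //.
  apply: le_Rintegral => //; last by move=> x _; exact: Re_le_normc.
  by have := integrable_norm i1.
apply: le_Rintegral => //; last by move=> x _; exact: Im_le_normc.
by have := integrable_norm i2.
Qed.

Lemma L2_normsq f : L2 mu D f -> mu.-integrable D (EFin \o (fun x => normc (f x) ^+ 2)).
Proof.
move=> [f1 f2 fi]; apply/integrableP; split.
  by apply/measurable_EFinP; apply: measurable_funX; exact: measurable_normc.
apply: le_lt_trans fi; rewrite le_eqVlt; apply/orP; left; apply/eqP.
by apply: eq_integral => x _; rewrite gee0_abs// lee_fin sqr_ge0.
Qed.

Hypothesis fD : (mu D < +oo)%E.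

Lemma bounded_integrable (f : X -> R) M : measurable_fun D f ->
  (forall x, D x -> `|f x| <= M) -> mu.-integrable D (EFin \o f).
Proof.
move=> mf fM; apply: measurable_bounded_integrable => //.
exists M; split; first exact: num_real.
by move=> N MN x Dx /=; rewrite (le_trans (fM _ Dx))// ltW.
Qed.

Lemma L2_integrable f : L2 mu D f -> cintegrable f.
Proof.
move=> f2; have [m1 m2 _] := f2.
apply: (@cintegrable_dom _ (fun x => 1 + normc (f x) ^+ 2)).
- by split.
- apply: integrable_RD; last exact: L2_normsq.
  by apply: (@bounded_integrable _ 1) => [|x _]; [exact: measurable_cst|rewrite normr1].
- by move=> x _; have := sqr_ge0 (normc (f x) - 1); rewrite sqrrB1; have := normc_nneg (f x); nra.
Qed.

Lemma bounded_L2 f M : cmeas f -> (forall x, D x -> normc (f x) <= M) -> L2 mu D f.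
Proof.
move=> mf fM; split; [exact: mf.1|exact: mf.2|].
have mn := measurable_normc mf.
have /integrableP[_] : mu.-integrable D (EFin \o (fun x => normc (f x) ^+ 2)).
  apply: (@bounded_integrable _ (M ^+ 2)); first exact: measurable_funX.
  move=> x Dx; rewrite ger0_norm ?sqr_ge0// ler_sqr ?nnegrE ?normc_nneg ?fM//.
  exact: le_trans (normc_nneg _) (fM _ Dx).
apply: le_lt_trans; rewrite le_eqVlt; apply/orP; left; apply/eqP.
by apply: eq_integral => x _; rewrite gee0_abs// lee_fin sqr_ge0.
Qed.

End ComplexIntegral.

(** * Uniqueness of Fourier series on the square *)

Section Uniqueness2D.
Variable R : realType.
Local Notation leb := (@lebesgue_measure R).
Local Notation I := (@unitI R).
Local Notation R2 := (measurableTypeR R * measurableTypeR R)%type.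
Local Notation leb2 := (leb \x leb)%E.
Local Notation Om := (@Omega R).

Lemma OmegaE : Om = I `*` I.
Proof. by []. Qed.

Lemma measurable_Omega : measurable Om.
Proof. by rewrite OmegaE; apply: measurableX; exact: measurable_unitI. Qed.

Lemma lebesgue_Omega : leb2 Om = 1%E.
Proof.
rewrite OmegaE product_measure1E; [|exact: measurable_unitI..].
by rewrite -[X in _ = X]mule1; congr (_ * _)%E; exact: lebesgue_unitI.
Qed.

Lemma finite_Omega : (leb2 Om < +oo)%E.
Proof. by apply: (@le_lt_trans _ _ 1%E); [rewrite -lebesgue_Omega|exact: ltry]. Qed.

Lemma patch_Omega (f : R2 -> R) x y :
  (f \_ Om) (x, y) = ((fun x => ((fun y => f (x, y)) \_ I) y) \_ I) x.
Proof.
have [Ix|nIx] := pselect (I x); last first.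
  by rewrite [RHS]patchE (memNset nIx) patchE memNset//; case.
rewrite [RHS]patchE (mem_set Ix).
have [Iy|nIy] := pselect (I y); last first.
  by rewrite [RHS]patchE (memNset nIy) patchE memNset//; case.
by rewrite [RHS]patchE (mem_set Iy) patchE mem_set.
Qed.

Lemma integrable_patch_Omega (f : R2 -> R) : leb2.-integrable Om (EFin \o f) ->
  leb2.-integrable setT (EFin \o (f \_ Om)).
Proof.
by move=> fi; rewrite -restrict_EFin; apply/(integrable_mkcond _ measurable_Omega).1.
Qed.

(** Obtained from Fubini's theorem on the plane by extending [f] with 0
    outside the square. *)
Lemma fubini_Omega (f : R2 -> R) : leb2.-integrable Om (EFin \o f) ->
  let G x := \int[leb]_(y in I) f (x, y) in
  [/\ leb.-integrable I (EFin \o G), \int[leb]_(x in I) G x = \int[leb2]_(z in Om) f z &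
      {ae leb, forall x, I x -> leb.-integrable I (EFin \o (fun y => f (x, y)))}].
Proof.
move=> fi G.
have mO := measurable_Omega; have mI := @measurable_unitI R.
have fT := integrable_patch_Omega fi.
have ae1 := ae_integrable1 fT.
have GE x : I x -> fubini_F leb (EFin \o (f \_ Om)) x = (\int[leb]_(y in I) (f (x, y))%:E)%E.
  move=> Ix; rewrite /fubini_F [RHS]integral_mkcond; apply: eq_integral => y _.
  by rewrite /= patch_Omega patchE mem_set// restrict_EFin.
have G0 x : ~ I x -> fubini_F leb (EFin \o (f \_ Om)) x = 0%E.
  move=> Ix; rewrite /fubini_F integral0_eq// => y _ /=.
  by rewrite patch_Omega patchE memNset.
have ae2 : {ae leb, forall x, I x -> leb.-integrable I (EFin \o (fun y => f (x, y)))}.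
  apply: filterS ae1 => x /= H Ix; apply/(integrable_mkcond _ mI).
  rewrite (_ : _ \_ I = (fun y => ((f \_ Om) (x, y))%:E))//.
  by apply/funext => y; rewrite patch_Omega [in RHS]patchE mem_set// restrict_EFin.
have iF := integrable_fubini_F fT.
have aeG : {ae leb, forall x, I x -> fubini_F leb (EFin \o (f \_ Om)) x = (G x)%:E}.
  apply: filterS ae2 => x h Ix; rewrite GE// /G /Rintegral fineK//.
  by apply: integrable_fin_num => //; exact: h.
have iFI : leb.-integrable I (fubini_F leb (EFin \o (f \_ Om))).
  by apply: integrableS iF.
have mF := measurable_int _ iFI.
have GF x : I x -> G x = fine (fubini_F leb (EFin \o (f \_ Om)) x).
  by move=> Ix; rewrite GE.
have mG : measurable_fun I (EFin \o G).
  apply/measurable_EFinP.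
  apply: (eq_measurable_fun (fun x => fine (fubini_F leb (EFin \o (f \_ Om)) x))).
    by move=> x; rewrite inE => Ix; rewrite GF.
  by apply: (@measurableT_comp _ _ _ _ _ _ fine) => //; exact: measurable_fine.
split => //.
  apply: (le_integrable mI mG _ iFI) => x Ix /=.
  rewrite GF//; case: (fubini_F _ _ x) => [r| |] //=.
  by rewrite normr0 leey.
  by rewrite normr0 leey.
rewrite /Rintegral (@ae_eq_integral _ _ _ _ _ (fubini_F leb (EFin \o (f \_ Om)))) //; last first.
  by apply: filterS aeG => x h Ix; rewrite h.
rewrite (integral_mkcond Om) restrict_EFin -(integral12_prod_meas1 fT).
rewrite integral_mkcond; congr fine; apply: eq_integral => x _.
by rewrite patchE; case: ifPn => //; rewrite notin_setE => /G0 ->.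
Qed.

Definition phase (k l : int) (z : R2) : R := 2 * pi * z.1 * k%:~R + 2 * pi * z.2 * l%:~R.

Lemma measurable_snd_cont (g : R -> R) : continuous g ->
  measurable_fun setT (fun z : R2 => g z.2).
Proof.
move=> cg; have h : measurable_fun setT (g : measurableTypeR R -> R) by exact: continuous_measurable_fun.
exact: (measurableT_comp h measurable_snd).
Qed.
Lemma measurable_fst_cont (g : R -> R) : continuous g ->
  measurable_fun setT (fun z : R2 => g z.1).
Proof.
move=> cg; have h : measurable_fun setT (g : measurableTypeR R -> R) by exact: continuous_measurable_fun.
exact: (measurableT_comp h measurable_fst).
Qed.

Lemma integrable_cbd2 (f : R2 -> R) (g h : R -> R) :
  leb2.-integrable Om (EFin \o f) -> cbd g -> cbd h ->
  leb2.-integrable Om (EFin \o (fun z => f z * (g z.1 * h z.2))).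
Proof.
move=> fi [cg [M hM]] [ch [N hN]]; apply: (integrableMl measurable_Omega fi).
  apply: measurable_funTS; apply: measurable_funM.
    exact: measurable_fst_cont.
  exact: measurable_snd_cont.
exists (M * N); split; first exact: num_real.
by move=> K MNK z _ /=; rewrite normrM (le_trans _ (ltW MNK))// ler_pM.
Qed.

Lemma fubini_cbd (f : R2 -> R) (g h : R -> R) :
  leb2.-integrable Om (EFin \o f) -> cbd g -> cbd h ->
  let G x := \int[leb]_(y in I) (f (x, y) * h y) in
  leb.-integrable I (EFin \o G) /\
  \int[leb]_(x in I) (G x * g x) = \int[leb2]_(z in Om) (f z * (g z.1 * h z.2)).
Proof.
move=> fi cg ch G; have mI := @measurable_unitI R.
have i1 := integrable_cbd2 fi (cbd_cst 1) ch.
have i2 := integrable_cbd2 fi cg ch.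
have [a1 b1 c1] := fubini_Omega i1.
have [a2 b2 c2] := fubini_Omega i2.
have GE : G = fun x => \int[leb]_(y in I) (f (x, y) * (1 * h y)).
  by apply/funext => x; apply: eq_Rintegral => y _; rewrite mul1r.
have iG : leb.-integrable I (EFin \o G) by rewrite GE.
split=> //; rewrite -b2 /=; rewrite /Rintegral; congr fine.
apply: ae_eq_integral => //.
- by apply: (@measurable_int _ _ _ leb); exact: integrable_cbd.
- exact: (measurable_int _ a2).
apply: filterS c1 => x cx Ix; congr EFin; rewrite GE -RintegralZr//; last exact: cx.
by apply: eq_Rintegral => y _ /=; ring.
Qed.

(** Each Fourier coefficient in the second variable is a function of the
    first one with zero Fourier coefficients, so it vanishes almost
    everywhere.  These coefficients are countably many, hence almost every
    restriction of [f] to a vertical line has all its coefficients zero and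
    vanishes almost everywhere. *)
Lemma fourier_unique2_prod (f : R2 -> R) :
  leb2.-integrable Om (EFin \o f) ->
  (forall k l, [/\ \int[leb2]_(z in Om) (f z * (trc k z.1 * trc l z.2)) = 0,
     \int[leb2]_(z in Om) (f z * (trc k z.1 * trs l z.2)) = 0,
     \int[leb2]_(z in Om) (f z * (trs k z.1 * trc l z.2)) = 0 &
     \int[leb2]_(z in Om) (f z * (trs k z.1 * trs l z.2)) = 0]) ->
  {ae leb2, forall z, Om z -> f z = 0}.
Proof.
move=> fi hf; have mI := @measurable_unitI R; have mO := measurable_Omega.
have hc l : {ae leb, forall x, I x -> \int[leb]_(y in I) (f (x, y) * trc l y) = 0}.
  have [iG _] := fubini_cbd fi (cbd_cst 1) (@cbd_trc R l).
  apply: fourier_unique1 => // k.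
    by have [_ ->] := fubini_cbd fi (@cbd_trc R k) (@cbd_trc R l); case: (hf k l).
  by have [_ ->] := fubini_cbd fi (@cbd_trs R k) (@cbd_trc R l); case: (hf k l).
have hs l : {ae leb, forall x, I x -> \int[leb]_(y in I) (f (x, y) * trs l y) = 0}.
  have [iG _] := fubini_cbd fi (cbd_cst 1) (@cbd_trs R l).
  apply: fourier_unique1 => // k.
    by have [_ ->] := fubini_cbd fi (@cbd_trc R k) (@cbd_trs R l); case: (hf k l).
  by have [_ ->] := fubini_cbd fi (@cbd_trs R k) (@cbd_trs R l); case: (hf k l).
have hc' : {ae leb, forall x, forall n : nat, forall l, unpickle n = Some l -> I x ->
    \int[leb]_(y in I) (f (x, y) * trc l y) = 0}.
  apply: ae_foralln => n; case: (unpickle n) => [l|]; last exact: aeW.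
  by apply: filterS (hc l) => x h l' [<-].
have hs' : {ae leb, forall x, forall n : nat, forall l, unpickle n = Some l -> I x ->
    \int[leb]_(y in I) (f (x, y) * trs l y) = 0}.
  apply: ae_foralln => n; case: (unpickle n) => [l|]; last exact: aeW.
  by apply: filterS (hs l) => x h l' [<-].
have [_ _ fub] := fubini_Omega fi.
have fx : {ae leb, forall x, I x -> {ae leb, forall y, I y -> f (x, y) = 0}}.
  apply: filterS3 hc' hs' fub => x h1 h2 h3 Ix.
  apply: fourier_unique1 => [|k|k]; first exact: h3.
    by apply: (h1 (pickle k)) => //; rewrite pickleK.
  by apply: (h2 (pickle k)) => //; rewrite pickleK.
have fT := integrable_patch_Omega fi.
have mfT := measurable_int _ fT.
have int0 : (\int[leb2]_z `|(EFin \o (f \_ Om)) z| = 0)%E.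
  rewrite fubini_tonelli1//; last exact: measurableT_comp.
  rewrite (@ae_eq_integral _ _ _ _ _ (cst 0%E))//; first exact: integral0.
    by apply: measurable_fun_fubini_tonelli_F => //; exact: measurableT_comp.
  apply: filterS fx => x hx _; rewrite /fubini_F.
  have [Ix|nIx] := pselect (I x); last first.
    by rewrite integral0_eq// => y _ /=; rewrite patch_Omega patchE memNset// normr0.
  rewrite (@ae_eq_integral _ _ _ _ _ (cst 0%E))//; first exact: integral0.
    apply: measurableT_comp => //; exact: (measurableT_comp (measurable_int _ fT) (pair1_measurable x)).
  apply: filterS (hx Ix) => y hy _ /=; rewrite patch_Omega patchE mem_set//.
  by rewrite patchE; case: ifPn => [|_]; rewrite ?normr0// inE => /hy ->; rewrite normr0.
have /ae_eq_integral_abs := int0; move=> /(_ measurableT mfT).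
apply: filterS => z h Oz; have := h Logic.I; rewrite /= patchE mem_set//; by case.
Qed.

Lemma cexp_i (t : R) : cexp (0 +i* t) = cos t +i* sin t.
Proof. by rewrite /cexp /= expR0 mul1r. Qed.

Lemma measurable_phase (g : R -> R) k l : continuous g ->
  measurable_fun setT (fun z : R2 => g (phase k l z)).
Proof.
move=> cg; have mg : measurable_fun setT (g : measurableTypeR R -> R) by exact: continuous_measurable_fun.
have m1 : measurable_fun setT (phase k l : R2 -> measurableTypeR R).
  apply: measurable_funD.
    apply: (@measurable_fst_cont (fun x => 2 * pi * x * k%:~R)) => x.
    by apply: continuousM; [apply: continuousM => //; exact: cst_continuous|exact: cst_continuous].
  apply: (@measurable_snd_cont (fun x => 2 * pi * x * l%:~R)) => x.
  by apply: continuousM; [apply: continuousM => //; exact: cst_continuous|exact: cst_continuous].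
exact: (measurableT_comp mg m1).
Qed.

Lemma cmeas_char k l : cmeas Om (fun z => cexp (0 +i* phase k l z)).
Proof.
by split; under eq_fun do rewrite cexp_i /=; apply: measurable_funTS;
  [exact: (measurable_phase _ _ (@continuous_cos R))|exact: (measurable_phase _ _ (@continuous_sin R))].
Qed.

Lemma normc_char k l z : normc (cexp (0 +i* phase k l z)) <= 1.
Proof. by rewrite cexp_i normcE /= addrC sin2cos2 subrK sqrtr1. Qed.

(** Each product of a cosine or sine in x and one in y is a combination of
    the four characters whose frequencies are k or - k in x and l or - l in
    y. *)
Lemma fourier_unique2 (f : R2 -> R[i]) : cintegrable leb2 Om f ->
  (forall k l, cintegral leb2 Om (fun z => f z * cexp (0 +i* phase k l z)) = 0) ->
  {ae leb2, forall z, Om z -> f z = 0}.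
Proof.
move=> fi hf; have [f1 f2] := fi; have mO := measurable_Omega.
have ci k l c : cintegrable leb2 Om (fun z => c * (f z * cexp (0 +i* phase k l z))).
  apply: cintegrableZ => //; apply: (@cintegrableM _ _ _ _ _ _ _ _ 1) => //.
    exact: cmeas_char.
  by move=> z _; exact: normc_char.
pose null (g : R2 -> R) := \int[leb2]_(z in Om) (complex.Re (f z) * g z) = 0 /\
  \int[leb2]_(z in Om) (complex.Im (f z) * g z) = 0.
have key (g : R2 -> R) k l c1 c2 c3 c4 :
   (forall z, (g z)%:C = c1 * cexp (0 +i* phase k l z) + c2 * cexp (0 +i* phase (- k) (- l) z)
     + (c3 * cexp (0 +i* phase k (- l) z) + c4 * cexp (0 +i* phase (- k) l z))) ->
   null g.
  move=> gE.
  have : cintegral leb2 Om (fun z => f z * (g z)%:C) = 0.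
    transitivity (cintegral leb2 Om (fun z => (c1 * (f z * cexp (0 +i* phase k l z)) + c2 * (f z * cexp (0 +i* phase (- k) (- l) z)))
     + (c3 * (f z * cexp (0 +i* phase k (- l) z)) + c4 * (f z * cexp (0 +i* phase (- k) l z))))).
      by apply: eq_cintegral => z _; rewrite gE; ring.
    rewrite !cintegralD//; do ?[exact: ci|exact: cintegrableD].
    have ci1 k' l' : cintegrable leb2 Om (fun z => f z * cexp (0 +i* phase k' l' z)).
      by have := ci k' l' 1; under eq_fun do rewrite mul1r.
    by rewrite !cintegralZ// !hf !mulr0 !addr0.
  move=> [e1 e2]; split.
    by rewrite -[RHS]e1; apply: eq_Rintegral => z _; rewrite !cE mulr0 subr0.
  by rewrite -[RHS]e2; apply: eq_Rintegral => z _; rewrite !cE mulr0 add0r.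
have phN k l z : phase (- k) (- l) z = - phase k l z by rewrite /phase !mulrNz; ring.
have phB k l z : phase (- k) l z = - phase k (- l) z by rewrite /phase !mulrNz; ring.
have cosph k l (z : R2) : cos (phase k l z) = trc k z.1 * trc l z.2 - trs k z.1 * trs l z.2.
  by rewrite /phase cosD.
have sinph k l (z : R2) : sin (phase k l z) = trs k z.1 * trc l z.2 + trc k z.1 * trs l z.2.
  by rewrite /phase sinD.
have trcN k x : trc (- k) x = trc k x by rewrite /trc mulrNz mulrN cosN.
have trsN k x : trs (- k) x = - trs k x by rewrite /trs mulrNz mulrN sinN.
have simpl := (cexp_i, phB, phN, cosN, sinN, cosph, sinph, trcN, trsN).
have all4 k l : [/\ 
   null (fun z => trc k z.1 * trc l z.2),
   null (fun z => trc k z.1 * trs l z.2),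
   null (fun z => trs k z.1 * trc l z.2) &
   null (fun z => trs k z.1 * trs l z.2)].
  pose q : R := 4^-1.
  split; [apply: (key _ k l q%:C q%:C q%:C q%:C)|
          apply: (key _ k l (0 -i* q) (0 +i* q) (0 +i* q) (0 -i* q))|
          apply: (key _ k l (0 -i* q) (0 +i* q) (0 -i* q) (0 +i* q))|
          apply: (key _ k l (- q)%:C (- q)%:C q%:C q%:C)];
  by move=> z; rewrite !simpl; apply: eqcP; rewrite !cE /q; field.
have a1 := fourier_unique2_prod f1; have a2 := fourier_unique2_prod f2.
have {}a1 : {ae leb2, forall z, Om z -> complex.Re (f z) = 0}.
  by apply: a1 => k0 l0; case: (all4 k0 l0) => -[? _] [? _] [? _] [? _].
have {}a2 : {ae leb2, forall z, Om z -> complex.Im (f z) = 0}.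
  by apply: a2 => k0 l0; case: (all4 k0 l0) => -[_ ?] [_ ?] [_ ?] [_ ?].
apply: filterS2 a1 a2 => z h1 h2 Oz; apply: eqcP; rewrite !cE; [exact: h1|exact: h2].
Qed.

End Uniqueness2D.

(** * Functions of class C^n on the plane *)

Section SmoothReal.
Variable R : realType.
Local Notation R2 := (R * R)%type.
Implicit Types f g : R2 -> R.
Local Notation e_ j := (@evec R j).

Lemma is_derive_line f x j t df : is_derive (x + t *: e_ j) (e_ j) f df ->
  is_derive t 1 (fun t => f (x + t *: e_ j)) df.
Proof.
have E : (fun h : R => h^-1 *: (((fun t => f (x + t *: e_ j)) \o shift t) (h *: 1) - f (x + t *: e_ j)))
   = (fun h => h^-1 *: ((f \o shift (x + t *: e_ j)) (h *: e_ j) - f (x + t *: e_ j))).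
  apply/funext => h /=; congr (_ *: (f _ - _)).
  by rewrite scalerDl addrCA [h *: 1]mulr1.
move=> [dr dv]; split.
  by rewrite /derivable E.
by rewrite /derive E.
Qed.

Lemma derivable_line0 f x j df : is_derive (0 : R) 1 (fun t => f (x + t *: e_ j)) df ->
  is_derive x (e_ j) f df.
Proof.
have E : (fun h : R => h^-1 *: (((fun t => f (x + t *: e_ j)) \o shift 0) (h *: 1) - f (x + 0 *: e_ j)))
   = (fun h => h^-1 *: ((f \o shift x) (h *: e_ j) - f x)).
  by apply/funext => h /=; rewrite scale0r !addr0 [h *: 1]mulr1 (addrC x).
move=> [dr dv]; split.
  by move: dr; rewrite /derivable E.
by move: dv; rewrite /derive E.
Qed.

Lemma mvt0 (g dg : R -> R) (t : R) : (forall s : R, is_derive s 1 g (dg s)) ->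
  exists2 c, `|c| <= `|t| & g t - g 0 = dg c * t.
Proof.
move=> dG; have cg : continuous g.
  by move=> s; apply: differentiable_continuous; apply/derivable1_diffP; case: (dG s).
have [t0|t0|<-] := ltgtP 0 t; last by exists 0 => //; rewrite subrr mulr0.
- have [|c cI ->] := @MVT R g dg 0 t t0 (fun s _ => dG s).
    by apply: continuous_subspaceT.
  exists c; last by rewrite subr0.
  by move: cI; rewrite in_itv/= => /andP[c0 ct]; rewrite !gtr0_norm// ltW.
- have [|c cI e] := @MVT R g dg t 0 t0 (fun s _ => dG s).
    by apply: continuous_subspaceT.
  exists c; last by move: e; rewrite sub0r mulrN => e; rewrite -opprB e opprK.
  by move: cI; rewrite in_itv/= => /andP[c0 ct]; rewrite !ltr0_norm// lerN2 ltW.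
Qed.

Lemma CkS n f : Ck n.+1 f -> Ck n f.
Proof.
elim: n f => [|n IH] f [cf df]; split => // j; case: (df j) => d1 d2; split => //.
exact: IH.
Qed.

Lemma Ck_le m n f : (m <= n)%N -> Ck n f -> Ck m f.
Proof.
move=> mn; rewrite -(subnK mn); elim: (n - m)%N => // k IH.
by rewrite addSn => /CkS.
Qed.

Lemma Ck_cont n f : Ck n f -> continuous f.
Proof. by case: n => [|n] []. Qed.

Lemma Ck_derive n f x j : Ck n.+1 f -> is_derive x (e_ j) f ('D_(e_ j) f x).
Proof. by move=> [_ /(_ j) [/(_ x) d _]]; exact/derivableP. Qed.

Lemma Ck_intro n f (df : bool -> R2 -> R) : continuous f ->
  (forall j x, is_derive x (e_ j) f (df j x)) -> (forall j, Ck n (df j)) ->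
  Ck n.+1 f.
Proof.
move=> cf dE ck; split => // j; split.
  by move=> x; case: (dE j x).
rewrite (_ : 'D_(e_ j) f = df j)//.
by apply/funext => x; exact: (@derive_val _ _ _ _ _ _ _ (dE j x)).
Qed.

Lemma derE f df j : (forall x, is_derive x (e_ j) f (df x)) -> 'D_(e_ j) f = df.
Proof.
by move=> h; apply/funext => x; exact: (@derive_val _ _ _ _ _ _ _ (h x)).
Qed.

Lemma Ck_cst n c : Ck n (fun=> c : R).
Proof.
elim: n c => [|n IH] c; first by split => // x; exact: cst_continuous.
apply: (@Ck_intro _ _ (fun _ _ => 0)) => //.
by move=> x; exact: cst_continuous.
Qed.

Lemma derD f g j : (forall x, derivable f x (e_ j)) -> (forall x, derivable g x (e_ j)) ->
  forall x, is_derive x (e_ j) (fun x => f x + g x) ('D_(e_ j) f x + 'D_(e_ j) g x).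
Proof.
move=> df dg x.
by have /derivableP h1 := df x; have /derivableP h2 := dg x; apply: is_deriveD.
Qed.

Lemma derM f g j : (forall x, derivable f x (e_ j)) -> (forall x, derivable g x (e_ j)) ->
  forall x, is_derive x (e_ j) (fun x => f x * g x) (f x * 'D_(e_ j) g x + g x * 'D_(e_ j) f x).
Proof.
move=> df dg x.
by have /derivableP h1 := df x; have /derivableP h2 := dg x; apply: is_deriveM.
Qed.

Lemma CkD n f g : Ck n f -> Ck n g -> Ck n (fun x => f x + g x).
Proof.
elim: n f g => [|n IH] f g kf kg.
  by split=> // x; apply: continuousD; [exact: (Ck_cont kf)|exact: (Ck_cont kg)].
apply: (@Ck_intro _ _ (fun j x => 'D_(e_ j) f x + 'D_(e_ j) g x)).
- by move=> x; apply: continuousD; [exact: (Ck_cont kf)|exact: (Ck_cont kg)].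
- by move=> j x; apply: derD => y; [case: kf => _ /(_ j) []|case: kg => _ /(_ j) []].
- by move=> j; apply: IH; [case: kf => _ /(_ j) []|case: kg => _ /(_ j) []].
Qed.

Lemma CkM n f g : Ck n f -> Ck n g -> Ck n (fun x => f x * g x).
Proof.
elim: n f g => [|n IH] f g kf kg.
  by split=> // x; apply: continuousM; [exact: (Ck_cont kf)|exact: (Ck_cont kg)].
apply: (@Ck_intro _ _ (fun j x => f x * 'D_(e_ j) g x + g x * 'D_(e_ j) f x)).
- by move=> x; apply: continuousM; [exact: (Ck_cont kf)|exact: (Ck_cont kg)].
- by move=> j x; apply: derM => y; [case: kf => _ /(_ j) []|case: kg => _ /(_ j) []].
- move=> j; apply: CkD; apply: IH; do ?exact: CkS;
  by [case: kg => _ /(_ j) []|case: kf => _ /(_ j) []].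
Qed.

Lemma CkN n f : Ck n f -> Ck n (fun x => - f x).
Proof.
move=> kf; have := CkM (Ck_cst n (-1)) kf.
by under eq_fun do rewrite mulN1r.
Qed.

Definition box (K : R) (x : R2) := `|x.1| <= K /\ `|x.2| <= K.

(** Bounds for all the derivatives of order at most [n] on the box of
    half-side [K].  These play the role of the seminorms of the space of
    smooth functions. *)
Fixpoint Bd K n f M : Prop :=
  (forall x, box K x -> `|f x| <= M) /\
  (if n is n'.+1 then forall j, Bd K n' ('D_(e_ j) f) M else True).

Lemma Bd_val K n f M : Bd K n f M -> forall x, box K x -> `|f x| <= M.
Proof. by case: n => [|n] []. Qed.

Lemma BdS K n f M : Bd K n.+1 f M -> Bd K n f M.
Proof. by elim: n f => [|n IH] f [h1 h2]; split => // j; exact: IH. Qed.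

Lemma Bd_le K n m f M : (m <= n)%N -> Bd K n f M -> Bd K m f M.
Proof.
move=> mn; rewrite -(subnK mn); elim: (n - m)%N => // k IH.
by rewrite addSn => /BdS.
Qed.

Lemma Bd_mono K n f M N : M <= N -> Bd K n f M -> Bd K n f N.
Proof.
move=> MN; elim: n f => [|n IH] f [h1 h2]; split => //.
- by move=> x bx; rewrite (le_trans (h1 _ bx)).
- by move=> x bx; rewrite (le_trans (h1 _ bx)).
- by move=> j; exact: IH (h2 j).
Qed.

Lemma Bd_box K K' n f M : K <= K' -> Bd K' n f M -> Bd K n f M.
Proof.
move=> KK; have bb x : box K x -> box K' x.
  by move=> [h1 h2]; split; apply: (le_trans _ KK).
elim: n f => [|n IH] f [h1 h2]; split => //.
- by move=> x /bb; exact: h1.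
- by move=> x /bb; exact: h1.
- by move=> j; exact: IH (h2 j).
Qed.

Lemma BdD K n f g M N : Ck n f -> Ck n g -> Bd K n f M -> Bd K n g N ->
  Bd K n (fun x => f x + g x) (M + N).
Proof.
elim: n f g => [|n IH] f g kf kg [f1 f2] [g1 g2].
  by split=> // x bx; rewrite (le_trans (ler_normD _ _))// lerD ?f1 ?g1.
split; first by move=> x bx; rewrite (le_trans (ler_normD _ _))// lerD ?f1 ?g1.
case: kf => cf kf; case: kg => cg kg.
move=> j; rewrite (derE (@derD f g j (kf j).1 (kg j).1)).
by apply: IH; [exact: (kf j).2|exact: (kg j).2|exact: f2|exact: g2].
Qed.

Lemma BdM K n f g M N : 0 <= M -> 0 <= N -> Ck n f -> Ck n g -> Bd K n f M -> Bd K n g N ->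
  Bd K n (fun x => f x * g x) (2 ^+ n * (M * N)).
Proof.
move=> M0 N0; elim: n f g => [|n IH] f g kf kg bf bg.
  by split=> // x bx; rewrite expr0 mul1r normrM ler_pM//; [exact: (Bd_val bf)|exact: (Bd_val bg)].
split.
  move=> x bx; apply: (@le_trans _ _ (1 * (M * N))).
    by rewrite mul1r normrM ler_pM//; [exact: (Bd_val bf)|exact: (Bd_val bg)].
  by rewrite ler_wpM2r ?mulr_ge0// exprn_ege1// ler1n.
have [_ f2] := bf; have [_ g2] := bg.
move: (kf) (kg) => [cf kf'] [cg kg'].
move=> j; rewrite (derE (@derM f g j (kf' j).1 (kg' j).1)).
rewrite exprS -mulrA mulr2n mulrDl !mul1r; apply: BdD.
- by apply: CkM; [exact: CkS|exact: (kg' j).2].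
- by apply: CkM; [exact: CkS|exact: (kf' j).2].
- by apply: IH; [exact: CkS|exact: (kg' j).2|exact: BdS|exact: g2].
- under eq_fun do rewrite mulrC.
  by apply: IH; [exact: (kf' j).2|exact: CkS|exact: f2|exact: BdS].
Qed.

Lemma box_compact K : compact (box K).
Proof.
have -> : box K = `[- K, K]%classic `*` `[- K, K]%classic.
  apply/seteqP; split => -[x y] [] /=.
    by rewrite /box /= !ler_norml !in_itv.
  by rewrite !in_itv /= => h1 h2; split; rewrite ler_norml.
by apply: compact_setX; exact: segment_compact.
Qed.

Lemma cont_bounded_box K f : continuous f -> exists2 M, 0 <= M & forall x, box K x -> `|f x| <= M.
Proof.
move=> cf; have := @continuous_compact _ _ f (box K).
have cw : {within box K, continuous f} by exact: continuous_subspaceT.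
move=> /(_ cw (@box_compact K)) /compact_bounded [M [_ hM]].
exists (`|M| + 1); first by rewrite addr_ge0.
move=> x bx; apply: (hM (`|M| + 1)); last by exists x.
by rewrite ltr_pwDr// ler_norm.
Qed.

Lemma Bd_exists K n f : Ck n f -> exists2 M, 0 <= M & Bd K n f M.
Proof.
elim: n f => [|n IH] f kf.
  by have [M M0 h] := cont_bounded_box K (Ck_cont kf); exists M.
have [M M0 h] := cont_bounded_box K (Ck_cont kf).
have [cf kd] := kf.
have [M1 M10 h1] := IH _ (kd false).2; have [M2 M20 h2] := IH _ (kd true).2.
exists (M + M1 + M2); first by rewrite !addr_ge0.
split; first by move=> x bx; rewrite (le_trans (h _ bx))// -addrA lerDl addr_ge0.
case; first by apply: Bd_mono h2; rewrite lerDr addr_ge0.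
by apply: Bd_mono h1; rewrite addrAC lerDr addr_ge0.
Qed.

(** The regularity clause of [smooth_periodic], for functions that need not
    be periodic. *)
Definition smooth1 (g : R -> R) := forall n x, derivable (derive1n n g) x 1.

Lemma smooth1_derive (g : R -> R) : smooth1 g -> smooth1 (derive1 g).
Proof. by move=> sg n x; have := sg n.+1 x; rewrite derive1Sn. Qed.

Lemma smooth1_der (g : R -> R) (x : R) : smooth1 g -> is_derive x 1 g (derive1 g x).
Proof. by move=> /(_ 0%N x) h; rewrite derive1E; exact/derivableP. Qed.

Lemma smooth1_cont (g : R -> R) : smooth1 g -> continuous g.
Proof.
move=> sg x; apply: differentiable_continuous; apply/derivable1_diffP.
by case: (smooth1_der x sg).
Qed.

Lemma fst_der j (g : R -> R) x : smooth1 g ->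
  is_derive x (e_ j) (fun x : R2 => g x.1) (if j then 0 else derive1 g x.1).
Proof.
move=> sg; apply: derivable_line0; case: j => /=.
  rewrite (_ : (fun t : R => _) = (fun=> g x.1)); first exact: is_derive_cst.
  by apply/funext => t; rewrite scaler0 addr0.
rewrite (_ : (fun t : R => _) = g \o (fun t => x.1 + t)); last first.
  by apply/funext => t; rewrite /= [t *: 1]mulr1.
have h1 : is_derive (0 : R) 1 (fun t : R => x.1 + t) 1.
  by rewrite -[X in is_derive _ _ _ X]add0r; apply: is_deriveD.
have h2 : is_derive (x.1 + 0) 1 g (derive1 g x.1) by rewrite addr0; exact: smooth1_der.
rewrite -[derive1 g _]mulr1; exact: is_derive1_comp.
Qed.

Lemma Ck_fst n (g : R -> R) : smooth1 g -> Ck n (fun x : R2 => g x.1).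
Proof.
elim: n g => [|n IH] g sg.
  by split=> // x; apply: continuous_comp; [exact: cvg_fst|exact: smooth1_cont].
apply: (@Ck_intro _ _ (fun j x => if j then 0 else derive1 g x.1)).
- by move=> x; apply: continuous_comp; [exact: cvg_fst|exact: smooth1_cont].
- by move=> j x; exact: fst_der.
- by case; [exact: Ck_cst|apply: IH; exact: smooth1_derive].
Qed.

End SmoothReal.

(** * Shears of the plane *)

Section Shear.
Variable R : realType.
Local Notation R2 := (R * R)%type.
Implicit Types f : R2 -> R.
Local Notation e_ j := (@evec R j).

Lemma der_small (F : R -> R) (l : R) :
  (forall e : R, 0 < e -> \forall t \near (0 : R), `|F t - F 0 - t * l| <= e * `|t|) ->
  is_derive (0 : R) 1 F l.
Proof.
move=> h.
have c : (h0^-1 *: ((F \o shift 0) (h0 *: 1) - F 0)) @[h0 --> 0^'] --> l.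
  apply/cvgrPdist_le => e e0.
  have h1 : \forall t \near 0^', `|F t - F 0 - t * l| <= e * `|t|.
    by apply: cvg_within; exact: h.
  near=> t.
  have t0 : t != 0 by near: t; exact: nbhs_dnbhs_neq.
  rewrite /= addr0 [t *: 1]mulr1.
  have -> : l - t^-1 *: (F t - F 0) = - t^-1 * (F t - F 0 - t * l).
    by rewrite /GRing.scale /=; field.
  rewrite normrM normrN normfV ler_pdivrMl ?normr_gt0// (mulrC _ e).
  by near: t; exact: h1.
split; first by apply/cvg_ex; exists l.
exact/cvg_lim.
Unshelve. all: by end_near. Qed.

Definition shear_map (A : R -> R) (x : R2) : R2 := (x.1, x.2 - A x.1).

Lemma shear_map_cont A : continuous A -> continuous (shear_map A).
Proof.
move=> cA x.
have c1 : {for x, continuous (fun x : R2 => A x.1)}.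
  by apply: continuous_comp; [exact: cvg_fst|exact: cA].
have c2 : {for x, continuous (fun x : R2 => x.2 - A x.1)}.
  by apply: (@continuousB _ _ _ (fun x : R2 => x.2) (fun x => A x.1)); [exact: cvg_snd|exact: c1].
exact: (cvg_pair (@cvg_fst _ _ (nbhs x.1) (nbhs x.2) _) c2).
Qed.

Lemma shear_der2 f A x : Ck 1 f ->
  is_derive x (e_ true) (fun x => f (shear_map A x)) ('D_(e_ true) f (shear_map A x)).
Proof.
move=> kf; apply: derivable_line0.
have -> : (fun t : R => f (shear_map A (x + t *: e_ true))) = (fun t => f (shear_map A x + t *: e_ true)).
  apply/funext => t; congr f; rewrite /shear_map /=; congr pair; rewrite /= ?scaler0 ?addr0//.
  by rewrite addrAC.
apply: is_derive_line; rewrite scale0r addr0; exact: (Ck_derive _ _ kf).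
Qed.

Lemma mvt_line f j (x : R2) (t : R) : Ck 1 f -> exists2 c, `|c| <= `|t| &
  f (x + t *: e_ j) - f x = 'D_(e_ j) f (x + c *: e_ j) * t.
Proof.
move=> kf; have [|c ct h] := @mvt0 R (fun s => f (x + s *: e_ j)) (fun s => 'D_(e_ j) f (x + s *: e_ j)) t.
  by move=> s; apply: is_derive_line; exact: (Ck_derive _ _ kf).
by exists c => //; rewrite -h scale0r addr0.
Qed.

(** Partial derivatives only give derivatives along lines, and the shear does
    not map horizontal lines to lines.  So f (x_1 + t, b t) - f (x_1, b 0) is
    split at f (x_1, b t): the first part is handled by the mean value
    theorem and the continuity of the first partial derivative, the second
    one by the chain rule on a vertical line. *)
Lemma shear_der1 f A x : Ck 1 f -> smooth1 A ->
  is_derive x (e_ false) (fun x => f (shear_map A x))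
    ('D_(e_ false) f (shear_map A x) + - derive1 A x.1 * 'D_(e_ true) f (shear_map A x)).
Proof.
move=> kf sA; apply: derivable_line0.
pose b t := x.2 - A (x.1 + t).
have bE : b 0 = x.2 - A x.1 by rewrite /b addr0.
pose F t := f (x.1 + t, b t) - f (x.1, b t).
pose H t := f (x.1, b t).
have -> : (fun t : R => f (shear_map A (x + t *: e_ false))) = (fun t => F t + H t).
  apply/funext => t; rewrite /F /H subrK /shear_map /b /= scaler0 addr0.
  by rewrite [t *: 1]mulr1.
have db : is_derive (0 : R) 1 b (- derive1 A x.1).
  rewrite -[- _]add0r; apply: is_deriveB.
  have h1 : is_derive (0 : R) 1 (fun t : R => x.1 + t) 1.
    by rewrite -[X in is_derive _ _ _ X]add0r; apply: is_deriveD.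
  have h2 : is_derive (x.1 + 0) 1 A (derive1 A (x.1)) by rewrite addr0; exact: smooth1_der.
  rewrite -[derive1 A _]mulr1; exact: is_derive1_comp.
apply: is_deriveD.
  apply: der_small => e e0.
  have F0 : F 0 = 0 by rewrite /F addr0 subrr.
  have cD : {for shear_map A x, continuous ('D_(e_ false) f)}.
    by case: kf => _ /(_ false)[_ [h _]]; exact: h.
  have [d d0 hd] : exists2 d, 0 < d & forall y, `|y.1 - (shear_map A x).1| < d -> `|y.2 - (shear_map A x).2| < d ->
      `|'D_(e_ false) f y - 'D_(e_ false) f (shear_map A x)| <= e.
    move/cvgrPdist_le : cD => /(_ _ e0); rewrite -nbhs_ballE => -[d d0 hd].
    exists d => // y y1 y2; rewrite distrC; apply: hd; split; rewrite -ball_normE /= distrC.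
      exact: y1.
    exact: y2.
  have cb : {for 0, continuous b}.
    by apply: differentiable_continuous; apply/derivable1_diffP; case: db.
  have nb : \forall t \near (0 : R), `|b t - b 0| < d.
    by move/cvgrPdist_lt : cb => /(_ _ d0); apply: filterS => t; rewrite distrC.
  have nt : \forall t \near (0 : R), `|t| < d.
    have /cvgrPdist_lt : (t : R) @[t --> 0] --> (0 : R) by exact: cvg_id.
    by move=> /(_ _ d0); apply: filterS => t; rewrite sub0r normrN.
  apply: filterS2 nb nt => t bt td.
  rewrite F0 subr0 /F.
  have [c ct] := @mvt_line f false (x.1, b t) t kf.
  have -> : (x.1, b t) + t *: e_ false = (x.1 + t, b t).
    by congr pair => /=; rewrite ?scaler0 ?addr0// [t *: 1]mulr1.
  move=> ->; rewrite mulrC -mulrBr normrM mulrC ler_wpM2r//.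
  apply: hd => /=.
    by rewrite [c *: 1]mulr1 addrAC subrr add0r (le_lt_trans ct).
  by rewrite scaler0 addr0 -bE.
have h2 : is_derive (b 0) 1 (fun s => f (x.1, s)) ('D_(e_ true) f (shear_map A x)).
  have -> : (fun s => f (x.1, s)) = (fun s => f ((x.1, 0) + s *: e_ true)).
    apply/funext => s; congr f; congr pair => /=; rewrite ?scaler0 ?addr0//.
    by rewrite add0r [s *: 1]mulr1.
  apply: is_derive_line.
  have -> : (x.1, 0) + b 0 *: e_ true = shear_map A x.
    by congr pair => /=; rewrite ?scaler0 ?addr0// add0r [_ *: 1]mulr1 bE.
  exact: (Ck_derive _ _ kf).
by rewrite mulrC; exact: (@is_derive1_comp _ (fun s => f (x.1, s)) b).
Qed.

Lemma smooth1_Ck_dN n A : smooth1 A -> Ck n (fun x : R2 => - derive1 A x.1).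
Proof. by move=> sA; apply: CkN; apply: Ck_fst; exact: smooth1_derive. Qed.

Lemma Ck_shear n f A : smooth1 A -> Ck n f -> Ck n (fun x => f (shear_map A x)).
Proof.
move=> sA; have cS := shear_map_cont (smooth1_cont sA).
elim: n f => [|n IH] f kf.
  by split=> // x; apply: continuous_comp; [exact: cS|exact: (Ck_cont kf)].
have kf1 : Ck 1 f by apply: Ck_le kf.
apply: (@Ck_intro _ _ _ (fun j x => if j then 'D_(e_ true) f (shear_map A x) else
   'D_(e_ false) f (shear_map A x) + - derive1 A x.1 * 'D_(e_ true) f (shear_map A x))).
- by move=> x; apply: continuous_comp; [exact: cS|exact: (Ck_cont kf)].
- by case=> x; [exact: shear_der2|exact: shear_der1].
- have [_ kd] := kf; case => /=; first exact: (IH _ (kd true).2).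
  apply: CkD; first exact: (IH _ (kd false).2).
  by apply: CkM; [exact: smooth1_Ck_dN|exact: (IH _ (kd true).2)].
Qed.

(** The box [K'] depends only on a bound for [A] on [- K, K]; it is the same
    for all orders, which makes the induction on the order work. *)
Lemma Bd_shear A K : smooth1 A -> exists K', forall n, exists2 C, 0 <= C &
  forall f M, 0 <= M -> Ck n f -> Bd K' n f M -> Bd K n (fun x => f (shear_map A x)) (C * M).
Proof.
move=> sA.
have [B B0 hB] := @cont_bounded_box R K (fun x => A x.1) (Ck_cont (Ck_fst 0 sA)).
exists (K + B).
have bb x : box K x -> box (K + B) (shear_map A x).
  move=> bx; split => /=; first by apply: (le_trans bx.1); rewrite lerDl.
  by rewrite (le_trans (ler_normB _ _))// lerD ?bx.2// hB.
elim=> [|n [C C0 IH]].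
  by exists 1 => // f M M0 kf [h1 _]; split => // x bx; rewrite mul1r; apply: h1; exact: bb.
have [N N0 hN] := Bd_exists K (smooth1_Ck_dN n sA).
exists (1 + C + 2 ^+ n * (N * C)); first by rewrite !addr_ge0// !mulr_ge0// exprn_ge0.
move=> f M M0 kf [h1 h2].
have kf1 : Ck 1 f by apply: Ck_le kf.
have [_ kd] := kf.
split.
  move=> x /bb bx; apply: (le_trans (h1 _ bx)).
  by rewrite ler_peMl// -addrA lerDl addr_ge0// !mulr_ge0// exprn_ge0.
case.
  rewrite (derE (fun x => @shear_der2 f A x kf1)).
  have := IH _ _ M0 (kd true).2 (h2 true); apply: Bd_mono.
  by rewrite ler_wpM2r// [1 + C]addrC -addrA lerDl addr_ge0// !mulr_ge0// exprn_ge0.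
rewrite (derE (fun x => @shear_der1 f A x kf1 sA)).
have b1 := IH _ _ M0 (kd false).2 (h2 false).
have b2 := IH _ _ M0 (kd true).2 (h2 true).
have k1 := Ck_shear sA (kd false).2.
have k2 := Ck_shear sA (kd true).2.
have b3 := BdM N0 (mulr_ge0 C0 M0) (smooth1_Ck_dN n sA) k2 hN b2.
have := BdD k1 (CkM (smooth1_Ck_dN n sA) k2) b1 b3.
apply: Bd_mono.
rewrite !mulrDl -!mulrA mul1r.
by rewrite -addrA lerDr.
Qed.

End Shear.

(** * Integration of derivatives over the square *)

Section PlaneIntegrals.
Variable R : realType.
Local Notation leb := (@lebesgue_measure R).
Local Notation I := (@unitI R).
Local Notation R2 := (measurableTypeR R * measurableTypeR R)%type.
Local Notation leb2 := (leb \x leb)%E.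
Local Notation Om := (@Omega R).
Local Notation e_ j := (@evec R j).

(** The measurable structure of the plane is the product one: an open set is
    the union of the squares with rational centre and radius that it
    contains. *)
Lemma continuous_measurable2 (f : R * R -> R) : continuous f ->
  measurable_fun setT (f : R2 -> R).
Proof.
move=> cf; apply: (measurability _ (@RGenOpens.measurableE R)).
move=> _ [_ [a [b ->] <-]]; rewrite setTI.
have oU : open (f @^-1` `]a, b[%classic).
  by move/continuousP : cf; apply; exact: interval_open.
set U := f @^-1` _ in oU *.
pose rc (q : rat * rat * rat) : set R2 :=
  ball (ratr q.1.1 : R) (ratr q.2 : R) `*` ball (ratr q.1.2 : R) (ratr q.2 : R).
have mrc q : measurable (rc q) by apply: measurableX; exact: measurable_ball.
pose F (n : nat) : set R2 := if unpickle n is Some q then (if `[< rc q `<=` U >] then rc q else set0) else set0.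
have -> : U = \bigcup_n F n.
  apply/seteqP; split.
    move=> x Ux; have := oU; rewrite openE => /(_ _ Ux); rewrite /interior -nbhs_ballE => -[d /= d0 hd].
    have [r /andP[r0 rd]] : exists r : rat, (0 : R) < ratr r < d / 2.
      have d2 : 0 < d / 2 by rewrite divr_gt0.
      have [r] := rat_in_itvoo d2.
      by rewrite in_itv /= => h; exists r.
    have near1 (y : R) : exists q : rat, `|y - ratr q| < ratr r.
      have yr : y < y + ratr r by rewrite ltrDl.
      have [q] := rat_in_itvoo yr; rewrite in_itv /= => /andP[q1 q2]; exists q.
      by rewrite ltr0_norm ?subr_lt0//; lra.
    have [q1 h1] := near1 x.1; have [q2 h2] := near1 x.2.
    exists (pickle (q1, q2, r)); first exact: Logic.I.
    rewrite /F pickleK.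
    case: asboolP => [_|]; first by split => /=; rewrite -ball_normE /= distrC.
    case=> y [/= y1 y2]; apply: hd; split.
      move: y1; rewrite -!ball_normE /= => y1.
      have -> : x.1 - y.1 = (x.1 - ratr q1) + (ratr q1 - y.1) by ring.
      by rewrite (le_lt_trans (ler_normD _ _))//; lra.
    move: y2; rewrite -!ball_normE /= => y2.
    have -> : x.2 - y.2 = (x.2 - ratr q2) + (ratr q2 - y.2) by ring.
    by rewrite (le_lt_trans (ler_normD _ _))//; lra.
  move=> x [n _]; rewrite /F; case: (unpickle n) => // q.
  by case: asboolP => // h; exact: h.
apply: bigcupT_measurable => n; rewrite /F; case: (unpickle n) => // q.
by case: asboolP.
Qed.

Lemma Omega_box x : Om x -> box (1 : R) x.
Proof. by move=> [/andP[? ?] /andP[? ?]]; split; rewrite gtr0_norm// ltW. Qed.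

Lemma bounded_integrable_Omega (f : R2 -> R) M : measurable_fun Om f ->
  (forall x, Om x -> `|f x| <= M) -> leb2.-integrable Om (EFin \o f).
Proof. exact: (bounded_integrable (@measurable_Omega R) (@finite_Omega R)). Qed.

Lemma continuous_integrable_Omega (f : R * R -> R) : continuous f ->
  leb2.-integrable Om (EFin \o f).
Proof.
move=> cf; have [M M0 hM] := @cont_bounded_box R 1 _ cf.
apply: (@bounded_integrable_Omega _ M).
  by apply: measurable_funTS; exact: continuous_measurable2.
by move=> x /Omega_box; exact: hM.
Qed.

Lemma ftc_open (g dg : R -> R) (y x : R) : y <= x -> (forall s : R, is_derive s 1 g (dg s)) ->
  continuous dg ->
  (\int[leb]_(t in [set t | (y < t < x)%R]) (dg t)%:E = (g x - g y)%:E)%E.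
Proof.
rewrite le_eqVlt => /predU1P[<-|yx] dG cd.
  rewrite (_ : mkset _ = set0) ?integral_set0 ?subrr//.
  apply/seteqP; split => t //= /andP[t0 /(lt_trans t0)]; by rewrite ltxx.
have -> : [set t | (y < t < x)%R] = [set` `]y, x[].
  by apply/seteqP; split => t /=; rewrite in_itv.
have cg : continuous g.
  by move=> s; apply: differentiable_continuous; apply/derivable1_diffP; case: (dG s).
have mdg : measurable_fun [set` `]y, x[] dg by exact: cont_meas.
rewrite -(@integral_itv_bndoo _ _ _ _ true false)//; last exact/measurable_EFinP.
apply: (@continuous_FTC2 R dg g) => //.
- exact: continuous_subspaceT.
- split.
  + by move=> t _; case: (dG t).
  + exact/cvg_at_right_filter/cg.
  + exact/cvg_at_left_filter/cg.
- by move=> t _; rewrite derive1E; exact: (@derive_val _ _ _ _ _ _ _ (dG t)).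
Qed.

Lemma unitIE : I = [set t | 0 < t < 1]. Proof. by []. Qed.

Lemma integral_der_line (F G : R * R -> R) j (x : R * R) :
  (forall x, is_derive x (e_ j) F (G x)) -> continuous G ->
  (\int[leb]_(t in I) (G (x + t *: e_ j))%:E = (F (x + 1 *: e_ j) - F x)%:E)%E.
Proof.
move=> dF cG; have := @ftc_open (fun t => F (x + t *: e_ j)) (fun t => G (x + t *: e_ j)) 0 1 ler01.
rewrite scale0r addr0; apply.
- by move=> s; apply: is_derive_line.
- move=> t; have cl : {for t, continuous (fun t : R => x + t *: e_ j)}.
    by apply: continuousD; [exact: cst_continuous|exact: scalel_continuous].
  have : {for t, continuous (G \o (fun t : R => x + t *: e_ j))} by apply: continuous_comp => //; exact: cG.
  exact.
Qed.

(** The divergence theorem on the square, for fluxes that cancel on opposite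
    faces. *)
Lemma div0 (F G : R * R -> R) j : continuous F ->
  (forall x, is_derive x (e_ j) F (G x)) -> continuous G ->
  (forall t, 0 < t < 1 -> F (face j 0 t) = F (face j 1 t)) ->
  \int[leb2]_(x in Om) G x = 0.
Proof.
move=> cF dF cG hF.
have mO := measurable_Omega; have mI := @measurable_unitI R.
have iG := continuous_integrable_Omega cG.
have fT := integrable_patch_Omega iG.
have inner t : I t -> (\int[leb]_(s in I) (G (face j s t))%:E = 0)%E.
  move=> It; have := @integral_der_line F G j (face j 0 t) dF cG.
  have E s : face j 0 t + s *: e_ j = face j s t.
    by case: j {dF hF} => /=; congr pair; rewrite /= ?scaler0 ?addr0// add0r [s *: 1]mulr1.
  rewrite E -hF// subrr => h; rewrite -[RHS]h.
  by apply: eq_integral => s _; rewrite E.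
rewrite /Rintegral integral_mkcond restrict_EFin.
case: j dF hF inner => dF hF inner.
  rewrite -(integral12_prod_meas1 fT) integral0_eq// => x _; rewrite /fubini_F.
  have [Ix|nIx] := pselect (I x); last first.
    by rewrite integral0_eq// => y _ /=; rewrite patch_Omega patchE memNset.
  rewrite -[RHS](inner x Ix) [RHS]integral_mkcond; apply: eq_integral => y _.
  by rewrite /= patch_Omega patchE mem_set// restrict_EFin.
rewrite -(integral21_prod_meas1 fT) integral0_eq// => y _; rewrite /fubini_G.
have [Iy|nIy] := pselect (I y); last first.
  rewrite integral0_eq// => x _ /=; rewrite patch_Omega patchE.
  by case: ifPn => // _; rewrite patchE memNset.
rewrite -[RHS](inner y Iy) [RHS]integral_mkcond; apply: eq_integral => x _.
rewrite /= patch_Omega restrict_EFin; congr EFin.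
by rewrite [LHS]patchE [RHS]patchE; case: ifPn => // _; rewrite patchE mem_set.
Qed.

Lemma cont_ae_eq (f g : R * R -> R) : continuous f -> continuous g ->
  {ae leb2, forall x, Om x -> f x = g x} -> forall x, Om x -> f x = g x.
Proof.
move=> cf cg [N [mN N0 hN]] x Ox; apply/eqP; apply: contrapT => /negP fg.
have fgx : 0 < `|f x - g x| by rewrite normr_gt0 subr_eq0.
have cfg : {for x, continuous (fun x => f x - g x)}.
  by apply: continuousB; [exact: cf|exact: cg].
have [d d0 hd] : exists2 d, 0 < d & forall y, `|y.1 - x.1| < d -> `|y.2 - x.2| < d -> f y != g y.
  move/cvgrPdist_lt : cfg => /(_ _ fgx); rewrite -nbhs_ballE => -[d d0 hd].
  exists d => // y y1 y2; have : `|(f x - g x) - (f y - g y)| < `|f x - g x|.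
    by apply: hd; split; rewrite -ball_normE /= distrC.
  by apply: contraTneq => ->; rewrite subrr subr0 ltxx.
have [/andP[x1 x1'] /andP[x2 x2']] := Ox.
pose r := Num.min d (Num.min (Num.min x.1 (1 - x.1)) (Num.min x.2 (1 - x.2))).
have r0 : 0 < r by rewrite !lt_min d0 x1 x2 !subr_gt0 x1' x2'.
have [rd r1 r2 r3 r4] : [/\ r <= d, r <= x.1, r <= 1 - x.1, r <= x.2 & r <= 1 - x.2].
  by rewrite /r !ge_min !lexx !orbT.
pose B : set R2 := (ball (x.1 : R) r) `*` (ball (x.2 : R) r).
have BN : B `<=` N.
  move=> y [/=]; rewrite -!ball_normE /= => y1 y2; apply: hN => /=.
  rewrite distrC in y1; rewrite distrC in y2.
  move=> h; have Oy : Om y.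
    move: y1 y2; rewrite !ltr_norml => /andP[? ?] /andP[? ?].
    by split; apply/andP; split; lra.
  have := hd y (lt_le_trans y1 rd) (lt_le_trans y2 rd).
  by rewrite (h Oy) eqxx.
have mB : measurable B by apply: measurableX; exact: measurable_ball.
have : (leb2 B <= leb2 N)%E by apply: le_measure; rewrite ?inE.
have mb (y : R) : leb (ball y r) = (r *+ 2)%:E by exact: lebesgue_measure_ball (ltW r0).
have -> : leb2 B = ((r *+ 2) * (r *+ 2))%:E.
  rewrite product_measure1E; [|exact: measurable_ball|exact: measurable_ball].
  by rewrite EFinM; congr (_ * _)%E; exact: mb.
rewrite N0 lee_fin leNgt => /negP; apply.
by rewrite mulr_gt0// pmulrn_lgt0.
Qed.

End PlaneIntegrals.

(** * Complex exponentials and complex-valued smooth functions *)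

Section Cexp.
Variable R : realType.
Implicit Types z w : R[i].

Lemma cexpE z : cexp z = (expR (complex.Re z) * cos (complex.Im z)) +i* (expR (complex.Re z) * sin (complex.Im z)).
Proof. by rewrite /cexp; apply: eqcP; rewrite !cE ?mul0r ?subr0 ?addr0. Qed.

Lemma cexpD z w : cexp (z + w) = cexp z * cexp w.
Proof.
by rewrite !cexpE; apply: eqcP; rewrite !cE expRD ?cosD ?sinD; ring.
Qed.

Lemma normc_cexp z : normc (cexp z) = expR (complex.Re z).
Proof.
rewrite cexpE normcE !cE !exprMn -mulrDr addrC sin2cos2 subrK mulr1 sqrtr_sqr.
by rewrite ger0_norm// expR_ge0.
Qed.

Lemma cexp0 : cexp (0 : R[i]) = 1.
Proof. by rewrite cexpE expR0 cos0 sin0 mulr0 mulr1. Qed.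

Lemma cexpJ z : (Num.conj (cexp z)) = cexp (Num.conj z).
Proof. by rewrite !cexpE; apply: eqcP; rewrite !cE ?cosN ?sinN ?mulrN. Qed.

Lemma cos_sin_2pin (n : nat) : cos (2 * pi * n%:R) = 1 :> R /\ sin (2 * pi * n%:R) = 0 :> R.
Proof.
elim: n => [|n [IH1 IH2]]; first by rewrite mulr0 cos0 sin0.
have -> : 2 * pi * n.+1%:R = 2 * pi * n%:R + pi + pi :> R by rewrite -natr1; ring.
by rewrite !cosDpi !sinDpi IH1 IH2 !opprK.
Qed.

Lemma cexp_2pi (k : int) : cexp (0 +i* (2 * pi * k%:~R)) = 1 :> R[i].
Proof.
rewrite cexp_i; case: k => n.
  by have [h1 h2] := cos_sin_2pin n; rewrite -[X in X%:~R]/(n%:Z) !pmulrn h1 h2.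
have [h1 h2] := cos_sin_2pin n.+1.
by rewrite NegzE mulrNz mulrN cosN sinN !pmulrn h1 h2 oppr0.
Qed.

Lemma is_derive_cexp (w z : R[i]) (t : R) :
  is_derive t 1 (fun t => complex.Re (cexp (w + z * t%:C))) (complex.Re (z * cexp (w + z * t%:C))) /\
  is_derive t 1 (fun t => complex.Im (cexp (w + z * t%:C))) (complex.Im (z * cexp (w + z * t%:C))).
Proof.
pose a := complex.Re z; pose b := complex.Im z; pose c := complex.Re w; pose d := complex.Im w.
have ReE s : complex.Re (w + z * s%:C) = c + a * s by rewrite !cE mulr0 subr0.
have ImE s : complex.Im (w + z * s%:C) = d + b * s by rewrite !cE mulr0 add0r.
have lin (p q : R) : is_derive t 1 (fun t => p + q * t) q.
  have h : is_derive t 1 (fun t : R => q * t) (q * 1).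
    by apply: (@is_deriveZ _ _ _ (fun t : R => t)) => //; exact: is_derive_id.
  by rewrite -[X in is_derive _ _ _ X]add0r -[X in 0 + X]mulr1; apply: is_deriveD.
have dE : is_derive t 1 (fun t => expR (c + a * t)) (expR (c + a * t) * a).
  exact: (@is_derive1_comp _ expR (fun t => c + a * t)).
have dC : is_derive t 1 (fun t => cos (d + b * t)) (- sin (d + b * t) * b).
  exact: (@is_derive1_comp _ (@cos R) (fun t => d + b * t)).
have dS : is_derive t 1 (fun t => sin (d + b * t)) (cos (d + b * t) * b).
  exact: (@is_derive1_comp _ (@sin R) (fun t => d + b * t)).
split.
  have -> : (fun t => complex.Re (cexp (w + z * t%:C))) = (fun t => expR (c + a * t) * cos (d + b * t)).
    by apply/funext => s; rewrite cexpE ReE ImE cE.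
  have -> : complex.Re (z * cexp (w + z * t%:C)) = expR (c + a * t) * (- sin (d + b * t) * b) + cos (d + b * t) * (expR (c + a * t) * a).
    by rewrite cE cexpE ReE ImE !cE -/a -/b; ring.
  exact: is_deriveM.
have -> : (fun t => complex.Im (cexp (w + z * t%:C))) = (fun t => expR (c + a * t) * sin (d + b * t)).
  by apply/funext => s; rewrite cexpE ReE ImE cE.
have -> : complex.Im (z * cexp (w + z * t%:C)) = expR (c + a * t) * (cos (d + b * t) * b) + sin (d + b * t) * (expR (c + a * t) * a).
  by rewrite cE cexpE ReE ImE !cE -/a -/b; ring.
exact: is_deriveM.
Qed.

End Cexp.

Section SmoothComplex.
Variable R : realType.
Local Notation C := R[i].
Local Notation R2 := (R * R)%type.
Local Notation e_ j := (@evec R j).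
Implicit Types f g : R2 -> C.
Local Notation Re := complex.Re.
Local Notation Im := complex.Im.

(** Partial derivatives of complex functions, as a relation so that the rules
    of differentiation compose without smoothness hypotheses; see
    [cderiv_pd]. *)
Definition cderiv j f f' := forall x,
  is_derive x (e_ j) (fun y => Re (f y)) (Re (f' x)) /\
  is_derive x (e_ j) (fun y => Im (f y)) (Im (f' x)).

Lemma cderiv_pd j f f' : cderiv j f f' -> pd j f = f'.
Proof.
move=> h; apply/funext => x; have [h1 h2] := h x; apply: eqcP; rewrite /pd !cE.
  exact: (@derive_val _ _ _ _ _ _ _ h1).
exact: (@derive_val _ _ _ _ _ _ _ h2).
Qed.

Definition cCk n f := Ck n (fun x => Re (f x)) /\ Ck n (fun x => Im (f x)).
Definition cBd K n f M := Bd K n (fun x => Re (f x)) M /\ Bd K n (fun x => Im (f x)) M.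

Lemma cCk_pd n f j : cCk n.+1 f -> cderiv j f (pd j f) /\ cCk n (pd j f).
Proof.
move=> [k1 k2]; split.
  by move=> x; split; exact: (Ck_derive _ _ k1) || exact: (Ck_derive _ _ k2).
by case: k1 => _ /(_ j)[_ k1]; case: k2 => _ /(_ j)[_ k2]; split.
Qed.

Lemma cCk_intro n f (df : bool -> R2 -> C) : 
  (forall j, cderiv j f (df j)) -> (forall j, cCk n (df j)) -> cCk 0 f -> cCk n.+1 f.
Proof.
move=> h k [[c1 _] [c2 _]]; split.
  apply: (@Ck_intro _ _ _ (fun j x => Re (df j x))) => //.
    by move=> j x; case: (h j x).
  by move=> j; case: (k j).
apply: (@Ck_intro _ _ _ (fun j x => Im (df j x))) => //.
  by move=> j x; case: (h j x).
by move=> j; case: (k j).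
Qed.

Lemma smooth2_cCk f n : smooth2 f -> cCk n f.
Proof. by move=> /(_ n). Qed.

Lemma smooth2_pd f j : smooth2 f -> smooth2 (pd j f).
Proof. by move=> sf n; have [_] := @cCk_pd n f j (sf n.+1). Qed.

Lemma smooth2_cderiv f j : smooth2 f -> cderiv j f (pd j f).
Proof. by move=> sf; have [] := @cCk_pd 0 f j (sf 1%N). Qed.

Lemma eqCk n (f g : R2 -> R) : Ck n f -> (forall x, g x = f x) -> Ck n g.
Proof. by move=> kf fg; rewrite (_ : g = f)//; apply/funext. Qed.

Lemma eqBd K n (f g : R2 -> R) M : Bd K n f M -> (forall x, g x = f x) -> Bd K n g M.
Proof. by move=> kf fg; rewrite (_ : g = f)//; apply/funext. Qed.

Lemma cCkD n f g : cCk n f -> cCk n g -> cCk n (fun x => f x + g x).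
Proof.
move=> [f1 f2] [g1 g2]; split; [apply: eqCk (CkD f1 g1) _|apply: eqCk (CkD f2 g2) _];
  by move=> x; rewrite cE.
Qed.

Lemma cCkM n f g : cCk n f -> cCk n g -> cCk n (fun x => f x * g x).
Proof.
move=> [f1 f2] [g1 g2]; split.
  by apply: eqCk (CkD (CkM f1 g1) (CkN (CkM f2 g2))) _ => x; rewrite cE.
by apply: eqCk (CkD (CkM f1 g2) (CkM f2 g1)) _ => x; rewrite cE.
Qed.

Lemma cCk_cst n c : cCk n (fun=> c).
Proof. by split; exact: Ck_cst. Qed.

Lemma cCkJ n f : cCk n f -> cCk n (fun x => (Num.conj (f x))).
Proof.
move=> [f1 f2]; split; first by apply: eqCk f1 _ => x; rewrite cE.
by apply: eqCk (CkN f2) _ => x; rewrite cE.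
Qed.

Lemma smooth2D f g : smooth2 f -> smooth2 g -> smooth2 (fun x => f x + g x).
Proof. by move=> sf sg n; exact: cCkD. Qed.
Lemma smooth2M f g : smooth2 f -> smooth2 g -> smooth2 (fun x => f x * g x).
Proof. by move=> sf sg n; exact: cCkM. Qed.
Lemma smooth2_cst c : smooth2 (fun=> c : C).
Proof. by move=> n; exact: cCk_cst. Qed.
Lemma smooth2Z c f : smooth2 f -> smooth2 (fun x => c * f x).
Proof. by move=> sf; apply: smooth2M => //; exact: smooth2_cst. Qed.
Lemma smooth2J f : smooth2 f -> smooth2 (fun x => (Num.conj (f x))).
Proof. by move=> sf n; exact: cCkJ. Qed.
Lemma smooth2_fst (g : R -> R) : smooth1 g -> smooth2 (fun x => (g x.1)%:C).
Proof. by move=> sg n; split; [exact: Ck_fst|exact: Ck_cst]. Qed.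
Lemma smooth2_shear A f : smooth1 A -> smooth2 f -> smooth2 (fun x => f (shear_map A x)).
Proof. by move=> sA sf n; have [f1 f2] := sf n; split; [exact: (Ck_shear sA f1)|exact: (Ck_shear sA f2)]. Qed.

Lemma cderivD j f g f' g' : cderiv j f f' -> cderiv j g g' ->
  cderiv j (fun x => f x + g x) (fun x => f' x + g' x).
Proof.
move=> hf hg x; have [f1 f2] := hf x; have [g1 g2] := hg x; split.
  have -> : (fun y => Re (f y + g y)) = (fun y => Re (f y) + Re (g y)) by apply/funext => y; rewrite cE.
  by rewrite ReD; apply: is_deriveD.
have -> : (fun y => Im (f y + g y)) = (fun y => Im (f y) + Im (g y)) by apply/funext => y; rewrite cE.
by rewrite ImD; apply: is_deriveD.
Qed.

Lemma cderivM j f g f' g' : cderiv j f f' -> cderiv j g g' ->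
  cderiv j (fun x => f x * g x) (fun x => f' x * g x + f x * g' x).
Proof.
move=> hf hg x; have [f1 f2] := hf x; have [g1 g2] := hg x; split.
  have -> : (fun y => Re (f y * g y)) = (fun y => Re (f y) * Re (g y) - Im (f y) * Im (g y)) by apply/funext => y; rewrite cE.
  have -> : Re (f' x * g x + f x * g' x) = (Re (f x) * Re (g' x) + Re (g x) * Re (f' x)) - (Im (f x) * Im (g' x) + Im (g x) * Im (f' x)).
    by rewrite !cE; ring.
  by apply: is_deriveB; apply: is_deriveM.
have -> : (fun y => Im (f y * g y)) = (fun y => Re (f y) * Im (g y) + Im (f y) * Re (g y)) by apply/funext => y; rewrite cE.
have -> : Im (f' x * g x + f x * g' x) = (Re (f x) * Im (g' x) + Im (g x) * Re (f' x)) + (Im (f x) * Re (g' x) + Re (g x) * Im (f' x)).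
  by rewrite !cE; ring.
by apply: is_deriveD; apply: is_deriveM.
Qed.

Lemma cderiv_cst j c : cderiv j (fun=> c) (fun=> 0).
Proof. by move=> x; split; exact: is_derive_cst. Qed.

Lemma cderivJ j f f' : cderiv j f f' -> cderiv j (fun x => (Num.conj (f x))) (fun x => (Num.conj (f' x))).
Proof.
move=> hf x; have [f1 f2] := hf x; split.
  have -> : (fun y => Re ((Num.conj (f y)))) = (fun y => Re (f y)) by apply/funext => y; rewrite cE.
  by rewrite ReJ.
have -> : (fun y => Im ((Num.conj (f y)))) = (fun y => - Im (f y)) by apply/funext => y; rewrite cE.
by rewrite ImJ; apply: is_deriveN.
Qed.

Lemma pdD j f g : smooth2 f -> smooth2 g ->
  pd j (fun x => f x + g x) = (fun x => pd j f x + pd j g x).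
Proof. by move=> sf sg; apply: cderiv_pd; apply: cderivD; exact: smooth2_cderiv. Qed.

Lemma pdM j f g : smooth2 f -> smooth2 g ->
  pd j (fun x => f x * g x) = (fun x => pd j f x * g x + f x * pd j g x).
Proof. by move=> sf sg; apply: cderiv_pd; apply: cderivM; exact: smooth2_cderiv. Qed.

Lemma pdZ j c f : smooth2 f -> pd j (fun x => c * f x) = (fun x => c * pd j f x).
Proof.
move=> sf; rewrite pdM//; last exact: smooth2_cst.
by apply/funext => x; rewrite (cderiv_pd (cderiv_cst j c)) mul0r add0r.
Qed.

Lemma pdJ j f : smooth2 f -> pd j (fun x => (Num.conj (f x))) = (fun x => (Num.conj (pd j f x))).
Proof. by move=> sf; apply: cderiv_pd; apply: cderivJ; exact: smooth2_cderiv. Qed.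

Lemma pd_fst j (g : R -> R) : smooth1 g ->
  pd j (fun x => (g x.1)%:C) = (fun x => if j then 0 else (derive1 g x.1)%:C).
Proof.
move=> sg; apply: cderiv_pd => x; split; last by case: j => /=; exact: is_derive_cst.
by have := fst_der j x sg; case: j.
Qed.

Lemma pd_shear A f : smooth1 A -> smooth2 f ->
  pd true (fun x => f (shear_map A x)) = (fun x => pd true f (shear_map A x)) /\
  pd false (fun x => f (shear_map A x)) =
    (fun x => pd false f (shear_map A x) + (- derive1 A x.1)%:C * pd true f (shear_map A x)).
Proof.
move=> sA sf; have [k1 k2] := sf 1%N; split; apply: cderiv_pd => x.
  by split; [exact: (shear_der2 _ _ k1)|exact: (shear_der2 _ _ k2)].
split; rewrite /pd !cE mul0r ?subr0 ?addr0.
  exact: (shear_der1 _ k1).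
exact: (shear_der1 _ k2).
Qed.

Lemma cBd_le K n m f M : (m <= n)%N -> cBd K n f M -> cBd K m f M.
Proof. by move=> mn [? ?]; split; exact: Bd_le mn _. Qed.

Lemma cBd_mono K n f M N : M <= N -> cBd K n f M -> cBd K n f N.
Proof. by move=> mn [? ?]; split; exact: Bd_mono mn _. Qed.

Lemma cBd_box K K' n f M : K <= K' -> cBd K' n f M -> cBd K n f M.
Proof. by move=> mn [? ?]; split; exact: Bd_box mn _. Qed.

Lemma cBd_pd K n f M j : cBd K n.+1 f M -> cBd K n (pd j f) M.
Proof. by move=> [[_ h1] [_ h2]]; split; [exact: h1|exact: h2]. Qed.

Lemma cBdD K n f g M N : cCk n f -> cCk n g -> cBd K n f M -> cBd K n g N ->
  cBd K n (fun x => f x + g x) (M + N).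
Proof.
move=> [f1 f2] [g1 g2] [a1 a2] [b1 b2]; split.
  by apply: eqBd (BdD f1 g1 a1 b1) _ => x; rewrite cE.
by apply: eqBd (BdD f2 g2 a2 b2) _ => x; rewrite cE.
Qed.

Lemma BdN K n (f : R2 -> R) M : Ck n f -> Bd K n f M -> Bd K n (fun x => - f x) M.
Proof.
elim: n f => [|n IH] f kf [h1 h2]; first by split => // x bx; rewrite normrN h1.
split; first by move=> x bx; rewrite normrN h1.
move=> j; have -> : 'D_(e_ j) (fun x => - f x) = (fun x => - 'D_(e_ j) f x).
  by apply: derE => x; apply: is_deriveN; exact: (Ck_derive _ _ kf).
by apply: IH; [case: kf => _ /(_ j)[]|exact: h2].
Qed.

Lemma cBdM K n f g M N : 0 <= M -> 0 <= N -> cCk n f -> cCk n g -> cBd K n f M -> cBd K n g N ->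
  cBd K n (fun x => f x * g x) (2 * (2 ^+ n * (M * N))).
Proof.
move=> M0 N0 [f1 f2] [g1 g2] [a1 a2] [b1 b2]; rewrite mulr2n mulrDl mul1r; split.
  apply: eqBd (BdD (CkM f1 g1) (CkN (CkM f2 g2)) (BdM M0 N0 f1 g1 a1 b1) (BdN (CkM f2 g2) (BdM M0 N0 f2 g2 a2 b2))) _.
  by move=> x; rewrite cE.
apply: eqBd (BdD (CkM f1 g2) (CkM f2 g1) (BdM M0 N0 f1 g2 a1 b2) (BdM M0 N0 f2 g1 a2 b1)) _.
by move=> x; rewrite cE.
Qed.

Lemma cBd_exists K n f : cCk n f -> exists2 M, 0 <= M & cBd K n f M.
Proof.
move=> [f1 f2]; have [M M0 h] := Bd_exists K f1; have [N N0 h'] := Bd_exists K f2.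
exists (M + N); first by rewrite addr_ge0.
by split; [apply: Bd_mono h; rewrite lerDl|apply: Bd_mono h'; rewrite lerDr].
Qed.

Lemma cBd_val K n f M x : cBd K n f M -> box K x -> normc (f x) <= 2 * M.
Proof.
move=> [h1 h2] bx; rewrite (le_trans (normc_le_ReIm _))// mulr2n mulrDl mul1r.
by rewrite lerD//; [exact: (Bd_val h1)|exact: (Bd_val h2)].
Qed.

Lemma cBd_cst_mul K n f M c : 0 <= M -> cCk n f -> cBd K n f M ->
  cBd K n (fun x => c * f x) (2 * (2 ^+ n * (normc c * M))).
Proof.
move=> M0 kf bf; apply: cBdM => //; [exact: normc_nneg|exact: cCk_cst|].
have h (b c' : R) : `|c'| <= b -> Bd K n (fun=> c') b.
  elim: n c' {kf bf} => [|n IH] c' cb; first by split.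
  split=> // j; have -> : 'D_(e_ j) (fun _ : R2 => c') = (fun=> 0).
    by apply: derE => x; exact: is_derive_cst.
  by apply: IH; rewrite normr0 (le_trans _ cb).
by split; apply: h; [exact: Re_le_normc|exact: Im_le_normc].
Qed.

Definition ex2 (z : C * C) (x : R2) : C := cexp (z.1 * (x.1)%:C + z.2 * (x.2)%:C).

Definition zc (z : C * C) (j : bool) := if j then z.2 else z.1.

Lemma ex2_line z x j t : ex2 z (x + t *: e_ j) = cexp (z.1 * (x.1)%:C + z.2 * (x.2)%:C + zc z j * t%:C).
Proof.
rewrite /ex2; congr cexp; case: j => /=.
  by rewrite scaler0 addr0 [t *: 1]mulr1 rmorphD /= mulrDr addrA.
by rewrite scaler0 addr0 [t *: 1]mulr1 rmorphD /= mulrDr addrAC.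
Qed.

Lemma ex2_cderiv z j : cderiv j (ex2 z) (fun x => zc z j * ex2 z x).
Proof.
move=> x; split; apply: derivable_line0; under eq_fun do rewrite ex2_line.
  have [h _] := is_derive_cexp (z.1 * (x.1)%:C + z.2 * (x.2)%:C) (zc z j) 0.
  by move: h; rewrite mulr0 addr0.
have [_ h] := is_derive_cexp (z.1 * (x.1)%:C + z.2 * (x.2)%:C) (zc z j) 0.
by move: h; rewrite mulr0 addr0.
Qed.

Lemma ex2_pd z j : pd j (ex2 z) = (fun x => zc z j * ex2 z x).
Proof. exact/cderiv_pd/ex2_cderiv. Qed.

Lemma ex2_cont z : cCk 0 (ex2 z).
Proof.
have cl (p q : R) : continuous (fun x : R2 => p * x.1 + q * x.2).
  move=> x; apply: (@continuousD _ _ _ (fun x : R2 => p * x.1) (fun x : R2 => q * x.2)).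
    by apply: (@continuousM _ _ (fun=> p) fst); [exact: cst_continuous|exact: cvg_fst].
  by apply: (@continuousM _ _ (fun=> q) snd); [exact: cst_continuous|exact: cvg_snd].
pose a := fun x : R2 => Re z.1 * x.1 + Re z.2 * x.2.
pose b := fun x : R2 => Im z.1 * x.1 + Im z.2 * x.2.
have E x : ex2 z x = (expR (a x) * cos (b x)) +i* (expR (a x) * sin (b x)).
  rewrite /ex2 cexpE /a /b; congr (expR _ * cos _ +i* (expR _ * sin _));
    by rewrite !cE ?mulr0 ?subr0 ?add0r.
split; split => // x; under eq_fun do rewrite E.
  apply: (@continuousM _ _ (expR \o a) (@cos R \o b)).
    by apply: continuous_comp; [exact: cl|exact: continuous_expR].
  by apply: continuous_comp; [exact: cl|exact: continuous_cos].
apply: (@continuousM _ _ (expR \o a) (@sin R \o b)).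
  by apply: continuous_comp; [exact: cl|exact: continuous_expR].
by apply: continuous_comp; [exact: cl|exact: continuous_sin].
Qed.

Lemma smooth2_ex2 z : smooth2 (ex2 z).
Proof.
elim=> [|n IH]; first exact: ex2_cont.
apply: (@cCk_intro _ _ (fun j x => zc z j * ex2 z x)).
- exact: ex2_cderiv.
- by move=> j; apply: cCkM => //; exact: cCk_cst.
- exact: ex2_cont.
Qed.

End SmoothComplex.

(** * Smooth quasi-periodic functions are test functions *)

Section QuasiPeriodic.
Variable R : realType.
Local Notation C := R[i].
Local Notation leb := (@lebesgue_measure R).
Local Notation R2 := (measurableTypeR R * measurableTypeR R)%type.
Local Notation leb2 := (leb \x leb)%E.
Local Notation Om := (@Omega R).
Local Notation e_ j := (@evec R j).
Local Notation Re := complex.Re.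
Local Notation Im := complex.Im.
Implicit Types (h : R * R) (f g psi : R * R -> C).

Lemma cCk0_integrable f : cCk 0 f -> cintegrable leb2 Om f.
Proof. by move=> [[c1 _] [c2 _]]; split; exact: continuous_integrable_Omega. Qed.

Lemma cCk0_meas f : cCk 0 f -> cmeas Om (f : R2 -> C).
Proof. by move=> h; apply: (cintegrable_meas (mu := leb2)); exact: cCk0_integrable. Qed.

Lemma cCk0_bound f : cCk 0 f -> exists2 M, 0 <= M & forall x, Om x -> normc (f x) <= M.
Proof.
move=> kf; have [M M0 h] := @cBd_exists R 1 _ _ kf.
exists (2 * M); first by rewrite mulr_ge0.
by move=> x /Omega_box bx; exact: (cBd_val h bx).
Qed.

Lemma L2_bounded (f : R2 -> C) M : cmeas Om f -> (forall x, Om x -> normc (f x) <= M) ->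
  L2 leb2 Om f.
Proof. exact: (bounded_L2 (@measurable_Omega R) (@finite_Omega R)). Qed.

Lemma L2_cCk0 f : cCk 0 f -> L2 leb2 Om (f : R2 -> C).
Proof. by move=> kf; have [M _ h] := cCk0_bound kf; exact: L2_bounded (cCk0_meas kf) h. Qed.

Lemma cdiv0 f f' j : cCk 0 f -> cCk 0 f' -> cderiv j f f' ->
  (forall t, 0 < t < 1 -> f (face j 0 t) = f (face j 1 t)) ->
  cintegral leb2 Om f' = 0.
Proof.
move=> [[c1 _] [c2 _]] [[d1 _] [d2 _]] df hf; rewrite /cintegral; apply: eqcP; rewrite !cE.
  apply: (@div0 R (fun x => Re (f x)) (fun x => Re (f' x)) j) => //.
    by move=> x; case: (df x).
  by move=> t t01; rewrite hf.
apply: (@div0 R (fun x => Im (f x)) (fun x => Im (f' x)) j) => //.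
  by move=> x; case: (df x).
by move=> t t01; rewrite hf.
Qed.

(** [uu] is the system u_xi of the eigenfunctions of L_h; [ev] is the complex
    conjugate of v_xi, an eigenfunction of the transpose of L_h, and [lam]
    their eigenvalues. *)
Definition uu h (xi : int * int) : R * R -> C := ex2 (freq h.1 xi.1, freq h.2 xi.2).
Definition ev h (xi : int * int) : R * R -> C := ex2 (- freq h.1 xi.1, - freq h.2 xi.2).
Definition lam h (xi : int * int) : C := freq h.1 xi.1 ^+ 2 + freq h.2 xi.2 ^+ 2.

Lemma uu_ev h xi eta x : uu h xi x * ev h eta x = cexp (0 +i* phase (xi.1 - eta.1) (xi.2 - eta.2) x).
Proof.
rewrite /uu /ev /ex2 -cexpD; congr cexp; rewrite /freq /phase !intrB.
by apply: eqcP; rewrite !cE; ring.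
Qed.

Lemma cexp_freq (hj : R) (k : int) : 0 < hj -> cexp (freq hj k) = hj%:C.
Proof.
move=> h0; have -> : freq hj k = (ln hj)%:C + (0 +i* (2 * pi * k%:~R)).
  by apply: eqcP; rewrite !cE ?addr0 ?add0r.
rewrite cexpD cexp_2pi mulr1 cexpE !cE cos0 sin0 mulr0 mulr1 lnK//.
Qed.

Lemma ex2_shift z j (x : R * R) : ex2 z (x + e_ j) = cexp (zc z j) * ex2 z x.
Proof.
have := ex2_line z x j 1; rewrite scale1r => ->; rewrite cexpD mulrC; congr (_ * _).
by congr cexp; apply: eqcP; rewrite !cE; ring.
Qed.

Lemma uu_shift h xi j x : 0 < h.1 -> 0 < h.2 -> uu h xi (x + e_ j) = (coord j h)%:C * uu h xi x.
Proof.
move=> h1 h2; rewrite /uu ex2_shift; congr (_ * _).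
by case: j; rewrite /= cexp_freq.
Qed.

Lemma ev_shift h xi j x : 0 < h.1 -> 0 < h.2 -> ev h xi x = (coord j h)%:C * ev h xi (x + e_ j).
Proof.
move=> h1 h2; rewrite /ev ex2_shift mulrA -[LHS]mul1r; congr (_ * _).
have -> : zc (- freq h.1 xi.1, - freq h.2 xi.2) j = - (zc (freq h.1 xi.1, freq h.2 xi.2) j) by case: j.
have -> : (coord j h)%:C = cexp (zc (freq h.1 xi.1, freq h.2 xi.2) j).
  by case: j; rewrite /= cexp_freq.
by rewrite -cexpD subrr cexp0.
Qed.

Lemma faceS j (t : R) : face j 1 t = face j 0 t + e_ j.
Proof. by case: j => /=; congr pair; rewrite /= ?addr0 ?add0r. Qed.

(** On each pair of opposite faces the boundary terms u d_j psi - (d_j u) psi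
    cancel: u and d_j u gain a factor h_j from one face to the other, and psi
    and d_j psi lose it. *)
Lemma green h xi psi : 0 < h.1 -> 0 < h.2 -> smooth2 psi -> transposed_BC h psi ->
  cintegral leb2 Om (fun x => lam h xi * uu h xi x * psi x) =
  cintegral leb2 Om (fun x => uu h xi x * laplacian psi x).
Proof.
move=> h1 h2 sp bc; set u := uu h xi; pose z := (freq h.1 xi.1, freq h.2 xi.2).
have su : smooth2 u by exact: smooth2_ex2.
have D j : cintegral leb2 Om (fun x => u x * pd j (pd j psi) x + - (zc z j ^+ 2 * (u x * psi x))) = 0.
  apply: (@cdiv0 (fun x => u x * pd j psi x + - zc z j * (u x * psi x)) _ j).
  - apply: (@smooth2_cCk _ _ 0); apply: smooth2D; first by apply: smooth2M => //; exact: smooth2_pd.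
    by apply: smooth2Z; exact: smooth2M.
  - under eq_fun do rewrite -mulNr.
    apply: (@smooth2_cCk _ _ 0); apply: smooth2D; first by apply: smooth2M => //; do 2 apply: smooth2_pd.
    by apply: smooth2Z; exact: smooth2M.
  - have d1 := cderivM (ex2_cderiv z j) (smooth2_cderiv j (smooth2_pd j sp)).
    have d2 := cderivM (ex2_cderiv z j) (smooth2_cderiv j sp).
    have := cderivD d1 (cderivM (cderiv_cst j (- zc z j)) d2).
    congr (cderiv _ _ _); apply/funext => x; rewrite /u /uu -/z; ring.
  - move=> t /andP[t0 t1]; have t01 : 0 <= t <= 1 by rewrite !ltW.
    have [b1 b2] := bc j t t01.
    by rewrite b1 b2 [in RHS]faceS /u uu_shift// -faceS; ring.
have ci (f : R2 -> C) : smooth2 f -> cintegrable leb2 Om f.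
  by move=> sf; apply: cCk0_integrable; exact: (sf 0%N).
have s1 j : smooth2 (fun x => u x * pd j (pd j psi) x) by apply: smooth2M => //; do 2 apply: smooth2_pd.
have s2 j : smooth2 (fun x => zc z j ^+ 2 * (u x * psi x)) by apply: smooth2Z; exact: smooth2M.
have mO := @measurable_Omega R.
have {}D j : cintegral leb2 Om (fun x => zc z j ^+ 2 * (u x * psi x)) = cintegral leb2 Om (fun x => u x * pd j (pd j psi) x).
  have := D j; rewrite cintegralD//; [|exact/ci/s1|].
    rewrite cintegralN//; last exact/ci/s2.
    by move=> /eqP; rewrite subr_eq0 => /eqP ->.
  apply: ci; under eq_fun do rewrite -mulN1r; exact/smooth2Z/s2.
transitivity (cintegral leb2 Om (fun x => zc z false ^+ 2 * (u x * psi x) + zc z true ^+ 2 * (u x * psi x))).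
  by apply: eq_cintegral => x _; rewrite /lam /=; ring.
rewrite cintegralD//; [|exact/ci/s2|exact/ci/s2].
rewrite !D -cintegralD//; [|exact/ci/s1|exact/ci/s1].
by apply: eq_cintegral => x _; rewrite /laplacian mulrDr.
Qed.

(** A function supported inside the square vanishes near its boundary, so
    that the weak equation is a special case of the boundary conditions. *)
Lemma supp_transposed_BC h psi : closure [set x | psi x != 0] `<=` (Om : set (R * R)) ->
  transposed_BC h psi.
Proof.
move=> supp j t t01.
have out s : (s = 0 \/ s = 1) -> psi (face j s t) = 0 /\ pd j psi (face j s t) = 0.
  move=> hs; have nO : ~ (Om : set (R * R)) (face j s t).
    by case: hs => ->; case: j => -[/=]; rewrite ?ltxx ?andbF.
  have nc : ~ closure [set x | psi x != 0] (face j s t) by move=> /supp.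
  have nz : \forall y \near face j s t, psi y = 0.
    have : nbhs (face j s t) (~` closure [set x | psi x != 0]).
      by apply: open_nbhs_nbhs; split => //; apply: closed_openC; exact: closed_closure.
    apply: filterS => y /= ny; apply/eqP; apply: contrapT => /negP y0; apply: ny.
    exact: subset_closure.
  split; first exact: nbhs_singleton nz.
  have dz (F : R * R -> R) : (\forall y \near face j s t, F y = 0) -> 'D_(e_ j) F (face j s t) = 0.
    move=> nF; have dF : is_derive (face j s t) (e_ j) F 0.
      apply: (@near_eq_is_derive _ _ _ (fun _ : R * R => 0 : R)).
      by apply: filterS nF => y ->.
    exact: (@derive_val _ _ _ _ _ _ _ dF).
  apply: eqcP; rewrite !cE; apply: dz; apply: filterS nz => y ->; by rewrite cE.
have [a1 a2] := out 0 (or_introl erefl); have [b1 b2] := out 1 (or_intror erefl).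
by rewrite a1 a2 b1 b2 mulr0.
Qed.

Lemma Lh_uu h xi : 0 < h.1 -> 0 < h.2 -> Lh h (uu h xi) (fun x => lam h xi * uu h xi x).
Proof.
move=> h1 h2; have su : smooth2 (uu h xi) by exact: smooth2_ex2.
split.
- exact: L2_cCk0 (su 0%N).
- by apply: L2_cCk0; apply: (@smooth2Z _ _ _ su 0%N).
- by move=> psi sp /(@supp_transposed_BC h) bc; rewrite green.
- by move=> psi sp bc; rewrite green.
Qed.

(** The smooth functions on the plane with the periodicity of the functions
    [ev h xi]: they restrict to the test functions on the square. *)
Definition Q h psi := smooth2 psi /\ forall j x, psi x = (coord j h)%:C * psi (x + e_ j).

Lemma is_derive_shift (F : R * R -> R) (a x : R * R) j df :
  is_derive (x + a) (e_ j) F df -> is_derive x (e_ j) (fun y => F (y + a)) df.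
Proof.
move=> dF; apply: derivable_line0.
have -> : (fun t : R => F (x + t *: e_ j + a)) = (fun t => F ((x + a) + t *: e_ j)).
  by apply/funext => t; rewrite addrAC.
by apply: is_derive_line; rewrite scale0r addr0.
Qed.

Lemma cderiv_shift j f f' a : cderiv j f f' -> cderiv j (fun x => f (x + a)) (fun x => f' (x + a)).
Proof.
by move=> df x; have [d1 d2] := df (x + a); split;
  [exact: (@is_derive_shift (fun x => Re (f x)))|exact: (@is_derive_shift (fun x => Im (f x)))].
Qed.

Lemma Q_pd h psi i : Q h psi -> Q h (pd i psi).
Proof.
move=> [sp qp]; split; first exact: smooth2_pd.
move=> j x.
have d1 := cderivM (cderiv_cst i (coord j h)%:C) (cderiv_shift (e_ j) (smooth2_cderiv i sp)).
have E : (fun x => (coord j h)%:C * psi (x + e_ j)) = psi by apply/funext => y; rewrite -qp.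
move: d1 => /cderiv_pd; rewrite E => /(congr1 (fun F => F x)) /= ->.
by rewrite mul0r add0r.
Qed.

Lemma QD h psi phi : Q h psi -> Q h phi -> Q h (fun x => psi x + phi x).
Proof.
move=> [sp qp] [sf qf]; split; first exact: smooth2D.
by move=> j x; rewrite mulrDr -qp -qf.
Qed.

Lemma QZ h c psi : Q h psi -> Q h (fun x => c * psi x).
Proof.
move=> [sp qp]; split; first exact: smooth2Z.
by move=> j x; rewrite mulrCA -qp.
Qed.

Lemma Q0 h : Q h (fun=> 0).
Proof. by split; [exact: smooth2_cst|move=> j x; rewrite mulr0]. Qed.

Lemma Q_laplacian h psi : Q h psi -> Q h (laplacian psi).
Proof. by move=> qp; apply: QD; do 2 apply: Q_pd. Qed.

Lemma Q_ev h xi : 0 < h.1 -> 0 < h.2 -> Q h (ev h xi).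
Proof. by move=> h1 h2; split; [exact: smooth2_ex2|move=> j x; exact: ev_shift]. Qed.

Lemma Q_tBC h psi : Q h psi -> transposed_BC h psi.
Proof.
move=> qp j t _; rewrite faceS; split; first exact: (qp.2 j).
exact: ((Q_pd j qp).2 j).
Qed.

Lemma laplacianJ psi : smooth2 psi -> laplacian (fun x => (Num.conj (psi x))) = (fun x => (Num.conj (laplacian psi x))).
Proof.
move=> sp; apply/funext => x; rewrite /laplacian.
by rewrite !pdJ//; try exact: smooth2_pd; rewrite rmorphD.
Qed.

Lemma tBCJ h psi : smooth2 psi -> transposed_BC h psi -> transposed_BC h (fun x => (Num.conj (psi x))).
Proof.
move=> sp bc j t t01; have [-> b2] := bc j t t01.
have cM (c : R) (a : C) : (Num.conj (c%:C * a)) = c%:C * (Num.conj a).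
  by apply: eqcP; rewrite !cE; ring.
by rewrite !pdJ// b2 !cM.
Qed.

(** The boundary conditions of L_h, tested with the conjugate of psi, are
    exactly the defining property of the adjoint. *)
Lemma adjoint_Q h psi : Q h psi -> adjoint leb2 Om (Lh h) psi (laplacian psi).
Proof.
move=> qp; have [sp _] := qp; split.
- exact: L2_cCk0 (sp 0%N).
- exact: L2_cCk0 ((Q_laplacian qp).1 0%N).
- move=> u v [_ _ _ bc]; rewrite /inner (bc (fun x => (Num.conj (psi x)))).
  + by apply: eq_cintegral => x _; rewrite laplacianJ.
  + exact: smooth2J.
  + by apply: tBCJ => //; exact: Q_tBC.
Qed.

(** [psi] is the smooth quasi-periodic representative of the test function
    [phi], which is only relevant up to a null set of the square. *)
Definition qrep h (phi : R2 -> C) psi :=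
  [/\ cmeas Om phi, Q h psi & {ae leb2, forall x, Om x -> phi x = psi x}].

Lemma Q_qrep h psi : Q h psi -> qrep h psi psi.
Proof. by move=> qp; split => //; [exact: cCk0_meas (qp.1 0%N)|exact: aeW]. Qed.

Lemma ae_L2 (f g : R2 -> C) : cmeas Om g -> {ae leb2, forall x, Om x -> f x = g x} ->
  L2 leb2 Om f -> L2 leb2 Om g.
Proof.
move=> [g1 g2] fg [f1 f2 fi]; split => //.
have mO := @measurable_Omega R.
have m (k : R2 -> C) : cmeas Om k -> measurable_fun Om (fun x => (normc (k x) ^+ 2)%:E).
  by move=> /measurable_normc mk; apply/measurable_EFinP; exact: measurable_funX.
rewrite (@ae_eq_integral _ _ _ _ _ (fun x => (normc (f x) ^+ 2)%:E))//; [exact: m|exact: m|].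
by apply: filterS fg => x fg Ox; rewrite (fg Ox).
Qed.

Lemma ae_eq_sym (f g : R2 -> C) : {ae leb2, forall x, Om x -> f x = g x} ->
  {ae leb2, forall x, Om x -> g x = f x}.
Proof. by apply: filterS => x fg Ox; rewrite fg. Qed.

Lemma adjoint_ae h (f f' g : R2 -> C) : adjoint leb2 Om (Lh h) f g -> cmeas Om f' ->
  {ae leb2, forall x, Om x -> f x = f' x} -> adjoint leb2 Om (Lh h) f' g.
Proof.
move=> [f1 g1 a] mf fE; split => //; first exact: ae_L2 fE f1.
move=> u v uv; rewrite -(a _ _ uv) /inner.
have [_ [v1 v2 _] _ _] := uv; have [m1 m2 _] := f1.
apply: ae_eq_cintegral => //.
- exact: measurable_Omega.
- by apply: cmeasM; [split|exact: cmeasJ].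
- by apply: cmeasM; [split|exact: cmeasJ].
- by apply: filterS fE => x fE Ox; rewrite -(fE Ox).
Qed.

Lemma qrep_iter h phi psi k : qrep h phi psi -> (1 <= k)%N ->
  iterop (adjoint leb2 Om (Lh h)) k phi (iter k (@laplacian R) psi).
Proof.
move=> [mp qp fE] k1.
have it n chi : Q h chi -> iterop (adjoint leb2 Om (Lh h)) n chi (iter n (@laplacian R) chi).
  elim: n chi => [|n IH] chi qc //=; exists (laplacian chi); first exact: adjoint_Q.
  by rewrite -iterS iterSr; apply: IH; exact: Q_laplacian.
case: k k1 => // k _; exists (laplacian psi); last by rewrite iterSr; apply: it; exact: Q_laplacian.
by apply: (adjoint_ae (adjoint_Q qp)) => //; exact: ae_eq_sym.
Qed.

Lemma qrep_Hinf h phi psi : qrep h phi psi -> Hinf (adjoint leb2 Om (Lh h)) phi.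
Proof. by move=> r k k1; exists (iter k (@laplacian R) psi); exact: qrep_iter. Qed.

End QuasiPeriodic.

(** * Series of smooth functions *)

Section RealSeries.
Variable R : realType.

(** A convergent series with explicit tails, with which all series below are
    compared. *)
Definition invprod (n : nat) : R := (n.+1%:R * n.+2%:R)^-1.

Lemma invprodE n : invprod n = n.+1%:R^-1 - n.+2%:R^-1.
Proof.
rewrite /invprod; have h1 : n.+1%:R != 0 :> R by rewrite pnatr_eq0.
have h2 : n.+2%:R != 0 :> R by rewrite pnatr_eq0.
have e : n.+2%:R = n.+1%:R + 1 :> R by rewrite -natr1.
by rewrite e in h2 *; field; apply/andP; split => //; rewrite natr1 pnatr_eq0.
Qed.

Lemma invprod_ge0 n : 0 <= invprod n.
Proof. by rewrite invr_ge0 mulr_ge0. Qed.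

Lemma invprod_le n : invprod n <= n.+1%:R^-1.
Proof. by rewrite invprodE gerBl invr_ge0. Qed.

Lemma sum_invprod N n : (N <= n)%N -> \sum_(N <= k < n) invprod k = N.+1%:R^-1 - n.+1%:R^-1.
Proof.
move=> Nn; rewrite (@telescope_sumr_eq _ _ _ (fun k => - k.+1%:R^-1))//.
  by rewrite opprK addrC.
by move=> k _; rewrite invprodE opprK addrC.
Qed.

Definition dominated (t : nat -> R) (B : R) := forall n, `|t n| <= B * invprod n.

Lemma dominated_ge0 t B : dominated t B -> 0 <= B.
Proof.
move=> /(_ 0%N) h; have q0 : 0 < invprod 0 by rewrite invr_gt0 mulr_gt0.
by rewrite -(pmulr_lge0 _ q0) (le_trans _ h).
Qed.

Lemma dominated_sum t B N n : dominated t B -> (N <= n)%N ->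
  `|\sum_(N <= k < n) t k| <= B * N.+1%:R^-1.
Proof.
move=> dt Nn; apply: (le_trans (ler_norm_sum _ _ _)).
apply: (@le_trans _ _ (\sum_(N <= k < n) (B * invprod k))).
  by apply: ler_sum => k _; exact: dt.
rewrite -mulr_sumr sum_invprod// ler_wpM2l ?(dominated_ge0 dt)// gerBl invr_ge0//.
Qed.

Lemma dominated_cvg t B : dominated t B -> cvgn (series t).
Proof.
move=> dt; apply: normed_cvg; apply: nondecreasing_is_cvgn.
  by apply: nondecreasing_series => n _ _ /=; exact: normr_ge0.
exists B => _ [n _ <-]; rewrite /series /=.
have := @dominated_sum (fun n => `|t n|) B 0 n; rewrite invr1 mulr1 => h.
apply: (le_trans (ler_norm _)); by apply: h => // k; rewrite normr_id.
Qed.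

Definition rsum (t : nat -> R) : R := limn (series t).

Lemma rsum_tail t B N : dominated t B -> `|rsum t - \sum_(0 <= k < N) t k| <= B * N.+1%:R^-1.
Proof.
move=> dt; have ct := dominated_cvg dt.
have c2 : (`|series t n - \sum_(0 <= k < N) t k|) @[n --> \oo] --> `|rsum t - \sum_(0 <= k < N) t k|.
  by apply: cvg_norm; apply: cvgB => //; exact: cvg_cst.
rewrite -(cvg_lim (@Rhausdorff R) c2).
apply: limr_le; first by apply/cvg_ex; eexists; exact: c2.
near=> n; have Nn : (N <= n)%N by near: n; exact: nbhs_infty_ge.
by rewrite /series /= (@big_cat_nat _ _ _ N)//= addrAC subrr add0r; exact: dominated_sum.
Unshelve. all: by end_near. Qed.

Lemma rsum_le t B : dominated t B -> `|rsum t| <= B.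
Proof.
by move=> dt; have := rsum_tail 0 dt; rewrite big_geq// subr0 invr1 mulr1.
Qed.

Lemma rsum_lin t1 t2 B1 B2 a : dominated t1 B1 -> dominated t2 B2 ->
  rsum (fun n => t1 n + a * t2 n) = rsum t1 + a * rsum t2.
Proof.
move=> d1 d2; have c1 := dominated_cvg d1; have c2 := dominated_cvg d2.
apply/cvg_lim; first exact: Rhausdorff.
have -> : series (fun n => t1 n + a * t2 n) = (fun n => series t1 n + a * series t2 n).
  by apply/funext => n; rewrite /series /= big_split /= mulr_sumr.
by apply: cvgD => //; apply: cvgM => //; exact: cvg_cst.
Qed.

Lemma rsum_fin t N : (forall n, (N <= n)%N -> t n = 0) -> rsum t = \sum_(0 <= k < N) t k.
Proof.
move=> h; apply: lim_near_cst; first exact: Rhausdorff.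
near=> n; have Nn : (N <= n)%N by near: n; exact: nbhs_infty_ge.
rewrite /series /= (@big_cat_nat _ _ _ N)//= [X in _ + X]big1_seq ?addr0//.
by move=> k /=; rewrite mem_index_iota => /andP[/h].
Unshelve. all: by end_near. Qed.

Local Notation R2 := (R * R)%type.
Local Notation e_ j := (@evec R j).

Lemma lip_box (f : R2 -> R) K M x y : Ck 1 f -> Bd (3 * K) 1 f M -> box K x -> box K y ->
  `|f y - f x| <= M * (`|y.1 - x.1| + `|y.2 - x.2|).
Proof.
move=> kf [_ bf] [x1 x2] [y1 y2].
have step j (p : R2) t : box K p -> `|t| <= 2 * K -> `|f (p + t *: e_ j) - f p| <= M * `|t|.
  move=> [p1 p2] tK; have [c ct ->] := mvt_line j p t kf.
  rewrite normrM ler_wpM2r//; have [h _] := bf j; apply: h.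
  have K0 : 0 <= K by apply: le_trans p1.
  have cK : `|c| <= 2 * K by apply: le_trans ct tK.
  case: j => /=; split => /=; rewrite ?scaler0 ?addr0 ?[c *: 1]mulr1.
  - by apply: (le_trans p1); lra.
  - by apply: (le_trans (ler_normD _ _)); lra.
  - by apply: (le_trans (ler_normD _ _)); lra.
  - by apply: (le_trans p2); lra.
pose p : R2 := (y.1, x.2).
have -> : f y - f x = (f y - f p) + (f p - f x) by ring.
have E1 : p = x + (y.1 - x.1) *: e_ false.
  by rewrite /p; congr pair => /=; rewrite ?scaler0 ?addr0// [_ *: 1]mulr1 addrC subrK.
have E2 : y = p + (y.2 - x.2) *: e_ true.
  rewrite /p [LHS]surjective_pairing; congr pair => /=; rewrite ?scaler0 ?addr0// [_ *: 1]mulr1 addrC subrK//.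
have b1 : `|y.1 - x.1| <= 2 * K by apply: (le_trans (ler_normB _ _)); lra.
have b2 : `|y.2 - x.2| <= 2 * K by apply: (le_trans (ler_normB _ _)); lra.
rewrite (le_trans (ler_normD _ _))// addrC mulrDr lerD//.
  by rewrite E1; exact: step.
by rewrite {1}E2; exact: step.
Qed.

(** The remainder of the first order expansion along an axis, bounded
    uniformly in terms of second derivatives so that it can be summed over a
    series. *)
Lemma taylor2 (f : R2 -> R) K M x j t : Ck 2 f -> Bd (K + 1) 2 f M -> box K x -> `|t| <= 1 ->
  `|f (x + t *: e_ j) - f x - t * 'D_(e_ j) f x| <= M * t ^+ 2.
Proof.
move=> kf [_ bf] [x1 x2] t1.
have kf1 : Ck 1 f by apply: CkS.
have [_ kd] := kf.
have [c ct ->] := mvt_line j x t kf1.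
have [d dc] := mvt_line j x c (kd j).2.
rewrite [_ * t]mulrC -mulrBr => ->.
have -> : t ^+ 2 = `|t| * `|t| by rewrite -expr2 real_normK ?num_real.
rewrite !normrM [M * _]mulrCA ler_wpM2l//.
have [_ h2] := bf j; have [h3 _] := h2 j.
have bx : box (K + 1) (x + d *: e_ j).
  have d1 : `|d| <= 1 by rewrite (le_trans dc)// (le_trans ct).
  case: j {h2 h3 dc ct} => /=; split => /=; rewrite ?scaler0 ?addr0 ?[d *: 1]mulr1.
  - by apply: (le_trans x1); lra.
  - by apply: (le_trans (ler_normD _ _)); lra.
  - by apply: (le_trans (ler_normD _ _)); lra.
  - by apply: (le_trans x2); lra.
have := h3 _ bx => h4.
by rewrite ler_pM.
Qed.

(** Families of smooth functions that may be summed, and differentiated, term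
    by term. *)
Definition summable_fam (f : nat -> R2 -> R) := (forall m n, Ck m (f n)) /\
  forall K m, exists B, forall n, Bd K m (f n) (B * invprod n).

Definition fsum (f : nat -> R2 -> R) (x : R2) : R := rsum (f ^~ x).

Lemma summable_fam_D f j : summable_fam f -> summable_fam (fun n => 'D_(e_ j) (f n)).
Proof.
move=> [kf bf]; split.
  by move=> m n; have [_ /(_ j)[]] := kf m.+1 n.
by move=> K m; have [B hB] := bf K m.+1; exists B => n; have [_ h] := hB n; exact: h.
Qed.

Lemma summable_fam_dominated f x : summable_fam f -> exists B, dominated (f ^~ x) B.
Proof.
move=> [kf bf]; have [B hB] := bf (Num.max `|x.1| `|x.2|) 0%N.
by exists B => n; apply: (Bd_val (hB n)); split; rewrite le_max lexx ?orbT.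
Qed.

Lemma fsum_dominated f K m B x : (forall n, Bd K m (f n) (B * invprod n)) -> box K x -> dominated (f ^~ x) B.
Proof. by move=> hB bx n; apply: (Bd_val (hB n)). Qed.

Lemma near0_lt (d : R) : 0 < d -> \forall t \near (0 : R), `|t| < d.
Proof.
move=> d0; have /cvgrPdist_lt : (t : R) @[t --> 0] --> (0 : R) by exact: cvg_id.
by move=> /(_ _ d0); apply: filterS => t; rewrite sub0r normrN.
Qed.

Lemma fsum_derive f j x : summable_fam f -> is_derive x (e_ j) (fsum f) (fsum (fun n => 'D_(e_ j) (f n)) x).
Proof.
move=> ff; have [kf bf] := ff; apply: derivable_line0.
pose K := Num.max `|x.1| `|x.2|.
have bx : box K x by split; rewrite le_max lexx ?orbT.
have [B hB] := bf (K + 1) 2%N.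
have [B1 d1] := summable_fam_dominated x ff.
have [B3 d3] := summable_fam_dominated x (summable_fam_D j ff).
have B0 : 0 <= B.
  by apply: (@dominated_ge0 (f ^~ x)); apply: (fsum_dominated hB); split; [move: bx.1|move: bx.2]; lra.
apply: der_small => e e0.
near=> t.
rewrite scale0r addr0.
have t1 : `|t| <= 1.
  by apply: ltW; near: t; exact: near0_lt.
have te : B * `|t| <= e.
  have : `|t| < e / (B + 1) by near: t; apply: near0_lt; rewrite divr_gt0// ltr_wpDl.
  rewrite ltr_pdivlMr ?ltr_wpDl// => h; nra.
have [B2 d2] := summable_fam_dominated (x + t *: e_ j) ff.
have d4 : dominated (fun n => f n (x + t *: e_ j) + (-1) * f n x) (B2 + B1).
  move=> n; rewrite mulN1r mulrDl; apply: (le_trans (ler_normB _ _)).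
    exact: lerD (d2 n) (d1 n).
have E : fsum f (x + t *: e_ j) - fsum f x - t * fsum (fun n => 'D_(e_ j) (f n)) x =
   rsum (fun n => (f n (x + t *: e_ j) + (-1) * f n x) + (- t) * 'D_(e_ j) (f n) x).
  by rewrite (rsum_lin _ d4 d3) (rsum_lin _ d2 d1) /fsum mulN1r mulNr.
rewrite E; apply: (@le_trans _ _ (B * t ^+ 2)).
  apply: rsum_le => n; rewrite mulN1r mulNr mulrAC.
  exact: (taylor2 j (kf 2%N n) (hB n) bx t1).
have -> : t ^+ 2 = `|t| * `|t| by rewrite -expr2 real_normK ?num_real.
by rewrite mulrA ler_wpM2r.
Unshelve. all: by end_near. Qed.

Lemma fsum_cont f : summable_fam f -> continuous (fsum f).
Proof.
move=> ff x; have [kf bf] := ff.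
pose K := Num.max `|x.1| `|x.2| + 1.
have x1 : `|x.1| <= K - 1 by rewrite addrK le_max lexx.
have x2 : `|x.2| <= K - 1 by rewrite addrK le_max lexx orbT.
have bx : box K x by split; lra.
have [B hB] := bf (3 * K) 1%N.
have K0 : 0 <= K by apply: le_trans bx.1.
have B0 : 0 <= B by apply: (@dominated_ge0 (f ^~ x)); apply: (fsum_dominated hB); split; [move: bx.1|move: bx.2]; lra.
apply/cvgrPdist_le => e e0.
pose d := Num.min 1 (e / (2 * B + 1)).
have B1 : 0 < 2 * B + 1 by rewrite ltr_wpDl// mulr_ge0.
have d0 : 0 < d by rewrite lt_min ltr01 divr_gt0.
near=> y.
have : ball x d y by near: y; exact: (nbhsx_ballx x d d0).
move=> [/=]; rewrite -!ball_normE /= => y1 y2.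
have dl1 : d <= 1 by rewrite ge_min lexx.
have by_ : box K y.
  split.
    have -> : y.1 = x.1 - (x.1 - y.1) by ring.
    by apply: (le_trans (ler_normB _ _)); lra.
  have -> : y.2 = x.2 - (x.2 - y.2) by ring.
  by apply: (le_trans (ler_normB _ _)); lra.
have [Bx dx] := summable_fam_dominated x ff; have [By dy] := summable_fam_dominated y ff.
have -> : fsum f x - fsum f y = rsum (fun n => f n x + (-1) * f n y).
  by rewrite (rsum_lin _ dx dy) mulN1r.
apply: (@le_trans _ _ (B * (`|x.1 - y.1| + `|x.2 - y.2|))).
  apply: rsum_le => n; rewrite mulN1r mulrAC.
  exact: (lip_box (kf 1%N n) (hB n)).
have de : d * (2 * B + 1) <= e by rewrite -ler_pdivlMr// ge_min lexx orbT.
by nra.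
Unshelve. all: by end_near. Qed.

Lemma fsum_Ck f m : summable_fam f -> Ck m (fsum f).
Proof.
elim: m f => [|m IH] f ff; first by split => //; exact: fsum_cont.
apply: (@Ck_intro _ _ _ (fun j => fsum (fun n => 'D_(e_ j) (f n)))).
- exact: fsum_cont.
- by move=> j x; exact: fsum_derive.
- by move=> j; apply: IH; exact: summable_fam_D.
Qed.

Lemma fsum_Bd f K m B : summable_fam f -> (forall n, Bd K m (f n) (B * invprod n)) -> Bd K m (fsum f) B.
Proof.
elim: m f => [|m IH] f ff hB.
  by split => // x bx; apply: rsum_le; exact: (fsum_dominated hB).
split; first by move=> x bx; apply: rsum_le; exact: (fsum_dominated hB).
move=> j; rewrite (derE (fun x => fsum_derive j x ff)).
by apply: IH; [exact: summable_fam_D|move=> n; have [_ h] := hB n; exact: h].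
Qed.

End RealSeries.

Definition zcode (k : int) : nat := match k with Posz n => n.*2 | Negz n => n.*2.+1 end.
(** The pairs of integers are numbered so that the index is bounded by a
    polynomial in the frequency: with s the sum of the two codes, the index
    lies between s ^ 2 and (s + 1) ^ 2, which makes it injective. *)
Definition code (xi : int * int) : nat := ((zcode xi.1 + zcode xi.2) ^ 2 + zcode xi.1)%N.

Lemma zcode_inj : injective zcode.
Proof. by move=> [m|m] [n|n] /= h; [congr Posz|exfalso|exfalso|congr Negz]; lia. Qed.

Lemma code_inj : injective code.
Proof.
move=> [a b] [c d]; rewrite /code /=; move: (zcode_inj (x1 := a) (x2 := c)) (zcode_inj (x1 := b) (x2 := d)).
move: (zcode a) (zcode b) (zcode c) (zcode d) => x y z w h1 h2 e.
have s : (x + y = z + w)%N by nia.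
have xz : x = z by move: e; rewrite s; lia.
have yw : y = w by lia.
by rewrite (h1 xz) (h2 yw).
Qed.

(** Not every number is a code, so [dec n] is only meaningful if n is one. *)
Definition dec (n : nat) : int * int := xget (0, 0) [set xi | code xi = n].

Lemma codeK : cancel code dec.
Proof.
move=> xi; apply: code_inj; rewrite /dec.
by case: xgetP => [y -> //|/(_ xi) /(_ erefl)].
Qed.

(** * Fourier series with rapidly decaying coefficients *)

Section ComplexSeries.
Variable R : realType.
Local Notation C := R[i].
Local Notation e_ j := (@evec R j).
Local Notation Re := complex.Re.
Local Notation Im := complex.Im.
Variable h : R * R.
Hypotheses (h1_gt0 : 0 < h.1) (h2_gt0 : 0 < h.2).

(** Comparable to the square of the weight of the frequency xi. *)
Definition wt (xi : int * int) : R := 1 + xi.1%:~R ^+ 2 + xi.2%:~R ^+ 2.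

Lemma wt_ge1 xi : 1 <= wt xi.
Proof. by rewrite /wt -addrA lerDl addr_ge0// sqr_ge0. Qed.

Lemma wt_ge0 xi : 0 <= wt xi. Proof. exact: le_trans (wt_ge1 xi). Qed.

Lemma zcode_le (k : int) : (zcode k)%:R <= 2 + k%:~R ^+ 2 :> R.
Proof.
case: k => n /=.
  rewrite -muln2 natrM -[X in X%:~R]/(n%:Z) -pmulrn.
  have : 0 <= (n%:R - 1) ^+ 2 :> R by rewrite sqr_ge0.
  by rewrite sqrrB1 => ?; nra.
rewrite NegzE mulrNz sqrrN -pmulrn -addn1 natrD -muln2 natrM.
have -> : n.+1%:R = n%:R + 1 :> R by rewrite natr1.
have : 0 <= n%:R ^+ 2 :> R by rewrite sqr_ge0.
by rewrite sqrrD1 => ?; lra.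
Qed.

Lemma code_le xi : ((code xi).+1%:R * (code xi).+2%:R) <= 484 * wt xi ^+ 4 :> R.
Proof.
have z1 := zcode_le xi.1; have z2 := zcode_le xi.2; have w1 := wt_ge1 xi.
pose s : R := (zcode xi.1)%:R + (zcode xi.2)%:R.
have s0 : 0 <= s by rewrite addr_ge0.
have s4 : s <= 4 * wt xi.
  have : 0 <= xi.1%:~R ^+ 2 :> R by rewrite sqr_ge0.
  have : 0 <= xi.2%:~R ^+ 2 :> R by rewrite sqr_ge0.
  by rewrite /s /wt; lra.
have cle : (code xi)%:R <= s ^+ 2 + s.
  by rewrite /code natrD natrX natrD -/s lerD2l lerDl.
have c2 : (code xi).+2%:R <= 22 * wt xi ^+ 2.
  have -> : (code xi).+2%:R = (code xi)%:R + 2 :> R by rewrite -addn2 natrD.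
  have : s ^+ 2 <= (4 * wt xi) ^+ 2 by rewrite ler_sqr ?nnegrE// (le_trans s0).
  have : 1 <= wt xi ^+ 2 by rewrite exprn_ege1.
  have : wt xi <= wt xi ^+ 2 by rewrite expr2 ler_peMr// wt_ge0.
  by rewrite exprMn; lra.
have c1 : (code xi).+1%:R <= 22 * wt xi ^+ 2.
  by apply: le_trans c2; rewrite ler_nat.
have -> : 484 * wt xi ^+ 4 = (22 * wt xi ^+ 2) * (22 * wt xi ^+ 2) by ring.
by rewrite ler_pM.
Qed.

(** The value of the constant is hidden from now on, since only its existence
    matters. *)
Lemma enum_cst_sig : {k : R | 0 <= k & forall xi, 1 <= k * wt xi ^+ 4 * invprod R (code xi)}.
Proof.
exists 484 => [|xi]; first exact: ler0n.
by rewrite /invprod -ler_pdivrMr ?invr_gt0 ?mulr_gt0// invrK mul1r code_le.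
Qed.

Definition enum_cst : R := s2val enum_cst_sig.

Lemma enum_cst_ge0 : 0 <= enum_cst. Proof. exact: (s2valP enum_cst_sig). Qed.

Lemma invprod_wt xi : 1 <= enum_cst * wt xi ^+ 4 * invprod R (code xi).
Proof. exact: (s2valP' enum_cst_sig). Qed.

Definition decay m (c : int * int -> C) B := forall xi, normc (c xi) * wt xi ^+ m <= B.
Definition rapid c := forall m, exists B, decay m c B.

Lemma decay_ge0 m c B : decay m c B -> 0 <= B.
Proof. by move=> /(_ (0, 0)); apply: le_trans; rewrite mulr_ge0 ?normc_nneg ?exprn_ge0 ?wt_ge0. Qed.

Definition freq_cst : R := 1 + `|ln h.1| + `|ln h.2| + 2 * pi.

Lemma freq_cst_ge1 : 1 <= freq_cst.
Proof. by rewrite /freq_cst -!addrA lerDl !addr_ge0// mulr_ge0// pi_ge0. Qed.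

Lemma int_le_sqr (k : int) : `|k%:~R| <= 1 + k%:~R ^+ 2 :> R.
Proof.
rewrite -[X in _ + X]real_normK ?num_real//; set a := `|_|.
have : 0 <= (a - 1) ^+ 2 by rewrite sqr_ge0.
have : 0 <= a by rewrite normr_ge0.
by rewrite sqrrB1; lra.
Qed.

(** A derivative of [ev h xi] costs a factor of order [wt xi]. *)
Lemma freq_le xi j : normc (if j then freq h.2 xi.2 else freq h.1 xi.1) <= freq_cst * wt xi.
Proof.
have w1 := wt_ge1 xi; have p0 := pi_ge0 R.
have a1 := normr_ge0 (ln h.1); have a2 := normr_ge0 (ln h.2).
have key (l : R) (k : int) : `|l| <= `|ln h.1| + `|ln h.2| -> 1 + k%:~R ^+ 2 <= wt xi ->
   normc (l +i* (2 * pi * k%:~R)) <= freq_cst * wt xi.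
  move=> hl hk; rewrite (le_trans (normc_le_ReIm _))//= normrM (@ger0_norm _ (2 * pi)) ?mulr_ge0//.
  have := int_le_sqr k => ik.
  have : 2 * pi * `|k%:~R| <= 2 * pi * wt xi by rewrite ler_wpM2l ?mulr_ge0// (le_trans ik).
  by rewrite /freq_cst; nra.
case: j; apply: key; rewrite /wt; do ?lra.
  by have := sqr_ge0 (xi.1%:~R : R); lra.
by have := sqr_ge0 (xi.2%:~R : R); lra.
Qed.

Lemma cBd_intro K n (f : R * R -> C) M : (forall x, box K x -> normc (f x) <= M) ->
  (forall j, cBd K n (pd j f) M) -> cBd K n.+1 f M.
Proof.
move=> fM dM; split; split.
- by move=> x bx; exact: le_trans (Re_le_normc _) (fM _ bx).
- by move=> j; have [] := dM j.
- by move=> x bx; exact: le_trans (Im_le_normc _) (fM _ bx).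
- by move=> j; have [] := dM j.
Qed.

Definition ev_bound (K : R) : R := expR (K * (`|ln h.1| + `|ln h.2|)).

Lemma normc_ev K xi x : box K x -> normc (ev h xi x) <= ev_bound K.
Proof.
move=> [x1 x2]; rewrite /ev normc_cexp ler_expR !cE /= !mulr0 !subr0 !mulNr.
have ab (a b : R) : `|b| <= K -> - (a * b) <= `|a| * K.
  move=> bK; apply: (le_trans (ler_norm _)); rewrite normrN normrM ler_wpM2l//.
by rewrite [K * _]mulrC mulrDl lerD// ab.
Qed.

Lemma Bd_ev K m c xi : cBd K m (fun x => c * ev h xi x) (normc c * (freq_cst * wt xi) ^+ m * ev_bound K).
Proof.
have FW : 1 <= freq_cst * wt xi by rewrite mulr_ege1 ?freq_cst_ge1 ?wt_ge1.
have E0 : 0 <= ev_bound K by rewrite expR_ge0.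
have val c' x : box K x -> normc (c' * ev h xi x) <= normc c' * ev_bound K.
  by move=> bx; rewrite normcM ler_wpM2l ?normc_nneg ?normc_ev.
elim: m c => [|m IH] c.
  by rewrite expr0 mulr1; split; split => // x bx; [apply: le_trans (Re_le_normc _) _|apply: le_trans (Im_le_normc _) _]; exact: val.
apply: cBd_intro.
  move=> x bx; apply: (le_trans (val _ _ bx)); rewrite ler_wpM2r//.
  by rewrite ler_peMr ?normc_nneg// exprn_ege1.
move=> j; rewrite pdZ; last exact: smooth2_ex2.
rewrite ex2_pd; under eq_fun do rewrite mulrA.
apply: cBd_mono (IH _); rewrite ler_wpM2r// exprS mulrA ler_wpM2r ?exprn_ge0//.
  exact: le_trans FW.
rewrite normcM ler_wpM2l ?normc_nneg//.
have -> : zc (- freq h.1 xi.1, - freq h.2 xi.2) j = - (if j then freq h.2 xi.2 else freq h.1 xi.1).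
  by case: j.
by rewrite normcN; exact: freq_le.
Qed.

(** The series is indexed by natural numbers, with zero terms at the numbers
    that are not codes. *)
Definition Sterm (c : int * int -> C) n x : C :=
  if code (dec n) == n then c (dec n) * ev h (dec n) x else 0.

Lemma smooth2_Sterm c n : smooth2 (Sterm c n).
Proof.
rewrite /Sterm; case: eqP => _; last exact: smooth2_cst.
by apply: smooth2Z; exact: smooth2_ex2.
Qed.

(** Dividing by [invprod] at the index of xi costs four powers of the weight, see
    [invprod_wt]; this is where the order m + 4 below comes from. *)
Definition Ser_bound K m : R := enum_cst * freq_cst ^+ m * ev_bound K.

Lemma Ser_bound_ge0 K m : 0 <= Ser_bound K m.
Proof.
apply: mulr_ge0; last exact: expR_ge0.
apply: mulr_ge0; first exact: enum_cst_ge0.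
apply: exprn_ge0; exact: le_trans freq_cst_ge1.
Qed.

Lemma Bd_Sterm K m c B n : decay (m + 4) c B -> cBd K m (Sterm c n) (Ser_bound K m * B * invprod R n).
Proof.
move=> dc; rewrite /Sterm; case: eqP => [e|_]; last first.
  apply: (@cBd_mono _ _ _ _ 0).
    by apply: mulr_ge0; [apply: mulr_ge0; [exact: Ser_bound_ge0|exact: decay_ge0 dc]|exact: invprod_ge0].
  have := Bd_ev K m 0 (0, 0); rewrite normc0 !mul0r.
  by under eq_fun do rewrite mul0r.
apply: cBd_mono (Bd_ev _ _ _ _).
have := invprod_wt (dec n); rewrite e => q1.
have dd := dc (dec n).
have E0 : 0 <= ev_bound K by rewrite expR_ge0.
have F0 : 0 <= freq_cst ^+ m by rewrite exprn_ge0// (le_trans _ freq_cst_ge1).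
have w0 := wt_ge0 (dec n).
rewrite exprMn /Ser_bound; have n0 := normc_nneg (c (dec n)).
apply: (@le_trans _ _ (normc (c (dec n)) * (freq_cst ^+ m * wt (dec n) ^+ m) * ev_bound K * (enum_cst * wt (dec n) ^+ 4 * invprod R n))).
  by rewrite ler_peMr// !mulr_ge0// exprn_ge0.
have -> : normc (c (dec n)) * (freq_cst ^+ m * wt (dec n) ^+ m) * ev_bound K * (enum_cst * wt (dec n) ^+ 4 * invprod R n)
  = (enum_cst * freq_cst ^+ m * ev_bound K * invprod R n) * (normc (c (dec n)) * wt (dec n) ^+ (m + 4)).
  by rewrite exprD; ring.
have -> : enum_cst * freq_cst ^+ m * ev_bound K * B * invprod R n = (enum_cst * freq_cst ^+ m * ev_bound K * invprod R n) * B by ring.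
have A0 : 0 <= Ser_bound K m * invprod R n by apply: mulr_ge0; [exact: Ser_bound_ge0|exact: invprod_ge0].
by apply: ler_wpM2l; [exact: A0|exact: dd].
Qed.

Definition Sterm_re c n x : R := Re (Sterm c n x).
Definition Sterm_im c n x : R := Im (Sterm c n x).

Lemma summable_fam_Sterm c : rapid c -> summable_fam (Sterm_re c) /\ summable_fam (Sterm_im c).
Proof.
move=> rc; split; split.
- by move=> m n; have [] := smooth2_Sterm c n m.
- move=> K m; have [B dc] := rc (m + 4)%N; exists (Ser_bound K m * B) => n.
  by have [] := Bd_Sterm K n dc.
- by move=> m n; have [] := smooth2_Sterm c n m.
- move=> K m; have [B dc] := rc (m + 4)%N; exists (Ser_bound K m * B) => n.
  by have [] := Bd_Sterm K n dc.
Qed.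

Definition Ser c x : C := fsum (Sterm_re c) x +i* fsum (Sterm_im c) x.

Lemma smooth2_Ser c : rapid c -> smooth2 (Ser c).
Proof. by move=> /summable_fam_Sterm[f1 f2] n; split; exact: fsum_Ck. Qed.

Lemma Bd_Ser K m c B : rapid c -> decay (m + 4) c B -> cBd K m (Ser c) (Ser_bound K m * B).
Proof.
move=> rc dc; have [f1 f2] := summable_fam_Sterm rc; split; apply: fsum_Bd => // n; have [] := Bd_Sterm K n dc; by [].
Qed.

Lemma rsumZ (t : nat -> R) (a B : R) : dominated t B -> rsum (fun n => a * t n) = a * rsum t.
Proof.
move=> dt; have d0 : dominated (fun=> 0 : R) 0 by move=> n; rewrite normr0 mul0r.
have := rsum_lin a d0 dt; rewrite [X in _ = X + _]/rsum.
have -> : rsum (fun n => 0 + a * t n) = rsum (fun n => a * t n).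
  by congr rsum; apply/funext => n; rewrite add0r.
move=> ->; rewrite -/(rsum (fun=> 0)) (@rsum_fin _ _ 0%N)// big_geq// add0r//.
Qed.

Lemma Sterm_shift c n j x : Sterm c n x = (coord j h)%:C * Sterm c n (x + e_ j).
Proof.
rewrite /Sterm; case: ifP => _; last by rewrite mulr0.
by rewrite (ev_shift _ j)// mulrCA.
Qed.

Lemma Q_Ser c : rapid c -> Q h (Ser c).
Proof.
move=> rc; split; first exact: smooth2_Ser.
move=> j x; have [f1 f2] := summable_fam_Sterm rc.
have [B1 d1] := summable_fam_dominated (x + e_ j) f1; have [B2 d2] := summable_fam_dominated (x + e_ j) f2.
apply: eqcP; rewrite !cE mul0r ?subr0 ?addr0.
  rewrite /fsum -(rsumZ _ d1); congr rsum; apply/funext => n.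
  by rewrite /Sterm_re (Sterm_shift c n j) !cE mul0r subr0.
rewrite /fsum -(rsumZ _ d2); congr rsum; apply/funext => n.
by rewrite /Sterm_im (Sterm_shift c n j) !cE mul0r addr0.
Qed.

Definition tailc N (c : int * int -> C) xi : C := if (code xi < N)%N then 0 else c xi.

Lemma decay_tail_le N m c B : decay m c B -> decay m (tailc N c) B.
Proof.
move=> dc xi; rewrite /tailc; case: ifP => _ //.
by rewrite normc0 mul0r (decay_ge0 dc).
Qed.

Lemma rapid_tail N c : rapid c -> rapid (tailc N c).
Proof. by move=> rc m; have [B dc] := rc m; exists B; exact: decay_tail_le. Qed.

(** Tails of a rapidly decaying family are small in every norm, at the price
    of four powers of the weight. *)
Lemma decay_tail N m c B : decay (m + 4) c B -> decay m (tailc N c) (enum_cst * B * N.+1%:R^-1).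
Proof.
move=> dc xi; have B0 := decay_ge0 dc; rewrite /tailc; case: ltnP => [_|Nc].
  by rewrite normc0 mul0r; apply: mulr_ge0; [apply: mulr_ge0 => //; exact: enum_cst_ge0|rewrite invr_ge0; exact: ler0n].
have q1 := invprod_wt xi.
have w0 := wt_ge0 xi; have n0 := normc_nneg (c xi).
apply: (@le_trans _ _ (normc (c xi) * wt xi ^+ m * (enum_cst * wt xi ^+ 4 * invprod R (code xi)))).
  by rewrite ler_peMr// !mulr_ge0// exprn_ge0.
have -> : normc (c xi) * wt xi ^+ m * (enum_cst * wt xi ^+ 4 * invprod R (code xi)) =
   enum_cst * (normc (c xi) * wt xi ^+ (m + 4)) * invprod R (code xi) by rewrite exprD; ring.
apply: ler_pM.
- by apply: mulr_ge0; [exact: enum_cst_ge0|apply: mulr_ge0 => //; exact: exprn_ge0].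
- exact: invprod_ge0.
- by apply: ler_wpM2l; [exact: enum_cst_ge0|exact: dc].
by rewrite (le_trans (invprod_le _ _))// lef_pV2 ?posrE// ler_nat.
Qed.

Lemma Re_sum (T : nat -> C) N : Re (\sum_(0 <= k < N) T k) = \sum_(0 <= k < N) Re (T k).
Proof. by elim: N => [|N IH]; [rewrite !big_geq|rewrite !big_nat_recr//= ReD IH]. Qed.
Lemma Im_sum (T : nat -> C) N : Im (\sum_(0 <= k < N) T k) = \sum_(0 <= k < N) Im (T k).
Proof. by elim: N => [|N IH]; [rewrite !big_geq|rewrite !big_nat_recr//= ImD IH]. Qed.

Lemma Sterm_tail N c n x : Sterm (tailc N c) n x = if (n < N)%N then 0 else Sterm c n x.
Proof.
rewrite /Sterm /tailc; case: ifP => [/eqP ->|_]; last by case: ifP.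
by case: ifP => // _; rewrite mul0r.
Qed.

Lemma Ser_split N c x : rapid c ->
  Ser c x = (\sum_(0 <= k < N) Sterm c k x) + Ser (tailc N c) x.
Proof.
move=> rc; have [f1 f2] := summable_fam_Sterm rc; have [g1 g2] := summable_fam_Sterm (rapid_tail N rc).
have key (t t' : nat -> R) B B' : dominated t B -> dominated t' B' ->
    (forall n, t' n = if (n < N)%N then 0 else t n) ->
    rsum t = \sum_(0 <= k < N) t k + rsum t'.
  move=> dt dt' E; have := rsum_lin (-1) dt dt'.
  rewrite (@rsum_fin _ _ N); last by move=> n Nn; rewrite E ltnNge Nn /= mulN1r subrr.
  rewrite (@eq_big_nat _ _ _ _ _ _ t); last by move=> n /andP[_ nN]; rewrite E nN mulr0 addr0.
  by move=> ->; rewrite mulN1r subrK.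
have [B1 d1] := summable_fam_dominated x f1; have [B2 d2] := summable_fam_dominated x f2.
have [B3 d3] := summable_fam_dominated x g1; have [B4 d4] := summable_fam_dominated x g2.
have e1 n : Sterm_re (tailc N c) n x = if (n < N)%N then 0 else Sterm_re c n x.
  by rewrite /Sterm_re Sterm_tail; case: ifP.
have e2 n : Sterm_im (tailc N c) n x = if (n < N)%N then 0 else Sterm_im c n x.
  by rewrite /Sterm_im Sterm_tail; case: ifP.
apply: eqcP; rewrite /Ser !cE ?Re_sum ?Im_sum.
  exact: (key _ _ _ _ d1 d3 e1).
exact: (key _ _ _ _ d2 d4 e2).
Qed.

End ComplexSeries.

(** * Fourier coefficients of test functions *)

Section FourierCoefficients.
Variable R : realType.
Local Notation C := R[i].
Local Notation leb := (@lebesgue_measure R).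
Local Notation R2 := (measurableTypeR R * measurableTypeR R)%type.
Local Notation leb2 := (leb \x leb)%E.
Local Notation Om := (@Omega R).
Local Notation e_ j := (@evec R j).
Local Notation Re := complex.Re.
Local Notation Im := complex.Im.
Variable h : R * R.
Hypotheses (h1_gt0 : 0 < h.1) (h2_gt0 : 0 < h.2).
Local Notation adj := (adjoint leb2 Om (Lh h)).
Local Notation mO := (@measurable_Omega R).

Definition coef (f : R2 -> C) (xi : int * int) : C :=
  cintegral leb2 Om (fun x => f x * uu h xi x).

Definition uu_bound : R := ev_bound h 1.
Lemma uu_bound_gt0 : 0 < uu_bound. Proof. exact: expR_gt0. Qed.

Lemma normc_uu xi x : Om x -> normc (uu h xi x) <= uu_bound.
Proof.
move=> [/andP[x0 x1] /andP[y0 y1]]; rewrite /uu normc_cexp ler_expR !cE /= !mulr0 !subr0 mul1r.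
have ab (a b : R) : 0 < b -> b < 1 -> a * b <= `|a|.
  move=> b0 b1; apply: (le_trans (ler_norm _)); rewrite normrM (gtr0_norm b0).
  by rewrite ler_piMr// ltW.
by rewrite lerD// ab.
Qed.

Lemma cmeas_uu xi : cmeas Om (uu h xi : R2 -> C).
Proof. by apply: cCk0_meas; exact: (@smooth2_ex2 R _ 0%N). Qed.

Lemma integrable_cst_Om (c : R) : leb2.-integrable Om (EFin \o (fun=> c)).
Proof. by apply: (@bounded_integrable_Omega R _ `|c|) => //; exact: measurable_cst. Qed.

Lemma Rint_cst_Om (c : R) : \int[leb2]_(x in Om) c = c.
Proof.
rewrite Rintegral_cst//; last exact: mO.
by rewrite [X in fine X](_ : _ = 1%E) ?mulr1//; exact: lebesgue_Omega.
Qed.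

Lemma L2_cintegrable (f : R2 -> C) : L2 leb2 Om f -> cintegrable leb2 Om f.
Proof. exact: (L2_integrable mO (@finite_Omega R)). Qed.

Lemma cintegrable_uu (f : R2 -> C) xi : cintegrable leb2 Om f ->
  cintegrable leb2 Om (fun x => f x * uu h xi x).
Proof. by move=> fi; apply: (cintegrableM mO fi (cmeas_uu xi)) => x Ox; exact: normc_uu Ox. Qed.

Lemma L2norm_sqr (f : R2 -> C) : L2norm leb2 Om f ^+ 2 = \int[leb2]_(x in Om) (normc (f x) ^+ 2).
Proof. by rewrite /L2norm sqr_sqrtr// Rintegral_ge0// => x _; rewrite sqr_ge0. Qed.

Lemma L2norm_ge0 (f : R2 -> C) : 0 <= L2norm leb2 Om f.
Proof. exact: sqrtr_ge0. Qed.

(** The elementary inequality n <= M + n ^ 2 / M replaces the inequality of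
    Cauchy and Schwarz. *)
Lemma coef_le (f : R2 -> C) M xi : L2 leb2 Om f -> 0 < M -> L2norm leb2 Om f <= M ->
  normc (coef f xi) <= 4 * uu_bound * M.
Proof.
move=> f2 M0 fM; have fi := L2_cintegrable f2; have E0 := uu_bound_gt0.
have ci := cintegrable_uu xi fi.
apply: (le_trans (normc_cintegral mO ci)).
(* n <= M + n ^ 2 / M for the modulus n of f *)
have i2 : leb2.-integrable Om (EFin \o (fun x => uu_bound * (M + M^-1 * normc (f x) ^+ 2))).
  by apply/(integrable_RZ mO)/(integrable_RD mO); [exact: integrable_cst_Om|exact/(integrable_RZ mO)/L2_normsq].
have le1 : \int[leb2]_(x in Om) normc (f x * uu h xi x) <= \int[leb2]_(x in Om) (uu_bound * (M + M^-1 * normc (f x) ^+ 2)).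
  apply: le_Rintegral => //; [exact: mO|exact: integrable_normc mO _ ci|].
  move=> x Ox; rewrite normcM mulrC ler_pM ?normc_nneg ?normc_uu//.
  set n := normc (f x); have n0 : 0 <= n by exact: normc_nneg.
  rewrite -(ler_pM2l M0) mulrDr mulrA mulfV ?gt_eqF// mul1r.
  by have := sqr_ge0 (n - M); rewrite sqrrB; nra.
have : \int[leb2]_(x in Om) (uu_bound * (M + M^-1 * normc (f x) ^+ 2)) <= uu_bound * (2 * M).
  rewrite RintegralZl; [|exact: mO|]; last first.
    by apply: (integrable_RD mO); [exact: integrable_cst_Om|exact/(integrable_RZ mO)/L2_normsq].
  rewrite RintegralD; [|exact: mO|exact: integrable_cst_Om|exact/(integrable_RZ mO)/L2_normsq].
  rewrite RintegralZl; [|exact: mO|exact: L2_normsq].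
  rewrite Rint_cst_Om -L2norm_sqr; apply: ler_wpM2l; first exact: ltW.
  have : M^-1 * L2norm leb2 Om f ^+ 2 <= M.
    rewrite mulrC ler_pdivrMr// -expr2 ler_sqr ?nnegrE ?L2norm_ge0//; exact: ltW.
  lra.
by move: le1; lra.
Qed.

Lemma uuJ xi x : (Num.conj (uu h xi x)) = uu h (- xi.1, - xi.2) x.
Proof.
rewrite /uu /ex2 cexpJ; congr cexp; rewrite /freq /= !mulrNz.
by apply: eqcP; rewrite !cE; ring.
Qed.

Lemma lamJ xi : (Num.conj (lam h xi)) = lam h (- xi.1, - xi.2).
Proof. by rewrite /lam /freq /= !mulrNz !expr2; apply: eqcP; rewrite !cE; ring. Qed.

(** The function u at the frequency - xi is the complex conjugate of u at xi
    and belongs to the domain of L_h, so it may be used in the definition of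
    the adjoint. *)
Lemma coef_adj (f g : R2 -> C) xi : adj f g -> coef g xi = lam h xi * coef f xi.
Proof.
move=> [f2 g2 a]; have fi := L2_cintegrable f2; have gi := L2_cintegrable g2.
have := a _ _ (Lh_uu (- xi.1, - xi.2) h1_gt0 h2_gt0); rewrite /inner => e.
have ci (k : R2 -> C) := @cintegrable_uu k xi.
rewrite /coef -cintegralZ; [|exact: mO|exact: ci].
apply: conj_inj; rewrite -!cintegralJ; [|exact: mO|apply: cintegrableZ; [exact: mO|exact: ci]|exact: mO|exact: ci].
transitivity (cintegral leb2 Om (fun x => uu h (- xi.1, - xi.2) x * (Num.conj (g x)))).
  by apply: eq_cintegral => x _; rewrite conjM uuJ mulrC.
rewrite -e; apply: eq_cintegral => x _.
by rewrite conjM lamJ conjM uuJ; ring.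
Qed.

Lemma coef_iter k (f g : R2 -> C) : L2 leb2 Om f -> iterop adj k f g ->
  L2 leb2 Om g /\ forall xi, coef g xi = lam h xi ^+ k * coef f xi.
Proof.
elim: k f => [|k IH] f f2 /=; first by move=> <-; split => // xi; rewrite expr0 mul1r.
move=> [f' ff' f'g]; have [_ f'2 _] := ff'; have [g2 gE] := IH _ f'2 f'g.
by split => // xi; rewrite gE (coef_adj _ ff') exprSr mulrA.
Qed.

Lemma Hinf_L2 f : Hinf adj f -> L2 leb2 Om f.
Proof. by move=> /(_ 1%N isT) [g [f' [? _ _] _]]. Qed.

Definition lam_cst : R := 1 + ln h.1 ^+ 2 + ln h.2 ^+ 2.
Lemma lam_cst_ge1 : 1 <= lam_cst.
Proof. by rewrite /lam_cst -addrA lerDl addr_ge0// sqr_ge0. Qed.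

(** The operator is elliptic: the real part of lambda_xi tends to minus
    infinity like the square of xi. *)
Lemma wt_lam xi : wt R xi <= lam_cst * (1 + normc (lam h xi)).
Proof.
have n0 := normc_nneg (lam h xi); have B1 := lam_cst_ge1.
have p2 : 1 <= (2 * pi) ^+ 2 :> R.
  by rewrite exprn_ege1//; have := pi_ge2 R; lra.
have := Re_le_normc (lam h xi); rewrite ler_norml => /andP[rl _].
have rE : Re (lam h xi) = ln h.1 ^+ 2 + ln h.2 ^+ 2 - (2 * pi) ^+ 2 * (xi.1%:~R ^+ 2 + xi.2%:~R ^+ 2).
  by rewrite /lam /freq !expr2 !cE; ring.
have s0 : 0 <= xi.1%:~R ^+ 2 + xi.2%:~R ^+ 2 :> R by rewrite addr_ge0// sqr_ge0.
move: s0 rE; set s := _ + _ => s0 rE.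
have -> : wt R xi = 1 + s by rewrite /wt -addrA.
have h0 : s <= (2 * pi) ^+ 2 * s by rewrite ler_peMl.
have : lam_cst - 1 = ln h.1 ^+ 2 + ln h.2 ^+ 2 by rewrite /lam_cst; ring.
by nra.
Qed.

Definition coef_cst (m : nat) : R := (lam_cst * 2) ^+ m * (8 * uu_bound).

Lemma coef_cst_ge0 m : 0 <= coef_cst m.
Proof.
have := lam_cst_ge1; have := uu_bound_gt0 => ? ?.
by apply: mulr_ge0; [apply: exprn_ge0; lra|lra].
Qed.

Lemma decay_bd m f g M : L2 leb2 Om f -> iterop adj m f g -> 0 < M ->
  L2norm leb2 Om f <= M -> L2norm leb2 Om g <= M -> decay m (coef f) (coef_cst m * M).
Proof.
move=> f2 fg M0 fM gM xi; have [g2 gE] := coef_iter f2 fg.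
have c1 := coef_le xi f2 M0 fM; have c2 := coef_le xi g2 M0 gM.
rewrite gE normcM normcX in c2.
have n0 := normc_nneg (lam h xi); set n := normc (lam h xi) in n0 c2 *.
have w1 := wt_lam xi; rewrite -/n in w1.
have B1 := lam_cst_ge1; have c0 := normc_nneg (coef f xi).
have wm : wt R xi ^+ m <= (lam_cst * 2) ^+ m * (1 + n ^+ m).
  apply: (@le_trans _ _ ((lam_cst * (1 + n)) ^+ m)).
    by apply: lerXn2r => //; rewrite nnegrE; [exact: wt_ge0|apply: mulr_ge0; lra].
  by rewrite !exprMn -mulrA ler_wpM2l ?exprD1_le//; apply: exprn_ge0; lra.
have Bm : 0 <= (lam_cst * 2) ^+ m by apply: exprn_ge0; lra.
apply: (@le_trans _ _ (normc (coef f xi) * ((lam_cst * 2) ^+ m * (1 + n ^+ m)))).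
  by rewrite ler_wpM2l.
have -> : coef_cst m * M = (lam_cst * 2) ^+ m * (8 * uu_bound * M) by rewrite /coef_cst -mulrA.
rewrite mulrCA; apply: ler_wpM2l => //; rewrite mulrDr mulr1.
have c3 : normc (coef f xi) * n ^+ m <= 4 * uu_bound * M by rewrite mulrC.
lra.
Qed.

Lemma Hinf_iter f k : Hinf adj f -> exists g, iterop adj k f g.
Proof. by case: k => [_|k /(_ k.+1 isT)//]; exists f. Qed.

Lemma Hinf_rapid f : Hinf adj f -> rapid (coef f).
Proof.
move=> hf m; have f2 := Hinf_L2 hf; have [g fg] := Hinf_iter m hf.
exists (coef_cst m * (L2norm leb2 Om f + L2norm leb2 Om g + 1)).
have := L2norm_ge0 f; have := L2norm_ge0 g => g0 f0.
by apply: (decay_bd f2 fg); lra.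
Qed.

Lemma coefD (f g : R2 -> C) xi : cintegrable leb2 Om f -> cintegrable leb2 Om g ->
  coef (fun x => f x + g x) xi = coef f xi + coef g xi.
Proof.
move=> fi gi; rewrite /coef -(cintegralD mO (cintegrable_uu _ fi) (cintegrable_uu _ gi)).
by apply: eq_cintegral => x _; ring.
Qed.

Lemma coefZ c (f : R2 -> C) xi : cintegrable leb2 Om f ->
  coef (fun x => c * f x) xi = c * coef f xi.
Proof.
move=> fi; rewrite /coef -(cintegralZ mO _ (cintegrable_uu _ fi)).
by apply: eq_cintegral => x _; ring.
Qed.

(** Multiplication by the nowhere vanishing function u_0 turns the
    coefficients into ordinary Fourier coefficients. *)
Lemma coef_unique (f g : R2 -> C) : cintegrable leb2 Om f -> cintegrable leb2 Om g ->
  (forall xi, coef f xi = coef g xi) -> {ae leb2, forall x, Om x -> f x = g x}.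
Proof.
move=> fi gi fg; pose hx : R2 -> C := uu h (0, 0).
pose D x := (f x + (-1) * g x) * hx x.
have gi' := cintegrableZ mO (-1) gi.
have di : cintegrable leb2 Om (fun x => f x + (-1) * g x) by exact: (cintegrableD mO fi gi').
have Di : cintegrable leb2 Om D.
  apply: (cintegrableM mO di (cmeas_uu (0, 0))) => x Ox; exact: normc_uu Ox.
have : {ae leb2, forall x, Om x -> D x = 0}.
  apply: (fourier_unique2 Di) => k l.
  have := coefD (k, l) fi gi'; rewrite (coefZ _ _ gi) fg mulN1r subrr => <-; apply: eq_cintegral => x _.
  rewrite /D -mulrA; congr (_ * _); rewrite /hx /uu /ex2 -cexpD; congr cexp.
  by rewrite /freq /phase /=; apply: eqcP; rewrite !cE; ring.
apply: filterS => x Dx Ox; apply/eqP; rewrite -subr_eq0 -[X in _ - X]mul1r -mulNr; apply/eqP.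
have /eqP := Dx Ox; rewrite /D mulf_eq0 => /orP[/eqP //|/eqP h0].
have := normc_cexp ((freq h.1 0) * (x.1)%:C + (freq h.2 0) * (x.2)%:C).
rewrite -[cexp _]/(hx x) h0 normc0 => e; have := expR_gt0 (Re (freq h.1 0 * (x.1)%:C + freq h.2 0 * (x.2)%:C)).
by rewrite -e ltxx.
Qed.

(** A character of nonzero frequency is a derivative of a periodic function. *)
Lemma char_int (k l : int) : (k, l) != (0, 0) ->
  cintegral leb2 Om (fun x => cexp (0 +i* phase k l x)) = 0.
Proof.
move=> kl.
pose z : C * C := (0 +i* (2 * pi * k%:~R), 0 +i* (2 * pi * l%:~R)).
have zE x : cexp (0 +i* phase k l x) = ex2 z x.
  by rewrite /ex2; congr cexp; rewrite /phase /z; apply: eqcP; rewrite !cE; ring.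
have [j zj] : exists j, zc z j != 0.
  have nz (n : int) : n != 0 -> (0 +i* (2 * pi * n%:~R) : C) != 0.
    move=> n0; apply/eqP => /(congr1 (@complex.Im R)) /= /eqP; rewrite !mulf_eq0 pnatr_eq0 /= intr_eq0 (negbTE n0) orbF.
    by rewrite gt_eqF// pi_gt0.
  move: kl; rewrite xpair_eqE negb_and => /orP[k0|l0]; first by exists false; exact: nz.
  by exists true; exact: nz.
transitivity (cintegral leb2 Om (ex2 z : R2 -> C)).
  by apply: eq_cintegral => x _; rewrite zE.
have sz := smooth2_ex2 z.
have := @cdiv0 R (fun x => (zc z j)^-1 * ex2 z x) (ex2 z) j.
apply.
- exact: (@smooth2Z _ _ _ sz 0%N).
- exact: (sz 0%N).
- have := cderivM (cderiv_cst j (zc z j)^-1) (ex2_cderiv z j).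
  by congr (cderiv _ _ _); apply/funext => x; rewrite mul0r add0r mulrA mulVf// mul1r.
- move=> t _; rewrite faceS ex2_shift.
  have -> : cexp (zc z j) = 1 by case: j {zj} => /=; exact: cexp_2pi.
  by rewrite mul1r.
Qed.

Lemma coef_ev xi eta : coef (ev h xi) eta = if xi == eta then 1 else 0.
Proof.
transitivity (cintegral leb2 Om (fun x => cexp (0 +i* phase (eta.1 - xi.1) (eta.2 - xi.2) x))).
  by apply: eq_cintegral => x _; rewrite mulrC uu_ev.
case: eqP => [->|ne].
  transitivity (cintegral leb2 Om (fun=> 1)); last first.
    by rewrite /cintegral; apply: eqcP; rewrite !cE Rint_cst_Om.
  by apply: eq_cintegral => x _; rewrite !subrr /phase !mulr0 addr0 cexp_i cos0 sin0.
have kl : (eta.1 - xi.1, eta.2 - xi.2) != (0, 0).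
  apply/eqP => -[/eqP a /eqP b]; apply: ne.
  by move: a b; rewrite !subr_eq0 => /eqP a /eqP b; case: xi eta a b => [? ?] [? ?] /= -> ->.
exact: (char_int kl).
Qed.

Lemma coef_small (f : R * R -> C) M xi : cCk 0 f -> 0 < M -> cBd 1 0 f M ->
  normc (coef f xi) <= 8 * uu_bound * M.
Proof.
move=> kf M0 bf.
have f2 := L2_cCk0 kf.
have -> : 8 * uu_bound * M = 4 * uu_bound * (2 * M) by ring.
apply: coef_le => //; first by rewrite mulr_gt0.
have M2 : 0 <= 2 * M by lra.
have : L2norm leb2 Om f ^+ 2 <= (2 * M) ^+ 2.
  rewrite L2norm_sqr -[X in _ <= X]Rint_cst_Om; apply: le_Rintegral.
  - exact: mO.
  - exact: L2_normsq.
  - exact: integrable_cst_Om.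
  - move=> x Ox; rewrite ler_sqr ?nnegrE ?normc_nneg//.
    exact: cBd_val bf (Omega_box Ox).
by rewrite ler_sqr// nnegrE L2norm_ge0.
Qed.

End FourierCoefficients.

(** * Test functions are smooth and quasi-periodic *)

Section Regularity.
Variable R : realType.
Local Notation C := R[i].
Local Notation leb := (@lebesgue_measure R).
Local Notation R2 := (measurableTypeR R * measurableTypeR R)%type.
Local Notation leb2 := (leb \x leb)%E.
Local Notation Om := (@Omega R).
Local Notation e_ j := (@evec R j).
Local Notation Re := complex.Re.
Local Notation Im := complex.Im.
Variable h : R * R.
Hypotheses (h1_gt0 : 0 < h.1) (h2_gt0 : 0 < h.2).
Local Notation adj := (adjoint leb2 Om (Lh h)).
Local Notation mO := (@measurable_Omega R).
Local Notation coef := (@coef R h).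
Local Notation Ser := (@Ser R h).

Lemma le_inv_eq0 (x K : R) N0 : 0 <= x -> (forall N, (N0 <= N)%N -> x <= K * N.+1%:R^-1) -> x = 0.
Proof.
move=> x0 hx; apply/eqP; rewrite eq_le x0 andbT.
have c : (K * n.+1%:R^-1) @[n --> \oo] --> (K * 0).
  by apply: cvgM; [exact: cvg_cst|exact: cvg_harmonic].
rewrite mulr0 in c.
rewrite -(cvg_lim (@Rhausdorff R) c); apply: limr_ge; first by apply/cvg_ex; exists 0.
near=> n; apply: hx; near: n; exact: nbhs_infty_ge.
Unshelve. all: by end_near. Qed.

Lemma smooth2_cintegrable (f : R * R -> C) : smooth2 f -> cintegrable leb2 Om f.
Proof. by move=> sf; apply: cCk0_integrable; exact: (sf 0%N). Qed.

Lemma coef0 xi : coef (fun=> 0) xi = 0.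
Proof.
have i0 : cintegrable leb2 Om (fun=> 0 : C) by exact: (smooth2_cintegrable (@smooth2_cst R 0)).
transitivity (0 * coef (fun=> 0) xi); last exact: mul0r.
rewrite -coefZ//; apply: eq_cintegral => x _.
by rewrite !mul0r.
Qed.

Lemma coef_Sterm c n eta : coef (Sterm h c n) eta = if n == code eta then c eta else 0.
Proof.
rewrite /Sterm; case: eqP => [e|ne]; last first.
  by rewrite coef0; case: eqP => // E; case: ne; rewrite E codeK.
rewrite coefZ; last exact/smooth2_cintegrable/smooth2_ex2.
rewrite coef_ev; case: eqP => [<-|ne]; first by rewrite e eqxx mulr1.
by rewrite mulr0; case: eqP => // E; case: ne; rewrite E codeK.
Qed.

(** The coefficients of the partial sums are known, and those of the tails
    tend to 0. *)
Lemma coef_Ser c eta : rapid c -> coef (Ser c) eta = c eta.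
Proof.
move=> rc; apply/eqP; rewrite -subr_eq0; apply/eqP/eq0_normc.
have [B dB] := rc 8%N.
have [B4 dB4] : exists B, decay (0 + 4 + 4) c B by exists B.
pose K := Ser_bound h 1 0 * (enum_cst R * B4) + 1.
have B0 := decay_ge0 dB4.
have K0 : 0 < K.
  apply: ltr_wpDl => //; apply: mulr_ge0; first exact: Ser_bound_ge0.
  by apply: mulr_ge0 => //; exact: enum_cst_ge0.
apply: (@le_inv_eq0 _ (8 * uu_bound h * K) (code eta).+1); first exact: normc_nneg.
move=> N Nc.
have rt := rapid_tail N rc.
have dt : decay (0 + 4) (tailc N c) (enum_cst R * B4 * N.+1%:R^-1) := decay_tail N dB4.
have bt := Bd_Ser h 1 rt dt.
have N0 : 0 < N.+1%:R^-1 :> R by rewrite invr_gt0.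
have bt' : cBd 1 0 (Ser (tailc N c)) (K * N.+1%:R^-1).
  apply: cBd_mono bt; rewrite /K mulrDl mul1r mulrA.
  by rewrite lerDl ltW.
have := coef_small h eta ((smooth2_Ser h rt) 0%N) (mulr_gt0 K0 N0) bt'.
rewrite mulrA; congr (normc _ <= _).
have partial n : cintegrable leb2 Om (fun x => \sum_(0 <= k < n) Sterm h c k x) /\
    coef (fun x => \sum_(0 <= k < n) Sterm h c k x) eta = if (code eta < n)%N then c eta else 0.
  elim: n => [|n [IH1 IH2]].
    have i0 : cintegrable leb2 Om (fun=> 0 : C) by exact: (smooth2_cintegrable (@smooth2_cst R 0)).
    have -> : (fun x : R2 => \sum_(0 <= k < 0) Sterm h c k x) = (fun=> 0).
      by apply/funext => x; rewrite big_geq.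
    by split => //; exact: coef0.
  have -> : (fun x : R2 => \sum_(0 <= k < n.+1) Sterm h c k x) = (fun x => \sum_(0 <= k < n) Sterm h c k x + Sterm h c n x).
    by apply/funext => x; rewrite big_nat_recr.
  have it := smooth2_cintegrable (smooth2_Sterm h c n).
  split; first exact: cintegrableD mO _ _ IH1 it.
  rewrite coefD// IH2 coef_Sterm ltnS (leq_eqVlt (code eta)) (eq_sym n).
  by case: eqP => [->|_]; rewrite ?ltnn ?add0r// addr0.
have [i1 c1] := partial N.
have -> : Ser c = (fun x => \sum_(0 <= k < N) Sterm h c k x + Ser (tailc N c) x).
  by apply/funext => x; rewrite -Ser_split//.
rewrite coefD//; last exact/smooth2_cintegrable/smooth2_Ser.
by rewrite c1 Nc addrAC subrr add0r.
Qed.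

(** Both sides are integrable and have the same coefficients. *)
Lemma regular f : Hinf adj f -> qrep h f (Ser (coef f)).
Proof.
move=> hf; have f2 := Hinf_L2 hf; have rc := Hinf_rapid h1_gt0 h2_gt0 hf; split.
- by case: f2.
- exact: Q_Ser.
- apply: (coef_unique (h := h)); first exact: L2_cintegrable.
    exact/smooth2_cintegrable/smooth2_Ser.
  by move=> xi; rewrite coef_Ser.
Qed.

(** The powers of the adjoint are determined by their Fourier coefficients,
    so they coincide almost everywhere with the powers of the Laplacian. *)
Lemma qrep_coef_iter phi psi j g : qrep h phi psi -> iterop adj j phi g ->
  L2 leb2 Om g /\ {ae leb2, forall x, Om x -> g x = iter j (@laplacian R) psi x}.
Proof.
move=> r it; have hp := qrep_Hinf r; have p2 := Hinf_L2 hp.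
have [g2 gE] := coef_iter h1_gt0 h2_gt0 p2 it; split => //.
have [mp qp pE] := r.
case: j it gE => [|j] it gE.
  by move: it => /= <-.
have [d2 dE] := coef_iter h1_gt0 h2_gt0 p2 (qrep_iter r (isT : (1 <= j.+1)%N)).
apply: (coef_unique (h := h)); try exact: L2_cintegrable.
by move=> xi; rewrite gE dE.
Qed.

Lemma opow_iter phi j : Hinf adj phi -> iterop adj j phi (opow adj j phi).
Proof.
move=> hp; have [g it] := Hinf_iter j hp.
by rewrite /opow; have := @xgetPex _ (fun=> 0) [set g | iterop adj j phi g] (ex_intro _ g it).
Qed.

Lemma L2norm_le (f : R2 -> C) M : L2 leb2 Om f -> 0 <= M ->
  {ae leb2, forall x, Om x -> normc (f x) <= M} -> L2norm leb2 Om f <= M.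
Proof.
move=> f2 M0 fM.
have : L2norm leb2 Om f ^+ 2 <= M ^+ 2.
  rewrite L2norm_sqr -[X in _ <= X]Rint_cst_Om /Rintegral; apply: fine_le.
  - by apply: integrable_fin_num; [exact: mO|exact: L2_normsq].
  - by apply: integrable_fin_num; [exact: mO|exact: integrable_cst_Om].
  apply: ae_ge0_le_integral => //.
  - exact: mO.
  - by move=> x _; rewrite lee_fin sqr_ge0.
  - exact: (measurable_int _ (L2_normsq f2)).
  - by move=> x _; rewrite lee_fin sqr_ge0.
  - by apply: filterS fM => x fM Ox; rewrite lee_fin ler_sqr ?nnegrE ?normc_nneg ?fM.
by rewrite ler_sqr// nnegrE L2norm_ge0.
Qed.

Lemma Bd_laplacian K n (psi : R * R -> C) M : smooth2 psi -> cBd K n.+2 psi M -> cBd K n (laplacian psi) (2 * M).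
Proof.
move=> sp bp; rewrite mulr2n mulrDl mul1r; apply: cBdD.
- by apply: smooth2_cCk; do 2 apply: smooth2_pd.
- by apply: smooth2_cCk; do 2 apply: smooth2_pd.
- by do 2 apply: cBd_pd.
- by do 2 apply: cBd_pd.
Qed.

Lemma Bd_iter_laplacian K n j (psi : R * R -> C) M : Q h psi -> cBd K (n + j.*2) psi M ->
  cBd K n (iter j (@laplacian R) psi) (2 ^+ j * M).
Proof.
elim: j psi M => [|j IH] psi M qp bp; first by rewrite expr0 mul1r; rewrite addn0 in bp.
rewrite iterSr exprSr -mulrA; apply: IH; first exact: Q_laplacian.
by apply: Bd_laplacian; [case: qp|move: bp; rewrite doubleS !addnS].
Qed.

Lemma Hnorm_le k phi (psi : R * R -> C) M : qrep h phi psi -> 0 <= M -> cBd 1 k.*2 psi M ->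
  Hnorm leb2 Om adj k phi <= 2 ^+ k.+1 * M.
Proof.
move=> r M0 bp; rewrite /Hnorm; apply: bigmax_le; first by rewrite mulr_ge0// exprn_ge0.
move=> j _; have hp := qrep_Hinf r.
have [g2 gE] := qrep_coef_iter r (opow_iter j hp).
have [_ qp _] := r.
have jk : (j <= k)%N by rewrite -ltnS.
have bj : cBd 1 0 (iter j (@laplacian R) psi) (2 ^+ j * M).
  by apply: Bd_iter_laplacian => //; rewrite add0n; apply: cBd_le bp; rewrite leq_double.
apply: (@le_trans _ _ (2 * (2 ^+ j * M))).
  apply: L2norm_le => //; first by rewrite !mulr_ge0// exprn_ge0.
  by apply: filterS gE => x gE Ox; rewrite gE//; exact: cBd_val bj (Omega_box Ox).
rewrite mulrA -exprS ler_wpM2r// ler_eXn2l// ?ltr1n//.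
Qed.

Lemma Hnorm_decay m phi M : Hinf adj phi -> 0 < M -> Hnorm leb2 Om adj m phi <= M ->
  decay m (coef phi) (coef_cst h m * M).
Proof.
move=> hp M0 hM; have p2 := Hinf_L2 hp.
have le j : (j <= m)%N -> L2norm leb2 Om (opow adj j phi) <= M.
  move=> jm; apply: le_trans hM; rewrite /Hnorm.
  have jm' : (j < m.+1)%N by [].
  exact: (@le_bigmax _ _ _ 0 (fun j : 'I_m.+1 => L2norm leb2 Om (opow adj j phi)) (Ordinal jm')).
apply: (decay_bd h1_gt0 h2_gt0 p2 (opow_iter m hp)) => //; last exact: le.
have := le 0%N isT; have : iterop adj 0 phi (opow adj 0 phi) by exact: opow_iter.
by move=> /= <-.
Qed.

Lemma Hnorm_Bd K n : exists m A, [/\ 0 <= A & forall phi M, Hinf adj phi -> 0 < M ->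
  Hnorm leb2 Om adj m phi <= M -> cBd K n (Ser (coef phi)) (A * M)].
Proof.
exists (n + 4)%N, (Ser_bound h K n * coef_cst h (n + 4)); split.
  by apply: mulr_ge0; [exact: Ser_bound_ge0|exact: coef_cst_ge0].
move=> phi M hp M0 hM; rewrite -mulrA; apply: Bd_Ser => //; first exact: Hinf_rapid.
exact: Hnorm_decay.
Qed.

(** The difference vanishes on the open square, hence on its translates by
    integers, and these are dense in the plane. *)
Lemma Q_unique (psi psi' : R * R -> C) : Q h psi -> Q h psi' ->
  {ae leb2, forall x, Om x -> psi x = psi' x} -> psi = psi'.
Proof.
move=> qp qp' E.
pose D x := psi x + (-1) * psi' x.
have qD : Q h D by apply: QD => //; exact: QZ.
have [sD pD] := qD.
have [[cR _] [cI _]] := sD 0%N.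
have hj j : coord j h != 0 by case: j; rewrite /= gt_eqF.
have D0 x : Om x -> D x = 0.
  have c0 : continuous (fun _ : R * R => 0 : R) by move=> ?; exact: cst_continuous.
  have aeD : {ae leb2, forall x, Om x -> D x = 0}.
    by apply: filterS E => y E Oy; rewrite /D E// mulN1r subrr.
  move=> Ox; apply: eqcP; rewrite ?Re0 ?Im0.
    apply: (@cont_ae_eq R (fun x => Re (D x)) _ cR c0) => //.
    by apply: filterS aeD => y h0 Oy; rewrite h0.
  apply: (@cont_ae_eq R (fun x => Im (D x)) _ cI c0) => //.
  by apply: filterS aeD => y h0 Oy; rewrite h0.
(* the zero set of D is invariant under integer translations *)
have shift1 j x : D (x + e_ j) = 0 <-> D x = 0.
  split=> [e|e]; first by rewrite (pD j) e mulr0.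
  have := pD j x; rewrite e => /esym/eqP; rewrite mulf_eq0 => /orP[/eqP c0|/eqP//].
  by have /eqP := hj j; case; move: c0 => /(congr1 (@complex.Re R)).
have shiftn j (n : nat) x : D (x + n%:R *: e_ j) = 0 <-> D x = 0.
  elim: n => [|n IH]; first by rewrite scale0r addr0.
  by rewrite -natr1 scalerDl scale1r addrA; apply: iff_trans (shift1 _ _) IH.
have shiftz j (k : int) x : D (x + k%:~R *: e_ j) = 0 <-> D x = 0.
  case: k => n; first by rewrite -[X in X%:~R]/(n%:Z) -pmulrn; exact: shiftn.
  rewrite NegzE mulrNz scaleNr -pmulrn; apply: iff_sym.
  by have := shiftn j n.+1 (x - n.+1%:R *: e_ j); rewrite subrK.
have nonint (y : R * R) : (forall j, exists k : int, k%:~R < coord j y < k%:~R + 1) -> D y = 0.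
  move=> hk; have [k /andP[k1 k2]] := hk false; have [l /andP[l1 l2]] := hk true.
  apply/(shiftz false (- k))/(shiftz true (- l)); apply: D0.
  rewrite /= in k1 k2 l1 l2.
  by split; rewrite /= ?scaler0 ?addr0 [_ *: 1]mulr1 mulrNz; apply/andP; split; lra.
(* every open set contains points with no integer coordinate *)
have Dz x : D x = 0.
  apply/eqP; apply: contrapT => /negP Dx.
  have nz : exists2 d : R, 0 < d & forall y : R * R, `|y.1 - x.1| < d -> `|y.2 - x.2| < d -> D y != 0.
    have key (F : R * R -> R) : continuous F -> F x != 0 -> exists2 d : R, 0 < d & forall y, `|y.1 - x.1| < d -> `|y.2 - x.2| < d -> F y != 0.
      move=> cF Fx; have F0 : 0 < `|F x| by rewrite normr_gt0.
      have /cvgrPdist_lt/(_ _ F0) := cF x; rewrite -nbhs_ballE => -[d d0 hd]; exists d => // y y1 y2.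
      have : `|F x - F y| < `|F x| by apply: hd; split; rewrite -ball_normE /= distrC.
      by apply: contraTneq => ->; rewrite subr0 ltxx.
    have [R0|R0] := eqVneq (Re (D x)) 0.
      have I0 : Im (D x) != 0.
        by apply: contraNneq Dx => I0; apply/eqP; apply: eqcP; rewrite ?Re0 ?Im0.
      have [d d0 hd] := key _ cI I0; exists d => // y y1 y2.
      by apply: contraNneq (hd y y1 y2) => ->.
    have [d d0 hd] := key _ cR R0; exists d => // y y1 y2.
    by apply: contraNneq (hd y y1 y2) => ->.
  have [d d0 hd] := nz.
  have fl (a : R) : exists2 r, 0 < r & forall t, 0 < t < r -> exists k : int, k%:~R < a + t < k%:~R + 1.
    exists ((Num.floor a)%:~R + 1 - a); first by have := floorD1_gt a; rewrite intrD subr_gt0.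
    move=> t /andP[t0 t1]; exists (Num.floor a); have := floor_le a => ?.
    by apply/andP; split; lra.
  have [r1 r10 h1] := fl x.1; have [r2 r20 h2] := fl x.2.
  pose t := Num.min d (Num.min r1 r2) / 2.
  have m0 : 0 < Num.min d (Num.min r1 r2) by rewrite !lt_min d0 r10.
  have [td tr1 tr2] : [/\ t < d, t < r1 & t < r2].
    have hm : Num.min d (Num.min r1 r2) / 2 < Num.min d (Num.min r1 r2) by lra.
    by rewrite /t; split; apply: (lt_le_trans hm); rewrite !ge_min lexx ?orbT.
  have t0 : 0 < t by rewrite divr_gt0.
  have := hd (x.1 + t, x.2 + t); rewrite /= ![_ + t]addrC !addrK !gtr0_norm// => /(_ td td) /eqP; apply.
  apply: nonint => j; case: j => /=; rewrite addrC; [apply: h2|apply: h1]; by apply/andP.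
apply/funext => x; have /eqP := Dz x; rewrite /D mulN1r subr_eq0 => /eqP.
by [].
Qed.

End Regularity.

(** * Distributions and operators acting by transposition *)

Section Distributions.
Variable R : realType.
Local Notation C := R[i].
Local Notation leb := (@lebesgue_measure R).
Local Notation R2 := (measurableTypeR R * measurableTypeR R)%type.
Local Notation leb2 := (leb \x leb)%E.
Local Notation Om := (@Omega R).
Local Notation e_ j := (@evec R j).
Local Notation Re := complex.Re.
Local Notation Im := complex.Im.
Variable h : R * R.
Hypotheses (h1_gt0 : 0 < h.1) (h2_gt0 : 0 < h.2).
Local Notation adj := (adjoint leb2 Om (Lh h)).
Local Notation mO := (@measurable_Omega R).
Local Notation coef := (@coef R h).
Local Notation Ser := (@Ser R h).
Local Notation X := (Hinf adj).
Local Notation dist := (@functional _ R2 R).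
Implicit Types (w : dist) (phi : R2 -> C) (psi : R * R -> C).

Definition qp_rep phi : R * R -> C := Ser (coef phi).

Lemma qp_repP phi : X phi -> qrep h phi (qp_rep phi). Proof. exact: regular. Qed.

Lemma qrep_X phi psi : qrep h phi psi -> X phi. Proof. exact: qrep_Hinf. Qed.

Lemma Q_X psi : Q h psi -> X psi. Proof. by move=> /Q_qrep /qrep_X. Qed.

Lemma qrep_eq phi psi psi' : qrep h phi psi -> qrep h phi psi' -> psi = psi'.
Proof.
move=> [_ q E] [_ q' E']; apply: (Q_unique h1_gt0 h2_gt0) => //.
by apply: filterS2 E E' => x e e' Ox; rewrite -e// e'.
Qed.

Lemma qp_repE phi psi : qrep h phi psi -> qp_rep phi = psi.
Proof. by move=> r; apply: (qrep_eq (qp_repP (qrep_X r)) r). Qed.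

Lemma qrep_lin c phi psi phi' psi' : qrep h phi psi -> qrep h phi' psi' ->
  qrep h (fun x => c * phi x + phi' x) (fun x => c * psi x + psi' x).
Proof.
move=> [m q E] [m' q' E']; split.
- by apply: cmeasD => //; apply: cmeasM => //; exact: cmeas_cst.
- by apply: QD => //; exact: QZ.
- by apply: filterS2 E E' => x e e' Ox; rewrite e// e'.
Qed.

Lemma qrepB phi psi phi' psi' : qrep h phi psi -> qrep h phi' psi' ->
  qrep h (fun x => phi x - phi' x) (fun x => psi x + (-1) * psi' x).
Proof.
move=> r1 r2; have := qrep_lin (-1) r2 r1.
by under eq_fun do rewrite mulN1r addrC; under [X in qrep _ _ X]eq_fun do rewrite addrC.
Qed.

Lemma XB phi phi' : X phi -> X phi' -> X (fun x => phi x - phi' x).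
Proof. by move=> /qp_repP r1 /qp_repP r2; apply: qrep_X (qrepB r1 r2). Qed.

Lemma X0 : X (fun=> 0). Proof. exact: Q_X (@Q0 R h). Qed.

Lemma cBd0 K n : cBd K n (fun=> 0 : C) 0.
Proof.
have [M M0 b] := @cBd_exists R K n _ (cCk_cst n 0).
have := cBd_cst_mul 0 M0 (cCk_cst n 0) b; by rewrite normc0 !mul0r !mulr0.
Qed.

(** Continuity at 0; by linearity it implies continuity everywhere. *)
Lemma Hminf_small w : Hminf2 h w -> forall e : R, 0 < e ->
  exists (k : nat) (dl : R), 0 < dl /\ forall phi, X phi -> Hnorm leb2 Om adj k phi < dl ->
    normc (w phi - w (fun=> 0)) < e.
Proof.
move=> [_ wc] e e0; have [k [dl [dl0 hk]]] := wc _ X0 e e0.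
exists k, dl; split => // phi Xp hn; apply: hk => //.
by under eq_fun do rewrite subr0.
Qed.

Lemma normc_lt_eq0 (z : C) : (forall e : R, 0 < e -> normc z < e) -> z = 0.
Proof.
move=> hz; apply: eq0_normc; apply/eqP; rewrite eq_le normc_nneg andbT leNgt; apply/negP => z0.
by have := hz _ z0; rewrite ltxx.
Qed.

(** Functions that agree almost everywhere on the square have distance 0 in
    all the seminorms. *)
Lemma w_ext w phi psi : Hminf2 h w -> qrep h phi psi -> w phi = w psi.
Proof.
move=> [_ wc] r; have [m q E] := r.
apply/eqP; rewrite -subr_eq0; apply/eqP/normc_lt_eq0 => e e0.
have [k [dl [dl0 hk]]] := wc psi (Q_X q) e e0.
apply: hk; first exact: qrep_X r.
have rd : qrep h (fun x => phi x - psi x) (fun=> 0).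
  split; [|exact: Q0|by apply: filterS E => x E Ox; rewrite E// subrr].
  by apply: cmeasD => //; apply: cmeasN; exact: cCk0_meas (q.1 0%N).
by have := Hnorm_le h1_gt0 h2_gt0 rd (lexx 0) (cBd0 1 k.*2); rewrite mulr0 => /le_lt_trans; apply.
Qed.

Lemma w_lin w c phi phi' : Hminf2 h w -> X phi -> X phi' ->
  w (fun x => c * phi x + phi' x) = c * w phi + w phi'.
Proof. by move=> [wl _]; exact: wl. Qed.

Lemma w0 w : Hminf2 h w -> w (fun=> 0) = 0.
Proof.
move=> hw; have := w_lin 1 hw X0 X0.
under [X in w X]eq_fun do rewrite mulr0 addr0.
by rewrite mul1r => /eqP; rewrite -subr_eq0 opprD addNKr oppr_eq0 => /eqP.
Qed.

Lemma wZ w c phi : Hminf2 h w -> X phi -> w (fun x => c * phi x) = c * w phi.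
Proof.
move=> hw Xp; have := w_lin c hw Xp X0; rewrite w0// addr0 => <-.
by congr w; apply/funext => x; rewrite addr0.
Qed.

Lemma Hminf_eqd w w' : Hminf2 h w -> (forall phi, X phi -> w' phi = w phi) -> Hminf2 h w'.
Proof.
move=> [wl wc] E; split.
  move=> c phi phi' Xp Xp'; rewrite !E//; first exact: wl.
  exact: (qrep_X (qrep_lin c (qp_repP Xp) (qp_repP Xp'))).
move=> phi Xp e e0; have [k [dl [dl0 hk]]] := wc phi Xp e e0.
by exists k, dl; split => // phi' Xp' hn; rewrite !E//; exact: hk.
Qed.

(** The operators on smooth quasi-periodic functions that are continuous for
    the bounds on boxes.  They can be transposed to distributions. *)
Record admissible (T : (R * R -> C) -> (R * R -> C)) : Prop := Adm {
  adm_Q : forall psi, Q h psi -> Q h (T psi);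
  adm_lin : forall c psi psi', Q h psi -> Q h psi' ->
    T (fun x => c * psi x + psi' x) = (fun x => c * T psi x + T psi' x);
  adm_bd : forall K n, exists K' m A, 0 <= A /\ forall psi M, Q h psi -> 0 <= M ->
    cBd K' m psi M -> cBd K n (T psi) (A * M) }.

Lemma adm_Hminf T w : admissible T -> Hminf2 h w -> Hminf2 h (fun phi => w (T (qp_rep phi))).
Proof.
move=> aT hw; split.
  move=> c phi phi' Xp Xp'; have r1 := qp_repP Xp; have r2 := qp_repP Xp'.
  rewrite (qp_repE (qrep_lin c r1 r2)) (adm_lin aT); [|by case: r1|by case: r2].
  by rewrite w_lin//; apply: Q_X; apply: (adm_Q aT); [case: r1|case: r2].
move=> phi Xp e e0.
have [k [dl [dl0 hk]]] := Hminf_small hw e0.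
have [K' [m [A [A0 hA]]]] := adm_bd aT 1 k.*2.
have [m' [B [B0 hB]]] := @Hnorm_Bd R h h1_gt0 h2_gt0 K' m.
pose D : R := 2 ^+ k.+1 * (A * B) + 1.
have AB0 : 0 <= 2 ^+ k.+1 * (A * B) by apply: mulr_ge0; [exact: exprn_ge0|exact: mulr_ge0].
have D0 : 0 < D by rewrite ltr_wpDl.
exists m', (dl / D); split; first by rewrite divr_gt0.
move=> phi' Xp' hn; pose chi x := phi' x - phi x.
have Xc : X chi by exact: XB.
have rc : qrep h chi (fun x => qp_rep phi' x + (-1) * qp_rep phi x) by apply: qrepB; exact: qp_repP.
pose M := dl / D; have M0 : 0 < M by rewrite divr_gt0.
have bc : cBd K' m (qp_rep chi) (B * M) by apply: hB => //; exact: ltW.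
have qc : Q h (qp_rep chi) by case: (qp_repP Xc).
have bT : cBd 1 k.*2 (T (qp_rep chi)) (A * (B * M)).
  by apply: hA => //; apply: mulr_ge0 => //; exact: ltW.
have qT := adm_Q aT qc.
have ABM : 0 <= A * (B * M) by apply: mulr_ge0 => //; apply: mulr_ge0 => //; exact: ltW.
have hnT := Hnorm_le h1_gt0 h2_gt0 (Q_qrep qT) ABM bT.
have X1 : X (T (qp_rep phi)) by apply: Q_X; apply: (adm_Q aT); case: (qp_repP Xp).
have X2 : X (T (qp_rep phi')) by apply: Q_X; apply: (adm_Q aT); case: (qp_repP Xp').
have E : T (qp_rep chi) = (fun x => (-1) * T (qp_rep phi) x + T (qp_rep phi') x).
  rewrite (qp_repE rc) -(adm_lin aT); [|by case: (qp_repP Xp)|by case: (qp_repP Xp')].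
  by congr T; apply/funext => x; rewrite addrC.
have E1 : w (T (qp_rep phi')) - w (T (qp_rep phi)) = w (T (qp_rep chi)).
  transitivity (w (fun x => (-1) * T (qp_rep phi) x + T (qp_rep phi') x)); last by congr w.
  by have := w_lin (-1) hw X1 X2 => ->; rewrite mulN1r addrC.
have -> : w (T (qp_rep phi')) - w (T (qp_rep phi)) = w (T (qp_rep chi)) - w (fun=> 0).
  have E2 : w (T (qp_rep chi)) - w (fun=> 0) = w (T (qp_rep chi)) - 0 := congr1 (fun z => w (T (qp_rep chi)) - z) (w0 hw).
  exact: etrans E1 (esym (etrans E2 (subr0 (w (T (qp_rep chi)))))).
apply: hk; first exact: Q_X.
apply: (le_lt_trans hnT).
have -> : 2 ^+ k.+1 * (A * (B * M)) = (2 ^+ k.+1 * (A * B)) * M by ring.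
have lt1 : 2 ^+ k.+1 * (A * B) < D by rewrite /D ltrDl.
have -> : dl = D * M by rewrite /M mulrC divfK// gt_eqF.
by rewrite ltr_pM2r.
Qed.

Lemma adm_comp T T' : admissible T -> admissible T' -> admissible (fun psi => T (T' psi)).
Proof.
move=> a a'; split.
- by move=> psi /(adm_Q a') /(adm_Q a).
- move=> c psi psi' q q'; rewrite (adm_lin a')// (adm_lin a)//; exact: (adm_Q a').
- move=> K n; have [K1 [m1 [A1 [A10 h1]]]] := adm_bd a K n.
  have [K2 [m2 [A2 [A20 h2]]]] := adm_bd a' K1 m1.
  exists K2, m2, (A1 * A2); split; first exact: mulr_ge0.
  move=> psi M q M0 b; rewrite -mulrA; apply: h1; [exact: (adm_Q a')|exact: mulr_ge0|exact: h2].
Qed.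

Lemma adm_add T T' : admissible T -> admissible T' -> admissible (fun psi x => T psi x + T' psi x).
Proof.
move=> a a'; split.
- by move=> psi q; apply: QD; [exact: (adm_Q a)|exact: (adm_Q a')].
- by move=> c psi psi' q q'; rewrite (adm_lin a)// (adm_lin a')//; apply/funext => x; ring.
- move=> K n; have [K1 [m1 [A1 [A10 h1]]]] := adm_bd a K n.
  have [K2 [m2 [A2 [A20 h2]]]] := adm_bd a' K n.
  exists (Num.max K1 K2), (maxn m1 m2), (A1 + A2); split; first exact: addr_ge0.
  move=> psi M q M0 b; rewrite mulrDl; apply: cBdD.
  + exact: ((adm_Q a q).1 n).
  + exact: ((adm_Q a' q).1 n).
  + by apply: h1 => //; apply: (@cBd_box _ _ (Num.max K1 K2)); [rewrite le_max lexx|apply: cBd_le b; exact: leq_maxl].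
  + by apply: h2 => //; apply: (@cBd_box _ _ (Num.max K1 K2)); [rewrite le_max lexx orbT|apply: cBd_le b; exact: leq_maxr].
Qed.

Lemma adm_scale c : admissible (fun psi x => c * psi x).
Proof.
split; [by move=> psi; exact: QZ|by move=> c' psi psi' _ _; apply/funext => x; ring|].
move=> K n; exists K, n, (2 * (2 ^+ n * normc c)); split.
  by apply: mulr_ge0 => //; apply: mulr_ge0; [exact: exprn_ge0|exact: normc_nneg].
move=> psi M q M0 b; have := cBd_cst_mul c M0 (q.1 n) b; by rewrite -!mulrA.
Qed.

Lemma adm_pd j : admissible (pd j).
Proof.
split; first by move=> psi; exact: Q_pd.
  move=> c psi psi' [s _] [s' _]; rewrite pdD//; last exact: smooth2Z.
  by rewrite pdZ.
move=> K n; exists K, n.+1, 1; split => // psi M q M0 b.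
by rewrite mul1r; exact: cBd_pd.
Qed.

Lemma Q_mul (b : R -> R) psi : smooth1 b -> (forall x, b (x + 1) = b x) -> Q h psi ->
  Q h (fun x => (b x.1)%:C * psi x).
Proof.
move=> sb pb [sp qp]; split; first by apply: smooth2M => //; exact: smooth2_fst.
move=> j x; rewrite mulrCA -qp; congr ((_)%:C * _).
by case: j => /=; rewrite ?addr0 ?pb.
Qed.

Lemma adm_mul (b : R -> R) : smooth1 b -> (forall x, b (x + 1) = b x) ->
  admissible (fun psi x => (b x.1)%:C * psi x).
Proof.
move=> sb pb; split.
- by move=> psi; exact: Q_mul.
- by move=> c psi psi' _ _; apply/funext => x; ring.
- move=> K n; have [N N0 bN] := @cBd_exists R K n _ (smooth2_fst sb n).
  exists K, n, (2 * (2 ^+ n * N)); split.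
    by apply: mulr_ge0 => //; apply: mulr_ge0 => //; exact: exprn_ge0.
  by move=> psi M q M0 bp; have := cBdM N0 M0 (smooth2_fst sb n) (q.1 n) bN bp; rewrite -!mulrA.
Qed.

Lemma Q_shear A psi : smooth1 A -> (forall x, A (x + 1) = A x) -> Q h psi -> Q h (fun x => psi (shear_map A x)).
Proof.
move=> sA pA [sp qp]; split; first exact: smooth2_shear.
move=> j x; rewrite (qp j); congr (_ * psi _).
by case: j; rewrite /shear_map; congr pair => /=; rewrite ?addr0 ?pA// addrAC.
Qed.

Lemma adm_shear A : smooth1 A -> (forall x, A (x + 1) = A x) -> admissible (fun psi x => psi (shear_map A x)).
Proof.
move=> sA pA; split => //; first by move=> psi; exact: Q_shear.
move=> K n; have [K' hK] := Bd_shear K sA; have [c c0 hc] := hK n.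
exists K', n, c; split => // psi M q M0 [b1 b2]; have [k1 k2] := q.1 n.
by split; [exact: (hc (fun x => Re (psi x)))|exact: (hc (fun x => Im (psi x)))].
Qed.

Lemma smooth_repP phi psi : qrep h phi psi ->
  smooth2 (smooth_rep phi) /\ {ae leb2, forall x, Om x -> phi x = smooth_rep phi x}.
Proof.
move=> [_ [sp _] E]; rewrite /smooth_rep.
have := @xgetPex _ (fun=> 0) [set psi : R2 -> C | smooth2 psi /\ {ae leb2, forall x, Om x -> phi x = psi x}].
by apply; exists psi.
Qed.

Lemma open_Omega : open (Om : set (R * R)).
Proof.
have -> : (Om : set (R * R)) = `]0, 1[%classic `*` `]0, 1[%classic.
  by apply/seteqP; split => -[x y]; rewrite /= !in_itv.
rewrite openE => -[x y] [/= x01 y01]; rewrite /interior /=.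
exists (`]0, 1[%classic, `]0, 1[%classic) => //; split.
  by apply: open_nbhs_nbhs; split => //; exact: interval_open.
by apply: open_nbhs_nbhs; split => //; exact: interval_open.
Qed.

(** The derivative of a distribution is defined with an arbitrary smooth
    representative on the square, which need not be quasi-periodic; on the
    square its derivatives are nevertheless determined. *)
Lemma pd_eq_Omega psi psi' j : smooth2 psi -> smooth2 psi' ->
  {ae leb2, forall x, Om x -> psi x = psi' x} -> forall x, Om x -> pd j psi x = pd j psi' x.
Proof.
move=> s s' E.
have [[c1 _] [c2 _]] := s 0%N; have [[c1' _] [c2' _]] := s' 0%N.
have eq x : Om x -> psi x = psi' x.
  move=> Ox; apply: eqcP.
    by apply: (cont_ae_eq c1 c1') => //; apply: filterS E => y e Oy; rewrite e.
  by apply: (cont_ae_eq c2 c2') => //; apply: filterS E => y e Oy; rewrite e.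
move=> x Ox; have nO : \forall y \near x, (Om : set (R * R)) y.
  by apply: open_nbhs_nbhs; split => //; exact: open_Omega.
have [d1 d2] := smooth2_cderiv j s x.
rewrite [RHS]/pd; apply: eqcP; rewrite !cE; apply/esym.
  apply: derive_val; apply: (@near_eq_is_derive _ _ _ (fun y => Re (psi y))).
  by apply: filterS nO => y Oy; rewrite eq.
apply: derive_val; apply: (@near_eq_is_derive _ _ _ (fun y => Im (psi y))).
by apply: filterS nO => y Oy; rewrite eq.
Qed.

Lemma qrep_pd phi psi j : qrep h phi psi -> qrep h (pd j (smooth_rep phi)) (pd j psi).
Proof.
move=> r; have [_ q E] := r; have [ss E'] := smooth_repP r; split.
- exact: cCk0_meas (smooth2_pd j ss 0%N).
- exact: Q_pd.
- apply: aeW => x Ox; apply: pd_eq_Omega => //; first by case: q.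
  by apply: filterS2 E E' => y e e' Oy; rewrite -e'// e.
Qed.

Lemma qrep_mul (b : R -> R) phi psi : smooth1 b -> (forall x, b (x + 1) = b x) -> qrep h phi psi ->
  qrep h (fun x => (b x.1)%:C * phi x) (fun x => (b x.1)%:C * psi x).
Proof.
move=> sb pb [m q E]; split; last by apply: filterS E => x e Ox; rewrite e.
  by apply: cmeasM => //; exact: cCk0_meas (smooth2_fst sb 0%N).
exact: Q_mul.
Qed.

(** The transpose of the operator [Pop b]. *)
Definition tPop (b : R -> R) psi : R * R -> C :=
  fun x => (-1) * (pd false psi x + (b x.1)%:C * pd true psi x).

Lemma adm_tPop b : smooth1 b -> (forall x, b (x + 1) = b x) -> admissible (tPop b).
Proof.
move=> sb pb; apply: (adm_comp (adm_scale (-1)) (adm_add (adm_pd false) (adm_comp (adm_mul sb pb) (adm_pd true)))).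
Qed.

Lemma PopE b w phi psi : smooth1 b -> (forall x, b (x + 1) = b x) -> Hminf2 h w -> qrep h phi psi ->
  Pop b w phi = w (tPop b psi).
Proof.
move=> sb pb hw r; have [_ q _] := r; have [sp _] := q.
rewrite /Pop /addd /muld /derived.
rewrite (w_ext hw (qrep_pd false r)) (w_ext hw (qrep_pd true (qrep_mul sb pb r))).
have -> : pd true (fun x => (b x.1)%:C * psi x) = (fun x => (b x.1)%:C * pd true psi x).
  rewrite pdM//; last exact: smooth2_fst.
  by apply/funext => x; rewrite pd_fst// mul0r add0r.
have Xf : X (pd false psi) by apply: Q_X; exact: Q_pd.
have Xt : X (fun x => (b x.1)%:C * pd true psi x) by apply: Q_X; apply: Q_mul => //; exact: Q_pd.
rewrite /tPop wZ//; last first.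
  by apply: Q_X; apply: QD; [exact: Q_pd|apply: Q_mul => //; exact: Q_pd].
have := w_lin 1 hw Xf Xt; under [X in w X]eq_fun do rewrite mul1r; rewrite mul1r => ->.
by rewrite mulN1r opprD.
Qed.

Lemma Pop_Hminf b w : smooth1 b -> (forall x, b (x + 1) = b x) -> Hminf2 h w -> Hminf2 h (Pop b w).
Proof.
move=> sb pb hw; apply: (Hminf_eqd (adm_Hminf (adm_tPop sb pb) hw)) => phi Xp.
exact: PopE (qp_repP Xp).
Qed.

(** The operator Psi_a when [A] is the primitive of a - a_0, see
    [is_Psi_shear]. *)
Definition shear A w : dist := fun phi => w (fun x => qp_rep phi (shear_map A x)).

Lemma shear_Hminf A w : smooth1 A -> (forall x, A (x + 1) = A x) -> Hminf2 h w -> Hminf2 h (shear A w).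
Proof. by move=> sA pA hw; exact: (adm_Hminf (adm_shear sA pA) hw). Qed.

Lemma shearE A w phi psi : qrep h phi psi -> shear A w phi = w (fun x => psi (shear_map A x)).
Proof. by move=> r; rewrite /shear (qp_repE r). Qed.

Lemma w_tail w c e : Hminf2 h w -> rapid c -> 0 < e ->
  \forall N \near \oo, normc (w (Ser (tailc N c))) < e.
Proof.
move=> hw rc e0; have [k [dl [dl0 hk]]] := Hminf_small hw e0.
have [B dB] := rc (k.*2 + 4 + 4)%N.
pose K := 2 ^+ k.+1 * (Ser_bound h 1 k.*2 * (enum_cst R * B)).
have cv : (K * n.+1%:R^-1) @[n --> \oo] --> (K * 0).
  by apply: cvgM; [exact: cvg_cst|exact: cvg_harmonic].
rewrite mulr0 in cv; have /cvgrPdist_lt/(_ _ dl0) := cv.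
apply: filterS => N; rewrite sub0r normrN => hN.
have rt := rapid_tail N rc; have dt := decay_tail N dB.
have bt := Bd_Ser h 1 rt dt.
have q := Q_Ser h1_gt0 h2_gt0 rt.
rewrite -[w _]subr0 -(w0 hw); apply: hk; first exact: Q_X.
apply: le_lt_trans hN; apply: le_trans (ler_norm _).
have M0 : 0 <= Ser_bound h 1 k.*2 * (enum_cst R * B * N.+1%:R^-1).
  by apply: mulr_ge0; [exact: Ser_bound_ge0|exact: decay_ge0 dt].
have := Hnorm_le h1_gt0 h2_gt0 (Q_qrep q) M0 bt.
by rewrite /K -!mulrA.
Qed.

(** The value of a distribution at a series of exponentials is the sum of its
    values at the terms, since the tails tend to 0. *)
Lemma w_dense w w' : Hminf2 h w -> Hminf2 h w' -> (forall xi, w (ev h xi) = w' (ev h xi)) ->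
  eqd2 h w w'.
Proof.
move=> hw hw' E phi Xp; have r := qp_repP Xp.
rewrite (w_ext hw r) (w_ext hw' r) /qp_rep; have rc := Hinf_rapid h1_gt0 h2_gt0 Xp.
set c := coef phi in rc *.
have part (u : dist) N : Hminf2 h u -> X (fun x => \sum_(0 <= k < N) Sterm h c k x) /\
   u (fun x => \sum_(0 <= k < N) Sterm h c k x) = \sum_(0 <= k < N) (if code (dec k) == k then c (dec k) * u (ev h (dec k)) else 0).
  move=> hu; elim: N => [|N [IH1 IH2]].
    have -> : (fun x : R2 => \sum_(0 <= k < 0) Sterm h c k x) = (fun=> 0) by apply/funext => x; rewrite big_geq.
    by rewrite w0// big_geq//; split => //; exact: X0.
  have Xt : X (Sterm h c N).
    rewrite /Sterm; case: eqP => _; last exact: X0.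
    by apply: Q_X; apply: QZ; exact: Q_ev.
  have ut : u (Sterm h c N) = (if code (dec N) == N then c (dec N) * u (ev h (dec N)) else 0).
    rewrite /Sterm; case: eqP => _; last exact: w0.
    by rewrite wZ//; apply: Q_X; exact: Q_ev.
  have -> : (fun x : R2 => \sum_(0 <= k < N.+1) Sterm h c k x) = (fun x => 1 * Sterm h c N x + \sum_(0 <= k < N) Sterm h c k x).
    by apply/funext => x; rewrite big_nat_recr//= mul1r addrC.
  split; first exact: (qrep_X (qrep_lin 1 (qp_repP Xt) (qp_repP IH1))).
  by rewrite w_lin// IH2 big_nat_recr//= mul1r addrC ut.
have split_u (u : dist) N : Hminf2 h u -> u (Ser c) =
   \sum_(0 <= k < N) (if code (dec k) == k then c (dec k) * u (ev h (dec k)) else 0) + u (Ser (tailc N c)).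
  move=> hu; have [X1 e1] := part u N hu.
  have X2 : X (Ser (tailc N c)) by apply: Q_X; apply: Q_Ser => //; exact: rapid_tail.
  have -> : Ser c = (fun x => 1 * (\sum_(0 <= k < N) Sterm h c k x) + Ser (tailc N c) x).
    by apply/funext => x; rewrite mul1r -Ser_split.
  by rewrite w_lin// e1 mul1r.
apply/eqP; rewrite -subr_eq0; apply/eqP/normc_lt_eq0 => e e0.
have e2 : 0 < e / 2 by rewrite divr_gt0.
have [N [t1 t2]] : exists N, normc (w (Ser (tailc N c))) < e / 2 /\ normc (w' (Ser (tailc N c))) < e / 2.
  have [N1 _ k1] := w_tail hw rc e2; have [N2 _ k2] := w_tail hw' rc e2.
  by exists (maxn N1 N2); split; [apply: k1 => /=; exact: leq_maxl|apply: k2 => /=; exact: leq_maxr].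
rewrite (split_u w N hw) (split_u w' N hw').
have -> : \sum_(0 <= k < N) (if code (dec k) == k then c (dec k) * w (ev h (dec k)) else 0) =
  \sum_(0 <= k < N) (if code (dec k) == k then c (dec k) * w' (ev h (dec k)) else 0).
  by apply: eq_bigr => k _; rewrite E.
rewrite opprD addrACA subrr add0r (le_lt_trans (le_normcD _ _))// normcN.
by rewrite [e]splitr ltrD.
Qed.

(** The frequency changes its sign twice because v_xi has the factor exp (- x
    log h_j) but the phase 2 pi x xi. *)
Lemma v1E (hj : R) (k : int) (x : R) : 0 < hj -> v1 hj k x = cexp (- freq hj (- k) * x%:C).
Proof.
move=> h0; rewrite /v1 /powR gt_eqF//.
have -> : (expR (- x * ln hj))%:C = cexp ((- x * ln hj)%:C).
  by rewrite cexpE !cE cos0 sin0 mulr0 mulr1.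
rewrite -cexpD; congr cexp; rewrite /freq mulrNz; apply: eqcP; rewrite !cE; ring.
Qed.

Lemma v2_ev xi : (fun x => Num.conj (v2 h xi x)) = ev h xi.
Proof.
apply/funext => x; rewrite /v2 !v1E// -cexpD cexpJ /ev /ex2; congr cexp.
by rewrite /freq !mulrNz; apply: eqcP; rewrite !cE; ring.
Qed.

Lemma fourierE w xi : fourier h w xi = w (ev h xi).
Proof. by rewrite /fourier -v2_ev. Qed.

End Distributions.

(** * Integration by parts on the interval *)

Section OneVariable.
Variable R : realType.
Local Notation C := R[i].
Local Notation leb := (@lebesgue_measure R).
Local Notation I := (@unitI R).
Local Notation R1 := (measurableTypeR R).
Local Notation R2 := (measurableTypeR R * measurableTypeR R)%type.
Local Notation leb2 := (leb \x leb)%E.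
Local Notation Om := (@Omega R).
Local Notation Re := complex.Re.
Local Notation Im := complex.Im.
Local Notation mI := (@measurable_unitI R).

Definition ex1 (z : C) (x : R) : C := cexp (z * x%:C).

Lemma ex1_der z (x : R) : is_derive x 1 (fun x => Re (ex1 z x)) (Re (z * ex1 z x)) /\
  is_derive x 1 (fun x => Im (ex1 z x)) (Im (z * ex1 z x)).
Proof.
have := is_derive_cexp 0 z x; rewrite add0r.
by under eq_fun do rewrite add0r; under [X in _ /\ is_derive _ _ X _]eq_fun do rewrite add0r.
Qed.

Lemma ex1_contRe z : continuous (fun x => Re (ex1 z x)).
Proof. by move=> x; apply: differentiable_continuous; apply/derivable1_diffP; case: (ex1_der z x) => [[]]. Qed.
Lemma ex1_contIm z : continuous (fun x => Im (ex1 z x)).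
Proof. by move=> x; apply: differentiable_continuous; apply/derivable1_diffP; case: (ex1_der z x) => _ []. Qed.

Lemma ex1_bound z x : I x -> normc (ex1 z x) <= expR `|Re z|.
Proof.
move=> /andP[x0 x1]; rewrite normc_cexp ler_expR !cE mulr0 subr0.
apply: (le_trans (ler_norm _)); rewrite normrM (gtr0_norm x0).
by apply: ler_piMr => //; exact: ltW.
Qed.

Lemma cmeas_ex1 z : cmeas I (ex1 z : R1 -> C).
Proof. by split; apply: cont_meas; try exact: mI; [exact: ex1_contRe|exact: ex1_contIm]. Qed.

Lemma bounded_integrable_I (f : R1 -> R) M : measurable_fun I f ->
  (forall x, I x -> `|f x| <= M) -> leb.-integrable I (EFin \o f).
Proof. exact: (bounded_integrable mI (@finite_unitI R)). Qed.

Lemma cintegrable_ex1 z : cintegrable leb I (ex1 z : R1 -> C).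
Proof.
have [m1 m2] := cmeas_ex1 z.
split; apply: (@bounded_integrable_I _ (expR `|Re z|)) => // x Ix.
  exact: le_trans (Re_le_normc _) (ex1_bound z Ix).
exact: le_trans (Im_le_normc _) (ex1_bound z Ix).
Qed.

Lemma L2_cintegrable1 (f : R1 -> C) : L2 leb I f -> cintegrable leb I f.
Proof. exact: (L2_integrable mI (@finite_unitI R)). Qed.

Lemma L2_bounded1 (f : R1 -> C) M : cmeas I f -> (forall x, I x -> normc (f x) <= M) -> L2 leb I f.
Proof. exact: (bounded_L2 mI (@finite_unitI R)). Qed.

Lemma ex1_dcont (z : C) : continuous (fun t => Re (z * ex1 z t)) /\ continuous (fun t => Im (z * ex1 z t)).
Proof.
have cM (c : R) (f : R -> R) : continuous f -> continuous (fun t => c * f t).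
  by move=> cf t; apply: (@continuousM _ _ (fun=> c) f); [exact: cst_continuous|exact: cf].
split.
  have -> : (fun t => Re (z * ex1 z t)) = (fun t => Re z * Re (ex1 z t) - Im z * Im (ex1 z t)).
    by apply/funext => t; rewrite cE.
  move=> t; apply: (@continuousB _ _ _ (fun t => Re z * Re (ex1 z t)) (fun t => Im z * Im (ex1 z t))).
    by apply: cM; exact: ex1_contRe.
  by apply: cM; exact: ex1_contIm.
have -> : (fun t => Im (z * ex1 z t)) = (fun t => Re z * Im (ex1 z t) + Im z * Re (ex1 z t)).
  by apply/funext => t; rewrite cE.
move=> t; apply: (@continuousD _ _ _ (fun t => Re z * Im (ex1 z t)) (fun t => Im z * Re (ex1 z t))).
  by apply: cM; exact: ex1_contIm.
by apply: cM; exact: ex1_contRe.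
Qed.

Lemma cftc z x : 0 <= x -> cintegral leb [set t | 0 < t < x] (fun t => z * ex1 z t) = ex1 z x - 1.
Proof.
move=> x0; have [cR cI] := ex1_dcont z.
have e1 := @ftc_open R _ _ 0 x x0 (fun s => (ex1_der z s).1) cR.
have e2 := @ftc_open R _ _ 0 x x0 (fun s => (ex1_der z s).2) cI.
have E0 : ex1 z 0 = 1 by rewrite /ex1 mulr0 cexp0.
rewrite /cintegral /Rintegral; rewrite E0 in e1 e2; rewrite [X in (fine X) +i* _]e1 [X in _ +i* (fine X)]e2 /=.
by apply: eqcP; rewrite !cE.
Qed.

Lemma L1_ex1 (hj : R) (k : int) : 0 < hj ->
  L1 hj (ex1 (freq hj k) : R1 -> C) (fun x => - 'i * (freq hj k * ex1 (freq hj k) x)).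
Proof.
move=> h0; set z := freq hj k; split.
- by apply: (L2_bounded1 (cmeas_ex1 z)) => x Ix; exact: ex1_bound Ix.
- apply: (@L2_bounded1 _ (normc (- 'i * z : C) * expR `|Re z|)).
    by do 2 (apply: cmeasM; first exact: cmeas_cst); exact: cmeas_ex1.
  by move=> x Ix; rewrite mulrA normcM ler_wpM2l ?normc_nneg ?ex1_bound.
exists (ex1 z); split; first exact: aeW.
  move=> x /andP[x0 x1].
  have E : (fun t => 'i * (- 'i * (z * ex1 z t))) = (fun t => z * ex1 z t).
    apply/funext => t; rewrite mulrA; have -> : 'i * - 'i = 1 :> C.
      by apply: eqcP; rewrite !cE; ring.
    by rewrite mul1r.
  rewrite [X in _ + cintegral _ _ X]E cftc//.
  by rewrite /ex1 mulr0 cexp0 addrC subrK.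
rewrite /ex1 mulr0 cexp0 mulr1; have -> : z * (1%:C : C) = z by rewrite mulr1.
by rewrite cexp_freq.
Qed.

Lemma measurable_coord (b : bool) (p : R1 -> R) : measurable_fun I p ->
  measurable_fun Om (fun z : R2 => p (if b then z.2 else z.1)).
Proof.
move=> mp; have mpI : measurable_fun setT (p \_ I) by apply/(measurable_restrictT _ _).1 => //; exact: mI.
have mq : measurable_fun Om (fun z : R2 => (p \_ I) (if b then z.2 else z.1)).
  apply: measurable_funTS; case: b.
    exact: (measurableT_comp mpI measurable_snd).
  exact: (measurableT_comp mpI measurable_fst).
apply: eq_measurable_fun mq => z; rewrite inE => -[z1 z2].
by rewrite patchE mem_set//; case: b.
Qed.

Lemma integrable_coord (b : bool) (p : R1 -> R) : leb.-integrable I (EFin \o p) ->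
  leb2.-integrable Om (EFin \o (fun z : R2 => p (if b then z.2 else z.1))).
Proof.
move=> ip; have mp : measurable_fun I p by have /measurable_int/measurable_EFinP := ip.
have mq := measurable_coord b mp.
apply/integrableP; split; first exact/measurable_EFinP.
have /integrableP[_ ip2] := ip.
set c := (\int[leb]_(x in I) `|(EFin \o p) x|)%E in ip2.
pose F : R2 -> \bar R := ((fun z => `|(p (if b then z.2 else z.1))%:E|%E) \_ Om).
have mF : measurable_fun setT F.
  apply/(measurable_restrictT _ _).1; first exact: measurable_Omega.
  by apply: measurableT_comp => //; exact/measurable_EFinP.
have F0 x : (0 <= F x)%E by rewrite /F patchE; case: ifPn.
rewrite integral_mkcond -/F.
have FO x y : F (x, y) = if (x \in I) && (y \in I) then `|(p (if b then y else x))%:E|%E else 0%E.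
  rewrite /F patchE /=; congr (if _ then _ else _).
  by apply/idP/andP => [|[]]; rewrite !inE => -[].
have cI : (\int[leb]_(x in I) c = c)%E.
  rewrite integral_cst//; last exact: mI.
  by rewrite [X in (c * X)%E](_ : _ = 1%E) ?mule1//; exact: lebesgue_unitI.
suff -> : (\int[leb2]_z F z = c)%E by [].
clearbody F; case: b FO {mq} => FO.
  rewrite fubini_tonelli1// -[RHS]cI [RHS]integral_mkcond; apply: eq_integral => x _.
  rewrite /fubini_F patchE; case: ifPn => xI.
    rewrite /c [RHS]integral_mkcond; apply: eq_integral => y _; rewrite FO xI patchE /=.
    by case: ifPn.
  by rewrite integral0_eq// => y _; rewrite FO (negbTE xI).
rewrite fubini_tonelli2// -[RHS]cI [RHS]integral_mkcond; apply: eq_integral => y _.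
rewrite /fubini_G patchE; case: ifPn => yI.
  rewrite /c [RHS]integral_mkcond; apply: eq_integral => x _; rewrite FO yI andbT patchE /=.
  by case: ifPn.
by rewrite integral0_eq// => x _; rewrite FO (negbTE yI) andbF.
Qed.

Lemma fubini_swap (f : R2 -> R) (F G : R -> R) : leb2.-integrable Om (EFin \o f) ->
  (forall x, I x -> (\int[leb]_(y in I) (f (x, y))%:E = (F x)%:E)%E) ->
  (forall y, I y -> (\int[leb]_(x in I) (f (x, y))%:E = (G y)%:E)%E) ->
  leb.-integrable I (EFin \o (F : R1 -> R)) /\ \int[leb]_(x in I) F x = \int[leb]_(y in I) G y.
Proof.
move=> fi hF hG; have fT := integrable_patch_Omega fi.
have FE x : fubini_F leb (EFin \o (f \_ Om)) x = ((fun x => (F x)%:E) \_ I) x.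
  rewrite /fubini_F [RHS]patchE; case: ifPn => xI.
    rewrite -hF; last by rewrite inE in xI.
    rewrite [RHS]integral_mkcond; apply: eq_integral => y _.
    by rewrite /= patch_Omega [in LHS]patchE xI restrict_EFin.
  by rewrite integral0_eq// => y _ /=; rewrite patch_Omega patchE (negbTE xI).
have GE y : fubini_G leb (EFin \o (f \_ Om)) y = ((fun y => (G y)%:E) \_ I) y.
  rewrite /fubini_G [RHS]patchE; case: ifPn => yI.
    rewrite -hG; last by rewrite inE in yI.
    rewrite [RHS]integral_mkcond; apply: eq_integral => x _.
    rewrite /= patch_Omega restrict_EFin; congr EFin.
    by rewrite [LHS]patchE [RHS]patchE; case: ifPn => // _; rewrite patchE yI.
  rewrite integral0_eq// => x _ /=; rewrite patch_Omega patchE; case: ifPn => // _.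
  by rewrite patchE (negbTE yI).
have e1 := integral12_prod_meas1 fT; have e2 := integral21_prod_meas1 fT.
have iF := integrable_fubini_F fT.
have EF : fubini_F leb (EFin \o (f \_ Om)) = (fun x => (F x)%:E) \_ I by apply/funext.
have EG : fubini_G leb (EFin \o (f \_ Om)) = (fun x => (G x)%:E) \_ I by apply/funext.
split.
  apply/(integrable_mkcond _ mI); move: iF; rewrite EF.
  by congr (_.-integrable _ _).
rewrite /Rintegral; congr fine; rewrite [LHS]integral_mkcond [RHS]integral_mkcond.
by rewrite EF in e1; rewrite EG in e2; rewrite e1 e2.
Qed.

Lemma measurable_lt : measurable [set z : R2 | z.2 < z.1].
Proof.
have m : measurable_fun setT (fun z : R2 => z.1 - z.2) by apply: measurable_funB.
rewrite (_ : mkset _ = (fun z : R2 => z.1 - z.2) @^-1` `]0%R, +oo[%classic).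
  by rewrite -[X in measurable X]setTI; apply: m => //; exact: measurable_itv.
by apply/seteqP; split => z /=; rewrite in_itv /= andbT subr_gt0.
Qed.

(** Fubini's theorem for the function p (y) g'(x) on the triangle y < x.  The
    primitive of [p] is only absolutely continuous, which rules out
    integration by parts for functions of class C^1. *)
Lemma parts_real (p g dg : R -> R) : leb.-integrable I (EFin \o (p : R1 -> R)) ->
  (forall s : R, is_derive s 1 g (dg s)) -> continuous dg -> 
  let P x := \int[leb]_(t in [set t | 0 < t < x]) p t in
  leb.-integrable I (EFin \o (fun x => P x * dg x)) /\
  \int[leb]_(x in I) (P x * dg x) = g 1 * \int[leb]_(t in I) p t - \int[leb]_(t in I) (p t * g t).
Proof.
move=> ip dG cdg P.
have cg : continuous g.
  by move=> s; apply: differentiable_continuous; apply/derivable1_diffP; case: (dG s).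
have bdd (k : R -> R) : continuous k -> exists M, forall x, I x -> `|k x| <= M.
  move=> ck; have cK : continuous (fun z : R * R => k z.1).
    by move=> z; apply: continuous_comp; [exact: cvg_fst|exact: ck].
  have [M _ hM] := @cont_bounded_box R 1 _ cK; exists M => x /andP[x0 x1].
  by apply: (hM (x, 0)); split; rewrite /= ?normr0// gtr0_norm// ltW.
have mp : measurable_fun I p by have /measurable_int/measurable_EFinP := ip.
pose ind (z : R2) : R := \1_[set z : R2 | z.2 < z.1] z.
pose f (z : R2) : R := p z.2 * (dg z.1 * ind z).
have mk : measurable_fun Om (fun z : R2 => dg z.1 * ind z).
  apply: measurable_funM; first by apply: measurable_funTS; exact: measurable_fst_cont.
  by apply: measurable_funTS; apply: measurable_indic; exact: measurable_lt.
have [M hM] := bdd dg cdg.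
have fi : leb2.-integrable Om (EFin \o f).
  have i2 := integrable_coord true ip.
  apply: (integrableMl (@measurable_Omega R) i2 mk).
  exists `|M|; split; first exact: num_real.
  move=> N MN z [z1 _] /=; rewrite normrM (le_trans _ (ltW MN))// (@le_trans _ _ (`|M| * 1))//; last by rewrite mulr1.
  rewrite ler_pM//; first by rewrite (le_trans (hM _ z1))// ler_norm.
  by rewrite /ind indicE; case: (_ \in _); rewrite ?normr1 ?normr0.
have sub x : I x -> [set t | 0 < t < x] `<=` (I : set R1).
  by move=> /andP[x0 x1] t /andP[t0 tx]; apply/andP; split => //; exact: lt_trans tx x1.
have mtx x : measurable ([set t | 0 < t < x] : set R1).
  have -> : ([set t | 0 < t < x] : set R1) = [set` `]0, x[].
    by apply/seteqP; split => t /=; rewrite in_itv.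
  exact: measurable_itv.
have ipx x : I x -> leb.-integrable [set t | 0 < t < x] (EFin \o (p : R1 -> R)).
  by move=> Ix; apply: (integrableS mI (mtx x) (sub x Ix)).
have hF x : I x -> (\int[leb]_(y in I) (f (x, y))%:E = (P x * dg x)%:E)%E.
  move=> Ix; have ix := ipx x Ix.
  transitivity (\int[leb]_(y in I) (((fun y => (dg x * p y)%:E) \_ [set t | (0 < t < x)%R]) y))%E.
    apply: eq_integral => y; rewrite inE => /andP[y0 y1]; rewrite patchE /f /ind indicE.
    rewrite (_ : (y \in [set t | 0 < t < x]) = ((x, y) \in [set z : R2 | z.2 < z.1])).
      by case: ifPn => _; congr EFin; rewrite ?mulr1 ?mulr0 // mulrC.
    by apply/idP/idP; rewrite !inE /= ?y0.
  rewrite -integral_mkcondr (_ : I `&` _ = [set t | 0 < t < x]); last by apply: setIidr; exact: sub.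
  have ic := integrable_RZ (mtx x) (dg x) ix.
  rewrite mulrC /P -(RintegralZl (dg x) (mtx x) ix) /Rintegral fineK; first by [].
  by apply: integrable_fin_num; [exact: mtx|exact: ic].
have hG y : I y -> (\int[leb]_(x in I) (f (x, y))%:E = (p y * (g 1 - g y))%:E)%E.
  move=> Iy; have /andP[y0 y1] := Iy.
  have cs : [set x | y < x < 1] `<=` (I : set R1).
    by move=> t /andP[t0 tx]; apply/andP; split => //; exact: lt_trans y0 t0.
  transitivity (\int[leb]_(x in I) (((fun x => (p y * dg x)%:E) \_ [set t | (y < t < 1)%R]) x))%E.
    apply: eq_integral => x; rewrite inE => /andP[x0 x1]; rewrite patchE /f /ind indicE.
    rewrite (_ : (x \in [set t | y < t < 1]) = ((x, y) \in [set z : R2 | z.2 < z.1])).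
      by case: ifPn => _; congr EFin; rewrite ?mulr1 ?mulr0.
    by apply/idP/idP; rewrite !inE /= ?x1 ?andbT.
  rewrite -integral_mkcondr (_ : I `&` _ = [set t | y < t < 1]); last by apply: setIidr.
  have E : [set t | y < t < 1] = [set` `]y, 1[] by apply/seteqP; split => t /=; rewrite in_itv.
  have mi : measurable ([set t | y < t < 1] : set R1) by rewrite E; exact: measurable_itv.
  have idg : leb.-integrable [set t | y < t < 1] (EFin \o (dg : R1 -> R)).
    apply: (integrableS mI) => //.
    by apply: (@bounded_integrable_I _ M) => //; exact: cont_meas mI cdg.
  have icg := integrable_RZ mi (p y) idg.
  rewrite -[LHS]fineK; last by apply: integrable_fin_num; [exact: mi|exact: icg].
  congr EFin; rewrite -[LHS]/(Rintegral _ _ _) RintegralZl; [|exact: mi|exact: idg].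
  congr (_ * _); rewrite /Rintegral -[RHS]/(fine (g 1 - g y)%:E); congr fine.
  by apply: ftc_open => //; exact: ltW.
have [iF ->] := fubini_swap fi hF hG; split => //.
have [N hN] := bdd g cg.
have ipg : leb.-integrable I (EFin \o (fun t => p t * g t)).
  apply: (integrableMl mI ip); first by exact: cont_meas mI cg.
  exists N; split; first exact: num_real.
  by move=> K NK t It /=; rewrite (le_trans (hN _ It))// ltW.
have ipc := integrable_RZ mI (g 1) ip.
rewrite -RintegralZl; [|exact: mI|exact: ip].
rewrite -RintegralB; [|exact: mI|exact: ipc|exact: ipg].
by apply: eq_Rintegral => t _; ring.
Qed.

End OneVariable.

(** * Test functions of one variable *)

Section OneVariable2.
Variable R : realType.
Local Notation C := R[i].
Local Notation leb := (@lebesgue_measure R).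
Local Notation I := (@unitI R).
Local Notation R1 := (measurableTypeR R).
Local Notation R2 := (measurableTypeR R * measurableTypeR R)%type.
Local Notation leb2 := (leb \x leb)%E.
Local Notation Om := (@Omega R).
Local Notation Re := complex.Re.
Local Notation Im := complex.Im.
Local Notation mI := (@measurable_unitI R).
Local Notation adj1 hj := (adjoint leb I (L1 hj)).

Lemma ex1_bdd z : exists M, forall x, I x -> normc (ex1 z x : C) <= M.
Proof. by exists (expR `|Re z|) => x; exact: ex1_bound. Qed.

Lemma cintegrableM_ex1 (p : R1 -> C) z : cintegrable leb I p -> cintegrable leb I (fun x => p x * ex1 z x).
Proof.
by move=> ip; apply: (cintegrableM mI ip (cmeas_ex1 z)) => x Ix; exact: ex1_bound Ix.
Qed.

Lemma parts_complex (p : R1 -> C) z : cintegrable leb I p ->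
  let P x := cintegral leb [set t | 0 < t < x] p in
  cintegrable leb I (fun x => P x * (z * ex1 z x)) /\
  cintegral leb I (fun x => P x * (z * ex1 z x)) =
    ex1 z 1 * cintegral leb I p - cintegral leb I (fun x => p x * ex1 z x).
Proof.
move=> ip P; have [iR iI] := ip; have [cR cI] := ex1_dcont z.
have [a1 b1] := parts_real iR (fun s => (ex1_der z s).1) cR.
have [a2 b2] := parts_real iI (fun s => (ex1_der z s).2) cI.
have [a3 b3] := parts_real iR (fun s => (ex1_der z s).2) cI.
have [a4 b4] := parts_real iI (fun s => (ex1_der z s).1) cR.
have ReP x : Re (P x) = \int[leb]_(t in [set t | 0 < t < x]) Re (p t) by [].
have ImP x : Im (P x) = \int[leb]_(t in [set t | 0 < t < x]) Im (p t) by [].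
have eR x : Re (P x * (z * ex1 z x)) = Re (P x) * Re (z * ex1 z x) - Im (P x) * Im (z * ex1 z x) by rewrite ReM.
have eI x : Im (P x * (z * ex1 z x)) = Re (P x) * Im (z * ex1 z x) + Im (P x) * Re (z * ex1 z x) by rewrite ImM.
split.
  split.
    have := integrable_RB mI a1 a2; congr (_.-integrable _ _); apply/funext => x /=; by rewrite eR.
  have := integrable_RD mI a3 a4; congr (_.-integrable _ _); apply/funext => x /=; by rewrite eI.
have [q1 q2] := cintegrableM_ex1 z ip.
have bd (f g : R1 -> R) : leb.-integrable I (EFin \o f) -> continuous (g : R -> R) -> (exists M, forall x, I x -> `|g x| <= M) ->
  leb.-integrable I (EFin \o (fun x => f x * g x)).
  move=> fi cg [N hN]; apply: (integrableMl mI fi); first by exact: cont_meas mI cg.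
  exists N; split; first exact: num_real.
  by move=> K NK t It /=; rewrite (le_trans (hN _ It))// ltW.
have bR : exists M, forall x, I x -> `|Re (ex1 z x)| <= M.
  by exists (expR `|Re z|) => x Ix; exact: le_trans (Re_le_normc _) (ex1_bound z Ix).
have bI : exists M, forall x, I x -> `|Im (ex1 z x)| <= M.
  by exists (expR `|Re z|) => x Ix; exact: le_trans (Im_le_normc _) (ex1_bound z Ix).
have iRR := bd _ _ iR (@ex1_contRe R z) bR; have iII := bd _ _ iI (@ex1_contIm R z) bI.
have iRI := bd _ _ iR (@ex1_contIm R z) bI; have iIR := bd _ _ iI (@ex1_contRe R z) bR.
apply: eqcP.
  transitivity (\int[leb]_(x in I) (Re (P x) * Re (z * ex1 z x) - Im (P x) * Im (z * ex1 z x))).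
    by rewrite {1}/cintegral Remk; apply: eq_Rintegral => x _; rewrite eR.
  rewrite RintegralB; [|exact: mI|exact: a1|exact: a2].
  rewrite b1 b2 ReD ReN ReM /cintegral !cE.
  have -> : \int[leb]_(x in I) Re (p x * ex1 z x) = \int[leb]_(x in I) (Re (p x) * Re (ex1 z x) - Im (p x) * Im (ex1 z x)).
    by apply: eq_Rintegral => x _; rewrite ReM.
  rewrite RintegralB; [|exact: mI|exact: iRR|exact: iII].
  by ring.
transitivity (\int[leb]_(x in I) (Re (P x) * Im (z * ex1 z x) + Im (P x) * Re (z * ex1 z x))).
  by rewrite {1}/cintegral Immk; apply: eq_Rintegral => x _; rewrite eI.
rewrite RintegralD; [|exact: mI|exact: a3|exact: a4].
rewrite b3 b4 ImD ImN ImM /cintegral !cE.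
have -> : \int[leb]_(x in I) Im (p x * ex1 z x) = \int[leb]_(x in I) (Re (p x) * Im (ex1 z x) + Im (p x) * Re (ex1 z x)).
  by apply: eq_Rintegral => x _; rewrite ImM.
rewrite RintegralD; [|exact: mI|exact: iRI|exact: iIR].
by ring.
Qed.

Lemma ex1J (z : C) x : Num.conj (ex1 z x) = ex1 (Num.conj z) x.
Proof. by rewrite /ex1 cexpJ; congr cexp; apply: eqcP; rewrite !cE; ring. Qed.

Lemma L2_ex1Z (c z : C) : L2 leb I (fun x : R1 => c * ex1 z x).
Proof.
apply: (@L2_bounded1 _ _ (normc c * expR `|Re z|)).
  by apply: cmeasM; [exact: cmeas_cst|exact: cmeas_ex1].
by move=> x Ix; rewrite normcM ler_wpM2l ?normc_nneg//; exact: ex1_bound Ix.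
Qed.

(** Integration by parts; the boundary terms cancel because F gains a factor
    h_j from 0 to 1, and the conjugate of the exponential loses it. *)
Lemma adj1_ex1 (hj : R) (k : int) (c : C) : 0 < hj ->
  adj1 hj (fun x => c * ex1 (- freq hj k) x) (fun x => ('i * freq hj k * c) * ex1 (- freq hj k) x).
Proof.
move=> h0; split; [exact: L2_ex1Z|exact: L2_ex1Z|].
move=> u v [u2 v2 [F [uF FE hF]]].
have iu := L2_cintegrable1 u2; have iv := L2_cintegrable1 v2.
pose z := Num.conj (- freq hj k).
pose p := fun t : R1 => 'i * v t.
have ip : cintegrable leb I p by exact: cintegrableZ mI _ _ iv.
have [iP eP] := parts_complex z ip.
set P := (fun x => cintegral leb [set t | 0 < t < x] p) in iP eP.
have FP x : I x -> F x = F 0 + P x.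
  by move=> /andP[x0 x1]; rewrite FE// !ltW.
have F1 : F 1 = F 0 + cintegral leb I p by rewrite FE ?ler01 ?lexx.
have iG : cintegrable leb I (fun x => z * ex1 z x).
  by apply: cintegrableZ; [exact: mI|exact: cintegrable_ex1].
have G1 : cintegral leb I (fun x => z * ex1 z x) = ex1 z 1 - 1 by apply: cftc; exact: ler01.
have iuG := cintegrableM_ex1 z iu; have ivG := cintegrableM_ex1 z iv.
have e1 : z * cintegral leb I (fun x => u x * ex1 z x) = F 0 * (ex1 z 1 - 1) + cintegral leb I (fun x => P x * (z * ex1 z x)).
  rewrite -(cintegralZ mI _ iuG) -G1 -(cintegralZ mI _ iG) -(cintegralD mI (cintegrableZ mI _ iG) iP).
  apply: ae_eq_cintegral.
  - exact: mI.
  - by apply: cintegrable_meas; exact: (cintegrableZ mI z iuG).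
  - by apply: cintegrable_meas; exact: (cintegrableD mI (cintegrableZ mI _ iG) iP).
  - by apply: filterS uF => x ux Ix; rewrite (ux Ix) (FP _ Ix) -/(P x); ring.
have Gh : hj%:C * ex1 z 1 = 1.
  have -> : hj%:C = Num.conj (cexp (freq hj k)) by rewrite cexp_freq//; apply: eqcP; rewrite !cE ?oppr0.
  rewrite /ex1 /z cexpJ -cexpD -[RHS]cexp0; congr cexp.
  by apply: eqcP; rewrite !cE; ring.
have ep : cintegral leb I (fun x => p x * ex1 z x) = 'i * cintegral leb I (fun x => v x * ex1 z x).
  by rewrite -(cintegralZ mI _ ivG); apply: eq_cintegral => x _; rewrite /p; ring.
have key : z * cintegral leb I (fun x => u x * ex1 z x) = - ('i * cintegral leb I (fun x => v x * ex1 z x)).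
  rewrite e1 eP ep.
  have -> : cintegral leb I p = F 1 - F 0 by rewrite F1 addrC addKr.
  have -> : ex1 z 1 * (F 1 - F 0) = (hj%:C * ex1 z 1) * F 0 - ex1 z 1 * F 0 by rewrite -hF; ring.
  by rewrite Gh; ring.
rewrite /inner.
transitivity (Num.conj c * cintegral leb I (fun x => v x * ex1 z x)).
  rewrite -(cintegralZ mI _ ivG); apply: eq_cintegral => x _.
  by rewrite /= conjM ex1J -/z; ring.
transitivity (Num.conj ('i * freq hj k * c) * cintegral leb I (fun x => u x * ex1 z x)); last first.
  rewrite -(cintegralZ mI _ iuG); apply: eq_cintegral => x _.
  by rewrite /= [in RHS]conjM ex1J -/z; ring.
have -> : Num.conj ('i * freq hj k * c) = Num.conj c * ('i * z).
  by rewrite /z; apply: eqcP; rewrite !cE; ring.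
rewrite -!mulrA key; congr (_ * _).
have ii : 'i * 'i = -1 :> C by apply: eqcP; rewrite !cE; ring.
by rewrite mulrN mulrA ii mulN1r opprK.
Qed.

Lemma Hinf1_ex1 (hj : R) (k : int) : 0 < hj -> Hinf (adj1 hj) (ex1 (- freq hj k) : R1 -> C).
Proof.
move=> h0 n _; exists (fun x => (('i * freq hj k) ^+ n) * ex1 (- freq hj k) x).
have it m (c : C) : iterop (adj1 hj) m (fun x => c * ex1 (- freq hj k) x) (fun x => (('i * freq hj k) ^+ m * c) * ex1 (- freq hj k) x).
  elim: m c => [|m IH] c /=; first by apply/funext => x; rewrite expr0 mul1r.
  exists (fun x => ('i * freq hj k * c) * ex1 (- freq hj k) x); first exact: adj1_ex1.
  have := IH ('i * freq hj k * c); congr (iterop _ _ _ _); apply/funext => x.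
  by rewrite exprSr; ring.
have := it n 1; congr (iterop _ _ _ _); apply/funext => x; by rewrite ?mulr1 ?mul1r.
Qed.

Definition coef1 (hj : R) (f : R1 -> C) (k : int) : C := cintegral leb I (fun x => f x * ex1 (freq hj k) x).

Lemma freqJ (hj : R) k : Num.conj (freq hj (- k)) = freq hj k.
Proof. by rewrite /freq mulrNz; apply: eqcP; rewrite !cE; ring. Qed.

Lemma coef1_adj hj (f g : R1 -> C) k : 0 < hj -> adj1 hj f g -> coef1 hj g k = 'i * freq hj k * coef1 hj f k.
Proof.
move=> h0 [f2 g2 a]; have fi := L2_cintegrable1 f2; have gi := L2_cintegrable1 g2.
have := a _ _ (L1_ex1 (- k) h0); rewrite /inner => e.
have ifk := cintegrableM_ex1 (freq hj k) fi; have igk := cintegrableM_ex1 (freq hj k) gi.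
have zJ : Num.conj (freq hj k) = freq hj (- k) by rewrite -{1}(opprK k) freqJ.
rewrite /coef1 -(cintegralZ mI _ ifk); apply: conj_inj.
rewrite -(cintegralJ mI igk) -(cintegralJ mI (cintegrableZ mI _ ifk)).
transitivity (cintegral leb I (fun x => ex1 (freq hj (- k)) x * Num.conj (g x))).
  by apply: eq_cintegral => x _; rewrite conjM ex1J zJ mulrC.
rewrite -e; apply: eq_cintegral => x _.
rewrite /= (conjM (_ * _) (_ * _)) (conjM (f x)) (conjM 'i) ex1J zJ; have -> : Num.conj ('i : C) = - 'i by apply: eqcP; rewrite !cE ?oppr0.
by ring.
Qed.

Lemma coef1_iter hj n (f g : R1 -> C) : 0 < hj -> L2 leb I f -> iterop (adj1 hj) n f g ->
  L2 leb I g /\ forall k, coef1 hj g k = ('i * freq hj k) ^+ n * coef1 hj f k.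
Proof.
move=> h0; elim: n f => [|n IH] f f2 /=; first by move=> <-; split => // k; rewrite expr0 mul1r.
move=> [f' ff' f'g]; have [_ f'2 _] := ff'; have [g2 gE] := IH _ f'2 f'g.
by split => // k; rewrite gE (coef1_adj _ h0 ff') exprSr mulrA.
Qed.

Lemma coef1_bdd hj (f : R1 -> C) : L2 leb I f -> exists2 B, 0 <= B & forall k, normc (coef1 hj f k) <= B.
Proof.
move=> f2; have fi := L2_cintegrable1 f2.
have ni := integrable_normc mI fi.
pose N := expR `|ln hj|.
exists (2 * (N * \int[leb]_(x in I) normc (f x))).
  apply: mulr_ge0 => //; apply: mulr_ge0; first exact: expR_ge0.
  by apply: Rintegral_ge0 => x _; exact: normc_nneg.
move=> k; have ik := cintegrableM_ex1 (freq hj k) fi.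
apply: (le_trans (normc_cintegral mI ik)); apply: ler_wpM2l => //.
rewrite -(RintegralZl N mI ni); apply: le_Rintegral.
- exact: mI.
- exact: integrable_normc mI _ ik.
- exact: (integrable_RZ mI N ni).
- move=> x Ix; rewrite normcM mulrC; apply: ler_wpM2r; first exact: normc_nneg.
  exact: ex1_bound Ix.
Qed.

(** The adjoint multiplies the coefficients by i (log h_j + 2 pi i k), so m
    powers of (1 + k ^ 2) are gained by applying it 2 m times. *)
Lemma coef1_decay hj (f : R1 -> C) m : 0 < hj -> Hinf (adj1 hj) f ->
  exists2 B, 0 <= B & forall k : int, normc (coef1 hj f k) * (1 + k%:~R ^+ 2) ^+ m <= B.
Proof.
move=> h0 hf; have f2 : L2 leb I f by have [g [f' [? _ _] _]] := hf 1%N isT.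
have [g fg] : exists g, iterop (adj1 hj) (2 * m) f g.
  by case: m => [|m]; [exists f|apply: hf; rewrite mulnS].
have [g2 gE] := coef1_iter h0 f2 fg.
have [Bf Bf0 hBf] := coef1_bdd hj f2; have [Bg Bg0 hBg] := coef1_bdd hj g2.
exists (2 ^+ m * (Bf + Bg)); first by apply: mulr_ge0; [exact: exprn_ge0|exact: addr_ge0].
move=> k; have c0 := normc_nneg (coef1 hj f k).
set s : R := k%:~R ^+ 2; have s0 : 0 <= s by rewrite sqr_ge0.
have nfr : s <= normc (freq hj k) ^+ 2.
  rewrite normc_sqr /freq /= exprMn -/s.
  have p2 : 1 <= (2 * pi) ^+ 2 :> R by rewrite exprn_ege1//; have := pi_ge2 R; lra.
  have : s <= (2 * pi) ^+ 2 * s by rewrite ler_peMl.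
  by have := sqr_ge0 (ln hj); lra.
have sm : s ^+ m * normc (coef1 hj f k) <= Bg.
  apply: le_trans (hBg k); rewrite gE normcM normcX normcM.
  have -> : normc ('i : C) = 1 by rewrite normcE !cE expr0n add0r expr1n sqrtr1.
  rewrite mul1r exprM ler_wpM2r//; apply: lerXn2r; rewrite ?nnegrE//.
  exact: sqr_ge0.
have wm := exprD1_le m s0.
apply: (@le_trans _ _ (normc (coef1 hj f k) * (2 ^+ m * (1 + s ^+ m)))); first by rewrite ler_wpM2l.
rewrite mulrCA; apply: ler_wpM2l; first exact: exprn_ge0.
rewrite mulrDr mulr1 lerD//.
by rewrite mulrC.
Qed.

Lemma int_char_I (l : int) : cintegral leb I (ex1 (0 +i* (2 * pi * l%:~R)) : R1 -> C) = if l == 0 then 1 else 0.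
Proof.
set z : C := 0 +i* _.
case: eqP => [l0|/eqP l0].
  have -> : (ex1 z : R1 -> C) = (fun=> 1).
    apply/funext => x; rewrite /ex1 /z l0 mulr0.
    have -> : (0 +i* 0) * x%:C = 0 :> C by apply: eqcP; rewrite !cE; ring.
    exact: cexp0.
  rewrite /cintegral; apply: eqcP; rewrite !cE Rintegral_cst ?mul0r//; try exact: mI.
  by rewrite mul1r [X in fine X](_ : _ = 1%E)//; exact: lebesgue_unitI.
have z0 : z != 0.
  apply/eqP => /(congr1 (@complex.Im R)) /= /eqP; rewrite !mulf_eq0 pnatr_eq0 /= intr_eq0 (negbTE l0) orbF.
  by rewrite gt_eqF// pi_gt0.
have e : z * cintegral leb I (ex1 z) = 0.
  rewrite -(cintegralZ mI _ (cintegrable_ex1 z)).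
  have := @cftc R z 1 ler01; rewrite -unitIE => ->.
  rewrite /ex1; have -> : z * (1%:C : C) = z by rewrite mulr1.
  by rewrite cexp_2pi subrr.
by move/eqP: e; rewrite mulf_eq0 (negbTE z0) => /eqP.
Qed.

Lemma prod_real (p q : R1 -> R) : leb.-integrable I (EFin \o p) -> measurable_fun I q ->
  (exists M, forall x, I x -> `|q x| <= M) ->
  leb2.-integrable Om (EFin \o (fun z : R2 => p z.1 * q z.2)) /\
  \int[leb2]_(z in Om) (p z.1 * q z.2) = (\int[leb]_(x in I) p x) * (\int[leb]_(y in I) q y).
Proof.
move=> ip mq [M hM].
have i1 := integrable_coord false ip.
have mq2 := measurable_coord true mq.
have iq : leb.-integrable I (EFin \o q) by exact: bounded_integrable_I mq hM.
have i2 : leb2.-integrable Om (EFin \o (fun z : R2 => p z.1 * q z.2)).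
  apply: (integrableMl (@measurable_Omega R) i1 mq2).
  exists M; split; first exact: num_real.
  by move=> K NK t [_ It] /=; rewrite (le_trans (hM _ It))// ltW.
split => //; have [_ <- _] := fubini_Omega i2.
rewrite -(RintegralZr _ mI ip); apply: eq_Rintegral => x _.
by rewrite -(RintegralZl _ mI iq).
Qed.

Lemma prod_complex (p q : R1 -> C) : cintegrable leb I p -> cmeas I q ->
  (exists M, forall x, I x -> normc (q x) <= M) ->
  cintegrable leb2 Om (fun z : R2 => p z.1 * q z.2) /\
  cintegral leb2 Om (fun z : R2 => p z.1 * q z.2) = cintegral leb I p * cintegral leb I q.
Proof.
move=> [pR pI] [mR mI'] [M hM].
have bR : exists M, forall x, I x -> `|Re (q x)| <= M.
  by exists M => x Ix; exact: le_trans (Re_le_normc _) (hM _ Ix).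
have bI : exists M, forall x, I x -> `|Im (q x)| <= M.
  by exists M => x Ix; exact: le_trans (Im_le_normc _) (hM _ Ix).
have [a1 b1] := prod_real pR mR bR; have [a2 b2] := prod_real pI mI' bI.
have [a3 b3] := prod_real pR mI' bI; have [a4 b4] := prod_real pI mR bR.
have mO := @measurable_Omega R.
split.
  split.
    have := integrable_RB mO a1 a2; congr (_.-integrable _ _); apply/funext => x /=; by rewrite ReM.
  have := integrable_RD mO a3 a4; congr (_.-integrable _ _); apply/funext => x /=; by rewrite ImM.
apply: eqcP.
  rewrite ReM /cintegral !cE -b1 -b2 -(RintegralB mO a1 a2).
  by apply: eq_Rintegral => x _; rewrite ReM.
rewrite ImM /cintegral !cE -b3 -b4 -(RintegralD mO a3 a4).
by apply: eq_Rintegral => x _; rewrite ImM.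
Qed.

End OneVariable2.

(** * The periodic primitive *)

Section Primitive.
Variable R : realType.
Local Notation leb := (@lebesgue_measure R).
Local Notation I := (@unitI R).
Variable a : R -> R.
Hypotheses (sa : smooth1 a) (pa : forall x, a (x + 1) = a x).

Let b (x : R) : R := a x - mean a.

Let cb : continuous b.
Proof. by move=> x; apply: (@continuousB _ _ _ a (fun=> mean a)); [exact: smooth1_cont|exact: cst_continuous]. Qed.

Let bint (f : R -> R) (y x : R) : continuous f -> leb.-integrable `[y, x] (EFin \o f).
Proof.
move=> cf; apply: continuous_compact_integrable; first exact: segment_compact.
exact: continuous_subspaceT.
Qed.

Let oo_cc (f : R -> R) (x : R) : continuous f ->
  \int[leb]_(t in [set t | 0 < t < x]) f t = \int[leb]_(t in `]0, x]) f t.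
Proof.
move=> cf; have ic := @bint f 0 x cf.
have i1 : leb.-integrable `]0, x] (EFin \o f).
  by apply: integrableS ic => //; exact: subset_itv_oc_cc.
have i2 : leb.-integrable `]0, x[ (EFin \o f).
  by apply: integrableS ic => //; exact: subset_itv_oo_cc.
by rewrite -(Rintegral_itv_bndo_bndc i2); congr (Rintegral _ _ _).
Qed.

Let G (x : R) : R := \int[leb]_(t in `[-1, x]) b t - \int[leb]_(t in `[-1, 0]) b t.

Let GB (y x : R) : -1 <= y -> y <= x -> G x - G y = \int[leb]_(t in `]y, x]) b t.
Proof.
move=> y1 yx; rewrite /G opprB addrA subrK.
by apply: Rintegral_itvB; [exact: bint|rewrite bnd_simp|rewrite bnd_simp].
Qed.

Let G0 : G 0 = 0. Proof. by rewrite /G subrr. Qed.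

Let dG (x : R) : -1 < x -> is_derive x 1 G (b x).
Proof.
move=> x1.
have xu : x < x + 1 by rewrite ltrDl.
have [d e] := continuous_FTC1_closed xu (@bint b (-1) (x + 1) cb) x1 (cb (x := x)).
have h : is_derive x 1 (fun x => \int[leb]_(t in `[-1, x]) b t) (b x).
  by split; [exact: d|rewrite -derive1E; exact: e].
have := is_deriveB h (is_derive_cst (\int[leb]_(t in `[-1, 0]) b t) x 1).
by rewrite subr0.
Qed.

Let mean0 : \int[leb]_(t in `]0, 1]) b t = 0.
Proof.
rewrite -(oo_cc _ cb).
have i1 : leb.-integrable I (EFin \o a).
  have := @bint a 0 1 (smooth1_cont sa); apply: integrableS => //; first exact: measurable_unitI.
  by move=> t; rewrite /= in_itv /= => /andP[t0 t1]; rewrite !ltW.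
have i2 : leb.-integrable I (EFin \o (fun=> mean a)).
  by apply: (@bounded_integrable_I _ _ `|mean a|).
rewrite (RintegralB (@measurable_unitI R) i1 i2).
rewrite Rintegral_cst; last exact: measurable_unitI.
by rewrite [X in fine X](_ : _ = 1%E) ?mulr1 ?subrr//; exact: lebesgue_unitI.
Qed.

Let G1 (x : R) : -1 < x -> G (x + 1) = G x.
Proof.
move=> x1; pose D y := G (y + 1) - G y.
have dD (y : R) : -1 < y -> is_derive y 1 D 0.
  move=> y1; have h2 : is_derive (y + 1) 1 G (b (y + 1)) by apply: dG; rewrite (lt_trans y1)// ltrDl.
  have h3 : is_derive y 1 (fun y => G (y + 1)) (b (y + 1)).
    have h4 : is_derive y 1 (fun y : R => y + 1) (1 + 0) by apply: is_deriveD.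
    by have := @is_derive1_comp _ G (fun y => y + 1) y _ _ h2 h4; rewrite addr0 mulr1.
  have := is_deriveB h3 (dG y1); rewrite /b pa subrr; exact.
have D0 : D 0 = 0.
  by rewrite /D add0r (GB (x := 1)) ?mean0// ?lerN10.
suff : D x = D 0 by rewrite D0 => /eqP; rewrite subr_eq0 => /eqP.
have key (u v : R) : -1 < u -> u < v -> D u = D v.
  move=> u1 uv; have inv y : y \in `]u, v[ -> -1 < y.
    by rewrite in_itv /= => /andP[uy _]; exact: lt_trans uy.
  have [|c _] := @MVT _ D (fun=> 0) _ _ uv (fun y yi => dD y (inv y yi)).
    apply: continuous_in_subspaceT => y; rewrite inE /= in_itv /= => /andP[uy _].
    have [+ _] := dD y (lt_le_trans u1 uy).
    by move=> /derivable1_diffP /differentiable_continuous.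
  by rewrite mul0r => /eqP; rewrite subr_eq0 => /eqP.
by case: (ltgtP x 0) => [x0|x0|->//]; [exact: key|apply/esym/key => //; exact: ltrN10].
Qed.

Let GN (x : R) n : -1 < x -> G (x + n%:R) = G x.
Proof.
elim: n => [|n IH] x1; first by rewrite addr0.
by rewrite -natr1 addrA G1 ?IH// (lt_le_trans x1)// lerDl.
Qed.

Let N (x : R) : nat := (Num.truncn `|x|).+1.

Let NP x : 0 < x + (N x)%:R.
Proof.
have : - `|x| <= x by rewrite lerNl ler_normr lexx orbT.
have : `|x| < (N x)%:R by apply: truncnS_gt.
by lra.
Qed.

(** The primitive of a - a_0 is obtained by integrating from - 1, so that it
    is differentiable at 0; it is periodic on ]- 1, +oo[ because a - a_0 has
    mean zero; every point is then moved into this half-line by an integer. *)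
Definition perprim (x : R) : R := G (x + (N x)%:R).

Let perprimE (x : R) n : -1 < x + n%:R -> perprim x = G (x + n%:R).
Proof.
move=> xn; rewrite /perprim.
rewrite -(GN n (lt_trans (ltrN10 R) (NP x))) -(GN (N x) xn).
by rewrite addrAC.
Qed.

Lemma perprim_der (x : R) : is_derive x 1 perprim (b x).
Proof.
have x0 := NP x.
have h : is_derive x 1 (fun y => G (y + (N x)%:R)) (b x).
  have h2 : is_derive (x + (N x)%:R) 1 G (b (x + (N x)%:R)) by apply: dG; apply: lt_trans x0; exact: ltrN10.
  have h4 : is_derive x 1 (fun y : R => y + (N x)%:R) (1 + 0) by apply: is_deriveD.
  have := @is_derive1_comp _ G (fun y => y + (N x)%:R) x _ _ h2 h4; rewrite addr0 mulr1.
  have bN n : b (x + n%:R) = b x.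
    by elim: n => [|n IH]; rewrite ?addr0// -natr1 addrA /b pa.
  by rewrite bN.
apply: (near_eq_is_derive _ h).
have : \forall y \near x, -1 - (N x)%:R < y by apply: lt_nbhsr; move: x0; lra.
by apply: filterS => y yx; rewrite (@perprimE y (N x))//; move: yx; lra.
Qed.

Lemma perprim_derive1 : derive1 perprim = b.
Proof. by apply/funext => x; rewrite derive1E; exact: (@derive_val _ _ _ _ _ _ _ (perprim_der x)). Qed.

Lemma perprim_smooth : smooth1 perprim.
Proof.
move=> [|n] x; first by case: (perprim_der x).
rewrite derive1Sn perprim_derive1; case: n => [|n].
  apply: (@derivableB _ _ _ a (fun=> mean a)); last exact: derivable_cst.
  by case: (smooth1_der x sa).
suff -> : derive1n n.+1 b = derive1n n.+1 a by exact: sa.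
rewrite !derive1Sn; congr derive1n; apply/funext => y; rewrite derive1E.
have h := is_deriveB (smooth1_der y sa) (is_derive_cst (mean a) y 1).
by rewrite (@derive_val _ _ _ _ _ _ _ h) subr0.
Qed.

Lemma perprim_per x : perprim (x + 1) = perprim x.
Proof.
have x1 := NP x; rewrite (@perprimE _ (N x)); first by rewrite addrAC G1// (lt_trans _ x1)// ltrN10.
by move: x1; lra.
Qed.

Lemma perprim_Aprim x : 0 < x < 1 -> perprim x = Aprim a x.
Proof.
move=> /andP[x0 x1]; rewrite (@perprimE _ 0%N) ?addr0; last by lra.
have := GB (lerN10 R) (ltW x0); rewrite G0 subr0 => ->.
rewrite -(oo_cc _ cb) /Aprim; set J := [set t | 0 < t < x].
have mJ : measurable (J : set (measurableTypeR R)).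
  rewrite (_ : J = `]0, x[%classic) //; by apply/seteqP; split => t /=; rewrite in_itv.
have JI : J `<=` I by move=> t /andP[t0 tx]; rewrite /unitI /= t0 (lt_trans tx).
have i1 : leb.-integrable J (EFin \o a).
  have := @bint a 0 1 (smooth1_cont sa); apply: integrableS => //.
  by move=> t /JI /andP[t0 t1]; rewrite /= in_itv /= !ltW.
have i2 : leb.-integrable J (EFin \o (fun=> mean a)).
  apply: (integrableS (@measurable_unitI R) mJ JI).
  by apply: (@bounded_integrable_I _ _ `|mean a|).
rewrite (RintegralB mJ i1 i2) Rintegral_cst//; congr (_ - _); rewrite mulrC; congr (_ * _).
rewrite (_ : J = `]0, x[%classic); last by apply/seteqP; split => t /=; rewrite in_itv.
rewrite [X in fine X](_ : _ = x%:E)//; apply: (etrans (@lebesgue_measure_itv R `]0, x[)).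
by rewrite /= lte_fin x0 /= sube0.
Qed.

End Primitive.

(** * Conjugation by the shear *)

Section Main.
Variable R : realType.
Local Notation C := R[i].
Local Notation leb := (@lebesgue_measure R).
Local Notation I := (@unitI R).
Local Notation R1 := (measurableTypeR R).
Local Notation R2 := (measurableTypeR R * measurableTypeR R)%type.
Local Notation leb2 := (leb \x leb)%E.
Local Notation Om := (@Omega R).
Local Notation Re := complex.Re.
Local Notation Im := complex.Im.
Variable h : R * R.
Hypotheses (h1_gt0 : 0 < h.1) (h2_gt0 : 0 < h.2).
Local Notation adj1 hj := (adjoint leb I (L1 hj)).
Local Notation mI := (@measurable_unitI R).
Local Notation mO := (@measurable_Omega R).
Local Notation X := (Hinf (adjoint leb2 Om (Lh h))).
Local Notation dist := (@functional _ R2 R).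
Implicit Types (w : dist) (phi : R2 -> C) (psi : R * R -> C).

(** Used for points x and y that differ by a vertical translation. *)
Lemma Ser_scale c (x y : R * R) (z : C) : rapid c ->
  (forall n, Sterm h c n y = z * Sterm h c n x) -> Ser h c y = z * Ser h c x.
Proof.
move=> rc E; have [f1 f2] := summable_fam_Sterm h rc.
have [B1 d1] := summable_fam_dominated x f1; have [B2 d2] := summable_fam_dominated x f2.
have sc (t : nat -> R) (a B : R) : dominated t B -> dominated (fun n => a * t n) (`|a| * B).
  by move=> d n; rewrite normrM -mulrA ler_wpM2l.
apply: eqcP.
  rewrite ReM /Ser /= /fsum -(rsumZ (Re z) d1) -mulNr -(rsum_lin _ (sc _ (Re z) _ d1) d2).
  by congr rsum; apply/funext => n; rewrite /Sterm_re /Sterm_im E ReM mulNr.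
rewrite ImM /Ser /= /fsum -(rsumZ (Re z) d2) -(rsum_lin _ (sc _ (Re z) _ d2) d1).
by congr rsum; apply/funext => n; rewrite /Sterm_re /Sterm_im E ImM.
Qed.

Lemma v1_ex1 hj (k : int) (x : R) : 0 < hj -> v1 hj (- k) x = ex1 (- freq hj k) x.
Proof. by move=> h0; rewrite v1E// opprK. Qed.

(** The coefficients of the product are those of [p], placed on the
    horizontal line at height k; so the product is represented by a series
    whose terms all gain the same factor under a vertical translation. *)
Lemma tensor (p : R1 -> C) (k : int) : Hinf (adj1 h.1) p -> exists psi,
  qrep h (fun x : R2 => p x.1 * v1 h.2 (- k) x.2) psi /\
  forall (x : R * R) (s : R), psi (x.1, x.2 - s) = cexp (freq h.2 k * s%:C) * psi x.
Proof.
move=> hp; set F := (fun x : R2 => _).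
have p2 : L2 leb I p by have [g [f' [? _ _] _]] := hp 1%N isT.
have ip := L2_cintegrable1 p2.
have FE : F = (fun x : R2 => p x.1 * ex1 (- freq h.2 k) x.2).
  by apply/funext => x; rewrite /F v1_ex1.
have iF : cintegrable leb2 Om F.
  rewrite FE; have [] := prod_complex ip (cmeas_ex1 (- freq h.2 k)) (ex1_bdd _); exact.
have cF xi : coef h F xi = coef1 h.1 p xi.1 * (if xi.2 == k then 1 else 0).
  rewrite -subr_eq0 -int_char_I.
  have [_ <-] := prod_complex (cintegrableM_ex1 (freq h.1 xi.1) ip)
     (cmeas_ex1 (0 +i* (2 * pi * (xi.2 - k)%:~R))) (ex1_bdd _).
  apply: eq_cintegral => x _; rewrite FE.
  have e : ex1 (- freq h.2 k) x.2 * uu h xi x =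
      ex1 (freq h.1 xi.1) x.1 * ex1 (0 +i* (2 * pi * (xi.2 - k)%:~R)) x.2.
    rewrite /ex1 /uu /ex2 -!cexpD; congr cexp.
    by apply: eqcP; rewrite /freq !cE ?intrB; ring.
  by rewrite -(mulrA (p x.1)) e mulrA.
have rF : rapid (coef h F).
  move=> m; have [B B0 hB] := coef1_decay m h1_gt0 hp.
  exists (B * (1 + k%:~R ^+ 2) ^+ m) => xi; rewrite cF.
  have k0 : 0 <= 1 + k%:~R ^+ 2 :> R by rewrite addr_ge0 ?sqr_ge0.
  case: eqP => [e|_]; last first.
    by rewrite mulr0 normc0 mul0r; apply: mulr_ge0 => //; exact: exprn_ge0.
  rewrite mulr1; apply: (@le_trans _ _ (normc (coef1 h.1 p xi.1) * ((1 + xi.1%:~R ^+ 2) ^+ m * (1 + k%:~R ^+ 2) ^+ m))).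
    apply: ler_wpM2l; first exact: normc_nneg.
    rewrite -exprMn; apply: lerXn2r; rewrite ?nnegrE ?wt_ge0//.
      by apply: mulr_ge0 => //; rewrite addr_ge0 ?sqr_ge0.
    rewrite /wt e; have := sqr_ge0 (k%:~R : R); have := sqr_ge0 (xi.1%:~R : R); nra.
  by rewrite mulrA; apply: ler_wpM2r; [exact: exprn_ge0|exact: hB].
exists (Ser h (coef h F)); split.
  split.
  - exact: cintegrable_meas iF.
  - exact: Q_Ser.
  - apply: (coef_unique (h := h)) => //; first exact/smooth2_cintegrable/smooth2_Ser.
    by move=> xi; rewrite coef_Ser.
move=> x s; apply: Ser_scale => // n; rewrite /Sterm; case: ifP => _; last by rewrite mulr0.
rewrite cF; case: eqP => [e|_]; last by rewrite mulr0 !mul0r mulr0.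
rewrite [RHS]mulrCA [RHS]mulrA [X in _ = X]mulrAC -[RHS]mulrA; set c := coef1 _ _ _ * 1.
suff -> : ev h (dec n) (x.1, x.2 - s) = ev h (dec n) x * cexp (freq h.2 k * s%:C) by [].
rewrite /ev /ex2 -cexpD e; congr cexp.
by apply: eqcP; rewrite /freq !cE /=; ring.
Qed.

Section Shear.
Variables (a A : R -> R).
Hypotheses (sa : smooth1 a) (pa : forall x, a (x + 1) = a x).
Hypotheses (sA : smooth1 A) (pA : forall x, A (x + 1) = A x).
Hypothesis AE : forall x, 0 < x < 1 -> A x = Aprim a x.
Hypothesis dA : derive1 A = fun x => a x - mean a.

Local Notation Psi := (shear h A).
Local Notation Psi' := (shear h (fun x => - A x)).
Local Notation P := (Pop a).
Local Notation P0 := (Pop (fun=> mean a)).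

Let sN : smooth1 (fun x => - A x).
Proof.
have e n : derive1n n (fun x => - A x) = (fun x => - derive1n n A x).
  elim: n => [//|n IH]; apply/funext => x; rewrite derive1nS IH derive1E.
  have dn : is_derive x 1 (derive1n n A) (derive1n n.+1 A x).
    by rewrite derive1nS derive1E; exact/derivableP/sA.
  by have := is_deriveN dn => dn'; rewrite (@derive_val _ _ _ _ _ _ _ dn').
by move=> n x; rewrite e; apply: derivableN; exact: sA.
Qed.

Let pN x : - A (x + 1) = - A x. Proof. by rewrite pA. Qed.

Let sm : smooth1 (fun=> mean a).
Proof.
have e n : derive1n n.+1 (fun=> mean a : R) = (fun=> 0).
  elim: n => [|n IH]; apply/funext => x; first by rewrite derive1n1 derive1_cst.
  by rewrite derive1nS IH derive1_cst.
by move=> [|n] x; [exact: derivable_cst|rewrite e; exact: derivable_cst].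
Qed.

Let pm (x : R) : mean a = mean a. Proof. by []. Qed.

(** The shear translates x_2 by A(x_1), and the representative given by
    [tensor] gains the required factor. *)
Lemma is_Psi_shear w : Hminf2 h w -> is_Psi h a w (Psi w).
Proof.
move=> hw k p hp; have [psi [r E]] := tensor k hp.
rewrite /F2 /muld (shearE h1_gt0 h2_gt0 _ _ r); apply/esym/(w_ext h1_gt0 h2_gt0 hw).
have [m q ae] := r; pose z := freq h.2 k.
have cz : cCk 0 (fun x : R * R => ex1 z (A x.1)).
  have cA : continuous (fun x : R * R => A x.1).
    by move=> x; apply: continuous_comp; [exact: cvg_fst|exact: smooth1_cont].
  split; split => // x.
    by apply: (@continuous_comp _ _ _ (fun x : R * R => A x.1) (fun t => Re (ex1 z t))); [exact: cA|exact: ex1_contRe].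
  by apply: (@continuous_comp _ _ _ (fun x : R * R => A x.1) (fun t => Im (ex1 z t))); [exact: cA|exact: ex1_contIm].
split.
- have [m1 m2] : cmeas Om (fun x : R2 => ex1 z (A x.1) * (p x.1 * v1 h.2 (- k) x.2)).
    by apply: cmeasM => //; exact: cCk0_meas.
  have e x : x \in Om -> ex1 z (A x.1) * (p x.1 * v1 h.2 (- k) x.2) =
      cexp (freq h.2 k * (Aprim a x.1)%:C) * p x.1 * v1 h.2 (- k) x.2.
    by rewrite inE => -[x1 _]; rewrite mulrA /ex1 AE.
  by split; [apply: eq_measurable_fun m1|apply: eq_measurable_fun m2] => x Ox /=; rewrite e.
- exact: Q_shear.
- apply: filterS ae => x e Ox; have := E x (A x.1); rewrite /shear_map => ->.
  by rewrite -(e Ox) mulrA AE//; case: Ox.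
Qed.

Lemma tPop_shear psi : Q h psi ->
  tPop a (fun x => psi (shear_map A x)) = (fun x => tPop (fun=> mean a) psi (shear_map A x)).
Proof.
move=> [sp _]; have [e1 e2] := pd_shear sA sp.
have e (u v : R) : (- (u - v))%:C = v%:C - u%:C by rewrite opprB rmorphB.
by apply/funext => x; rewrite /tPop e1 e2 dA e; ring.
Qed.

Lemma Psi_P w : Hminf2 h w -> eqd2 h (P0 (Psi w)) (Psi (P w)).
Proof.
move=> hw phi Xp; have r := qp_repP h1_gt0 h2_gt0 Xp; have [_ q _] := r.
have qs := Q_shear sA pA q.
rewrite (PopE h1_gt0 h2_gt0 sm pm (shear_Hminf h1_gt0 h2_gt0 sA pA hw) r).
have qt := adm_Q (adm_tPop h sm pm) q.
rewrite (shearE h1_gt0 h2_gt0 _ _ (Q_qrep qt)) (shearE h1_gt0 h2_gt0 _ _ r).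
by rewrite (PopE h1_gt0 h2_gt0 sa pa hw (Q_qrep qs)) tPop_shear.
Qed.

Lemma Psi'K w : Hminf2 h w -> eqd2 h (Psi' (Psi w)) w.
Proof.
move=> hw phi Xp; have r := qp_repP h1_gt0 h2_gt0 Xp; have [_ q _] := r.
rewrite (shearE h1_gt0 h2_gt0 _ _ r).
rewrite (shearE h1_gt0 h2_gt0 _ _ (Q_qrep (Q_shear sN pN q))) (w_ext h1_gt0 h2_gt0 hw r).
by congr w; apply/funext => -[x y]; rewrite /shear_map /= opprK subrK.
Qed.

Lemma PsiK' w : Hminf2 h w -> eqd2 h (Psi (Psi' w)) w.
Proof.
move=> hw phi Xp; have r := qp_repP h1_gt0 h2_gt0 Xp; have [_ q _] := r.
rewrite (shearE h1_gt0 h2_gt0 _ _ r).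
rewrite (shearE h1_gt0 h2_gt0 _ _ (Q_qrep (Q_shear sA pA q))) (w_ext h1_gt0 h2_gt0 hw r).
by congr w; apply/funext => -[x y]; rewrite /shear_map /= opprK addrK.
Qed.

Lemma shear_eqd B w w' : smooth1 B -> (forall x, B (x + 1) = B x) ->
  eqd2 h w w' -> eqd2 h (shear h B w) (shear h B w').
Proof.
move=> sB pB E phi Xp; apply: E.
by have [_ q _] := qp_repP h1_gt0 h2_gt0 Xp; apply: (Q_X (Q_shear sB pB q)).
Qed.

Lemma Pop_eqd b w w' : smooth1 b -> (forall x, b (x + 1) = b x) -> Hminf2 h w -> Hminf2 h w' ->
  eqd2 h w w' -> eqd2 h (Pop b w) (Pop b w').
Proof.
move=> sb pb hw hw' E phi Xp; have r := qp_repP h1_gt0 h2_gt0 Xp; have [_ q _] := r.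
rewrite (PopE h1_gt0 h2_gt0 sb pb hw r) (PopE h1_gt0 h2_gt0 sb pb hw' r); apply: E.
by apply: (Q_X (adm_Q (adm_tPop h sb pb) q)).
Qed.

Lemma fourier_P0 w xi : Hminf2 h w -> fourier h (P0 w) xi = sigmaP0 h (mean a) xi * fourier h w xi.
Proof.
move=> hw; have q := Q_ev xi h1_gt0 h2_gt0.
rewrite !(fourierE h1_gt0 h2_gt0) (PopE h1_gt0 h2_gt0 sm pm hw (Q_qrep q)).
rewrite -(wZ _ hw (Q_X q)); congr w; apply/funext => x.
by rewrite /tPop /sigmaP0 /ev !ex2_pd /zc /=; ring.
Qed.

Lemma E0_eqd w w' : Hminf2 h w' -> eqd2 h w w' -> E0 h (mean a) w -> E0 h (mean a) w'.
Proof.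
move=> hw' E [hw F]; split => // xi /F; rewrite !(fourierE h1_gt0 h2_gt0) E//.
exact/Q_X/Q_ev.
Qed.

Lemma E0_P0 w : Hminf2 h w -> E0 h (mean a) (P0 w).
Proof.
move=> hw; split; first exact: Pop_Hminf.
by move=> xi s0; rewrite fourier_P0// s0 mul0r.
Qed.

(** [ev h xi] is the product of the exponential with frequency xi_1, a test
    function of one variable, and the exponential used in the definition of
    F_2. *)
Lemma is_Psi_unique f g : Hminf2 h f -> Hminf2 h g -> is_Psi h a f g -> eqd2 h g (Psi f).
Proof.
move=> hf hg fg; apply: w_dense => //; first exact: shear_Hminf.
move=> xi; have H1 := Hinf1_ex1 xi.1 h1_gt0.
have e : ev h xi = (fun x => ex1 (- freq h.1 xi.1) x.1 * v1 h.2 (- xi.2) x.2).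
  by apply/funext => x; rewrite v1_ex1// /ex1 -cexpD.
have := fg xi.2 _ H1; have := is_Psi_shear hf xi.2 H1; rewrite /F2 -e.
by move=> -> ->.
Qed.

(** By uniqueness, the auxiliary distribution in the definition of F can only
    be [Psi f]. *)
Lemma FFP f : Hminf2 h f -> FF h a f <-> E0 h (mean a) (Psi f).
Proof.
move=> hf; have hP := shear_Hminf h1_gt0 h2_gt0 sA pA hf; split.
  by move=> [_ [g eg fg]]; have [hg _] := eg; apply: E0_eqd eg => //; exact: is_Psi_unique.
by move=> e; split => //; exists (Psi f) => //; exact: is_Psi_shear.
Qed.

(** The solutions correspond under w |-> Psi w, and the right-hand sides
    under f |-> Psi f. *)
Lemma solvable_equiv : P_solvable h a <-> P0_solvable h a.
Proof.
have hPsi w := @shear_Hminf R h h1_gt0 h2_gt0 A w sA pA.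
have hPsi' w := @shear_Hminf R h h1_gt0 h2_gt0 _ w sN pN.
have hP w := @Pop_Hminf R h h1_gt0 h2_gt0 a w sa pa.
have hP0 w := @Pop_Hminf R h h1_gt0 h2_gt0 _ w sm pm.
split => -[_ sol]; split.
- by move=> w hw; split; [exact: hP0|exact: E0_P0].
- move=> g eg; have [hg _] := eg.
  have fg : FF h a (Psi' g).
    apply/FFP; first exact: hPsi'.
    apply: E0_eqd eg; first exact/hPsi/hPsi'.
    by move=> phi Xp; rewrite PsiK'.
  have [w hw Pw] := sol _ fg; exists (Psi w); first exact: hPsi.
  move=> phi Xp; rewrite (Psi_P hw Xp) (shear_eqd sA pA Pw Xp).
  exact: PsiK'.
- move=> w hw; split; first exact: hP.
  apply/FFP; first exact: hP.
  apply: E0_eqd (E0_P0 (hPsi _ hw)); first exact/hPsi/hP.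
  exact: Psi_P.
- move=> f ff; have [hf _] := ff; have /(FFP hf) eg := ff.
  have [w0 hw0 Pw0] := sol _ eg; have hw := hPsi' _ hw0; exists (Psi' w0) => // phi Xp.
  rewrite -(Psi'K (hP _ hw) Xp) -(Psi'K hf Xp).
  apply: (shear_eqd sN pN _ Xp) => {Xp} {}phi Xp.
  rewrite -(Psi_P hw Xp) -(Pw0 _ Xp).
  exact: (Pop_eqd sm pm (hPsi _ hw) hw0 (PsiK' hw0) Xp).
Qed.

End Shear.
End Main.

Theorem theorem4p19 (R : realType) (h : R * R) (a : R -> R)
    (h1_gt0 : 0 < h.1) (h2_gt0 : 0 < h.2) (a_smooth : smooth_periodic a) :
  P_solvable h a <-> P0_solvable h a.
Proof.
have [pa sa] := a_smooth.
apply: (solvable_equiv h1_gt0 h2_gt0 sa pa (A := perprim a)).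
- exact: perprim_smooth.
- exact: perprim_per.
- by move=> x; exact: perprim_Aprim.
- exact: perprim_derive1.
Qed.
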